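(* Let $0<\gamma\le\pi\le\beta\le2\pi$. Then the Hardy constant of the domain $E_{\beta,\gamma}$ equals $c_\beta$.
   Context: For angles $\beta,\gamma>0$ with $\beta\ge\pi$ and $\beta+\gamma\le3\pi$, let $O=(0,0)$, $P=(1,0)$, $L_2$ the segment $[O,P]$, $L_3=\{t(\cos\beta,\sin\beta):t\ge0\}$ and $L_1=\{(1-t\cos\gamma,\ t\sin\gamma): t\ge0\}$ (the halflines $L_1,L_3$ do not intersect). $E_{\beta,\gamma}$ is the unbounded domain bounded by $L_3\cup L_2\cup L_1$ which contains the points $(x,y)$ with $0<x<1$ and $y>0$ small; its interior angle at $O$ is $\beta$ and at $P$ is $\gamma$. The Hardy constant of a domain $\Omega\subset\mathbb{R}^2$ is the largest $c\ge0$ such that $\int_\Omega|\nabla u|^2\,dx\ge c\int_\Omega u^2/d^2\,dx$ for all $u\in C_c^\infty(\Omega)$, where $d(x)=\mathrm{dist}(x,\partial\Omega)$. For $\beta\in[\pi,2\pi]$, $\Lambda_\beta=\{(r\cos\theta,r\sin\theta): r>0,\ 0<\theta<\beta\}$ and $c_\beta$ denotes the Hardy constant of $\Lambda_\beta$. It is known that $c_\beta\in(0,1/4]$; $c_\beta=1/4$ for $\pi\le\beta\le\beta_{cr}$, where $\beta_{cr}\in(\pi,2\pi)$ is the unique solution in $(\pi,2\pi)$ of $\tan\big(\frac{\beta_{cr}-\pi}{4}\big)=4\big(\Gamma(3/4)/\Gamma(1/4)\big)^2$; and for $\beta_{cr}\le\beta<2\pi$, $c_\beta$ is the unique solution of $\sqrt{c}\tan\big(\sqrt{c}\,\frac{\beta-\pi}{2}\big)=2\Big(\frac{\Gamma(\frac{3+\sqrt{1-4c}}{4})}{\Gamma(\frac{1+\sqrt{1-4c}}{4})}\Big)^2$.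 *)

(* Defs.v *)
From Stdlib Require Import Reals Lra ClassicalEpsilon List.
Import ListNotations.
Open Scope R_scope.

Definition pt := (R * R)%type.

Definition edist (z w : pt) : R :=
  sqrt ((fst z - fst w)^2 + (snd z - snd w)^2).

Definition is_inf (A : R -> Prop) (m : R) : Prop :=
  (forall t, A t -> m <= t) /\ (forall m', (forall t, A t -> m' <= t) -> m' <= m).

Definition boundary (Om : pt -> Prop) (z : pt) : Prop :=
  forall eps, 0 < eps ->
    (exists w, edist z w < eps /\ Om w) /\ (exists w, edist z w < eps /\ ~ Om w).

Definition dist_set (S : pt -> Prop) (z : pt) : R :=
  epsilon (inhabits 0) (fun m => is_inf (fun t => exists s, S s /\ t = edist z s) m).

Definition dist_bd (Om : pt -> Prop) (z : pt) : R := dist_set (boundary Om) z.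

Definition closed_set (K : pt -> Prop) : Prop :=
  forall z, ~ K z -> exists eps, 0 < eps /\ forall w, edist z w < eps -> ~ K w.
Definition bounded_set (K : pt -> Prop) : Prop :=
  exists M, forall z, K z -> edist z (0,0) <= M.

Definition cont2 (f : pt -> R) : Prop :=
  forall z eps, 0 < eps -> exists del, 0 < del /\
    forall w, edist z w < del -> Rabs (f w - f z) < eps.

(* C^infinity: D is a family of all iterated partial derivatives of u,
   indexed by words (true = d/dx, false = d/dy), applied innermost-first:
   D (true :: w) = d/dx (D w), D (false :: w) = d/dy (D w). *)
Definition smooth_family (u : pt -> R) (D : list bool -> pt -> R) : Prop :=
  D nil = u /\
  forall w, cont2 (D w) /\
    (forall x y, derivable_pt_lim (fun t => D w (t, y)) x (D (true :: w) (x, y))) /\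
    (forall x y, derivable_pt_lim (fun t => D w (x, t)) y (D (false :: w) (x, y))).

Definition smooth (u : pt -> R) : Prop := exists D, smooth_family u D.

Definition compact_support_in (Om : pt -> Prop) (u : pt -> R) : Prop :=
  exists K : pt -> Prop, closed_set K /\ bounded_set K /\
    (forall z, K z -> Om z) /\ (forall z, ~ K z -> u z = 0).

(* Lebesgue integral over R^2 of a compactly supported (continuous) function,
   computed as an iterated Riemann integral over a square containing the support. *)
Definition Int2 (f : pt -> R) (I : R) : Prop :=
  exists M, 0 < M /\
    (forall x y, (M < Rabs x \/ M < Rabs y) -> f (x, y) = 0) /\
    exists g : R -> R,
      (forall x, exists pr : Riemann_integrable (fun y => f (x, y)) (- M) M,
                   RiemannInt pr = g x) /\
      exists pr : Riemann_integrable g (- M) M, RiemannInt pr = I.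

Definition hardy_ineq (Om : pt -> Prop) (c : R) : Prop :=
  forall (u : pt -> R) (D : list bool -> pt -> R),
    smooth_family u D -> compact_support_in Om u ->
    forall I1 I2,
      Int2 (fun z => (D (true :: nil) z)^2 + (D (false :: nil) z)^2) I1 ->
      Int2 (fun z => (u z)^2 / (dist_bd Om z)^2) I2 ->
      c * I2 <= I1.

Definition hardy_constant (Om : pt -> Prop) (H : R) : Prop :=
  is_lub (fun c => 0 <= c /\ hardy_ineq Om c) H.

Definition Lambda (beta : R) (z : pt) : Prop :=
  exists r th, 0 < r /\ 0 < th /\ th < beta /\ z = (r * cos th, r * sin th).

Definition L1 (gamma : R) (z : pt) : Prop :=
  exists t, 0 <= t /\ z = (1 - t * cos gamma, t * sin gamma).
Definition L2 (z : pt) : Prop := 0 <= fst z <= 1 /\ snd z = 0.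
Definition L3 (beta : R) (z : pt) : Prop :=
  exists t, 0 <= t /\ z = (t * cos beta, t * sin beta).
Definition Gam (beta gamma : R) (z : pt) : Prop := L1 gamma z \/ L2 z \/ L3 beta z.

Definition path_avoiding (G : pt -> Prop) (z w : pt) : Prop :=
  exists p1 p2 : R -> R, continuity p1 /\ continuity p2 /\
    (p1 0, p2 0) = z /\ (p1 1, p2 1) = w /\
    forall t, 0 <= t <= 1 -> ~ G (p1 t, p2 t).

(* E_{β,γ}: the connected component of R^2 \ (L3 ∪ L2 ∪ L1) containing the
   points (1/2, y) with y > 0 small. *)
Definition E (beta gamma : R) (z : pt) : Prop :=
  exists eta, 0 < eta /\
    forall y, 0 < y < eta -> path_avoiding (Gam beta gamma) z (1/2, y).

(* Main.v *)
Require Import Defs.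
From Stdlib Require Import Reals Lra Lia List ClassicalEpsilon FunctionalExtensionality.
From Coquelicot Require Import Coquelicot.
Open Scope R_scope.

(* Near O the domain E coincides with the sector, so dilating test functions towards O transfers
   every Hardy inequality from E to the sector.  Conversely, let c be admissible for the sector and
   c' < c.  Testing with products X(ln r) Psi(theta), with X stretched, gives the one-dimensional
   Hardy inequality on (0, beta) with weight 1 / s^2, where s(theta) is the distance to the boundary
   at r = 1.  By a Sturm argument c <= 1/4 and the symmetric solution Y of Y'' + (c1 / s^2) Y = 0,
   c' < c1 < c, built from a power series, is positive.  Then T1 = grad ln Y(theta) satisfies
   div T1 + |T1|^2 = - c1 / d^2 with d the distance to the sides of the sector.  Where L1 is nearer
   than these sides, T1 is exchanged, by a cutoff in the ratio of the two distances, for the field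
   T2 = k2(theta') grad theta' about the mirror centre O' on the line of L1 at distance 1 behind P,
   where k2 is a majorant of Y'/Y on (0, pi/2) for which sin k2 is decreasing.  The transition only
   adds a term with the sign of the flux of T1 - T2 across the level lines of the ratio, and that
   sign is the right one.  A field with div T + |T|^2 <= - c / d^2 yields the Hardy inequality. *)

(** * Iterated integrals over squares *)

(** The two constants are only compared, so c_beta is never computed. Suprema tolerate the loss from
    c to c' < c, and this loss pays for the width of the transition zone and for the gap in the
    Sturm comparison. The bound c <= 1/4 makes the exponent of Y at the sides real and keeps sqrt c1
    below 1/2, so that Y is positive wherever the vertex is the nearest boundary point. The mirror
    centre lies at distance 1 from P because O does: O' is the image of O under the rotation about P
    that carries the direction of L2 to that of L1. The angles under which a point sees OP and O'P
    can then be compared. Since |T|^2 is convex, mixing T1 and T2 costs nothing except the term with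
    the gradient of the cutoff. Ordering the fluxes means comparing sin k at two different angles,
    and sin Y'/Y may increase near 0; a field needs only the Riccati inequality, which leaves room
    for a majorant. All integrals are iterated Riemann integrals over squares. A change to polar
    coordinates is avoided: integrals of products are related to each other by subtracting
    divergences of compactly supported fields. *)

Definition iint (M : R) (f : pt -> R) : R :=
  RInt (fun x => RInt (fun y => f (x, y)) (- M) M) (- M) M.

Definition box_supported (M : R) (f : pt -> R) : Prop :=
  forall x y, M < Rabs x \/ M < Rabs y -> f (x, y) = 0.

Definition box_integrable (M : R) (f : pt -> R) : Prop :=
  (forall x, ex_RInt (fun y => f (x, y)) (- M) M) /\
  ex_RInt (fun x => RInt (fun y => f (x, y)) (- M) M) (- M) M.

Lemma RInt_widen (f : R -> R) (M N : R) :
  0 < M -> M <= N -> (forall x, M < Rabs x -> f x = 0) -> ex_RInt f (- M) M ->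
  ex_RInt f (- N) N /\ RInt f (- N) N = RInt f (- M) M.
Proof.
  intros HM HN Hf Hi.
  assert (L : is_RInt f (- N) (- M) 0).
  { apply is_RInt_ext with (fun _ : R => 0).
    - rewrite Rmin_left, Rmax_right by lra. intros x Hx.
      symmetry; apply Hf. rewrite Rabs_left; lra.
    - evar_last. apply @is_RInt_const. unfold scal; simpl; unfold mult; simpl; ring. }
  assert (U : is_RInt f M N 0).
  { apply is_RInt_ext with (fun _ : R => 0).
    - rewrite Rmin_left, Rmax_right by lra. intros x Hx.
      symmetry; apply Hf. rewrite Rabs_right; lra.
    - evar_last. apply @is_RInt_const. unfold scal; simpl; unfold mult; simpl; ring. }
  assert (T : is_RInt f (- N) N (RInt f (- M) M)).
  { apply (RInt_correct f) in Hi.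
    pose proof (is_RInt_Chasles _ _ _ _ _ _ (is_RInt_Chasles _ _ _ _ _ _ L Hi) U) as H.
    evar_last. exact H. unfold plus; simpl. ring. }
  split. eexists; exact T. now apply is_RInt_unique.
Qed.

Lemma box_widen (f : pt -> R) (M N : R) :
  0 < M -> M <= N -> box_supported M f -> box_integrable M f ->
  box_supported N f /\ box_integrable N f /\ iint N f = iint M f.
Proof.
  intros HM HN Hs [Hi1 Hi2].
  assert (E1 : forall x, ex_RInt (fun y => f (x, y)) (- N) N /\
      RInt (fun y => f (x, y)) (- N) N = RInt (fun y => f (x, y)) (- M) M).
  { intros x. apply RInt_widen; auto. }
  assert (E2 : (fun x => RInt (fun y => f (x, y)) (- N) N) =
               (fun x => RInt (fun y => f (x, y)) (- M) M)).
  { apply functional_extensionality. intros x. apply E1. }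
  assert (E3 : ex_RInt (fun x => RInt (fun y => f (x, y)) (- M) M) (- N) N /\
     RInt (fun x => RInt (fun y => f (x, y)) (- M) M) (- N) N =
     RInt (fun x => RInt (fun y => f (x, y)) (- M) M) (- M) M).
  { apply RInt_widen; auto. intros x Hx.
    rewrite (RInt_ext _ (fun _ => 0)) by (intros; apply Hs; auto).
    rewrite RInt_const. unfold scal; simpl; unfold mult; simpl; ring. }
  split; [|split; [split|]].
  - intros x y Hxy. apply Hs. lra.
  - intros x; apply E1.
  - rewrite E2. apply E3.
  - unfold iint. rewrite E2. apply E3.
Qed.

Lemma Int2_iint (f : pt -> R) (I : R) :
  Int2 f I <-> exists M, 0 < M /\ box_supported M f /\ box_integrable M f /\ iint M f = I.
Proof.
  split.
  - intros (M & HM & Hs & g & Hg & pr & HI). exists M.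
    assert (G : (fun x => RInt (fun y => f (x, y)) (- M) M) = g).
    { apply functional_extensionality. intros x. destruct (Hg x) as [p Hp].
      rewrite <- Hp. apply RInt_Reals. }
    repeat split; auto.
    + intros x. destruct (Hg x) as [p _]. apply ex_RInt_Reals_1; exact p.
    + rewrite G. apply ex_RInt_Reals_1; exact pr.
    + unfold iint. rewrite G, <- HI. apply RInt_Reals.
  - intros (M & HM & Hs & [Hi1 Hi2] & HI). exists M. repeat split; auto.
    exists (fun x => RInt (fun y => f (x, y)) (- M) M). split.
    + intros x. exists (ex_RInt_Reals_0 _ _ _ (Hi1 x)). symmetry. apply RInt_Reals.
    + exists (ex_RInt_Reals_0 _ _ _ Hi2). rewrite <- HI. symmetry. apply RInt_Reals.
Qed.

(** Each [Int2] chooses its own square, while two integrals can be compared only on a common one;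
    hence a threshold beyond which every square serves. *)
Lemma Int2_eventually (f : pt -> R) (I : R) :
  Int2 f I -> exists M0, 0 < M0 /\ forall M, M0 <= M ->
    box_supported M f /\ box_integrable M f /\ iint M f = I.
Proof.
  intros (M & HM & Hs & Hi & HI)%Int2_iint. exists M. split; auto.
  intros N HN. rewrite <- HI. now apply box_widen.
Qed.

Lemma iint_linear (M c : R) (f g : pt -> R) :
  box_integrable M f -> box_integrable M g ->
  box_integrable M (fun z => f z + c * g z) /\
  iint M (fun z => f z + c * g z) = iint M f + c * iint M g.
Proof.
  intros [F1 F2] [G1 G2].
  assert (A : forall x, is_RInt (fun y => f (x, y) + c * g (x, y)) (- M) M
     (RInt (fun y => f (x, y)) (- M) M + c * RInt (fun y => g (x, y)) (- M) M)).
  { intros x. apply @is_RInt_plus; [|apply @is_RInt_scal]; apply @RInt_correct; auto. }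
  assert (B : (fun x => RInt (fun y => f (x, y) + c * g (x, y)) (- M) M) =
     (fun x => RInt (fun y => f (x, y)) (- M) M + c * RInt (fun y => g (x, y)) (- M) M)).
  { apply functional_extensionality. intros x. now apply is_RInt_unique. }
  assert (C : is_RInt (fun x => RInt (fun y => f (x, y) + c * g (x, y)) (- M) M) (- M) M
                (iint M f + c * iint M g)).
  { rewrite B. apply @is_RInt_plus; [|apply @is_RInt_scal]; apply @RInt_correct; auto. }
  split; [split|].
  - intros x. eexists; apply A.
  - eexists; apply C.
  - unfold iint at 1. apply is_RInt_unique, C.
Qed.

Lemma iint_le (M : R) (f g : pt -> R) :
  0 < M -> box_integrable M f -> box_integrable M g -> (forall z, f z <= g z) ->
  iint M f <= iint M g.
Proof.
  intros HM [F1 F2] [G1 G2] H. apply RInt_le; auto. lra.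
  intros x _. apply RInt_le; auto. lra.
Qed.

Lemma iint_zero (M : R) : iint M (fun _ => 0) = 0.
Proof.
  unfold iint. rewrite (RInt_ext _ (fun _ => 0)).
  - rewrite RInt_const. unfold scal; simpl; unfold mult; simpl; ring.
  - intros. rewrite RInt_const. unfold scal; simpl; unfold mult; simpl; ring.
Qed.

Lemma continuous_slice_y (f : pt -> R) (x y : R) :
  continuous f (x, y) -> continuous (fun t => f (x, t)) y.
Proof.
  intros H. apply (continuous_comp_2 (fun _ => x) (fun t => t) (fun a b => f (a, b))).
  - apply continuous_const.
  - apply continuous_id.
  - apply continuous_ext with f; auto. now intros [a b].
Qed.

Lemma continuity_2d_continuous (f : pt -> R) (x y : R) :
  continuous f (x, y) <-> continuity_2d_pt (fun u v => f (u, v)) x y.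
Proof.
  rewrite continuity_2d_pt_filterlim. unfold continuous. split; intros H.
  - eapply filterlim_ext; [|exact H]. now intros [a b].
  - eapply filterlim_ext; [|exact H]. now intros [a b].
Qed.

Lemma continuous_RInt_param (f : pt -> R) (a b x : R) :
  (forall z, continuous f z) -> continuous (fun x => RInt (fun y => f (x, y)) a b) x.
Proof.
  intros Hf. apply continuity_pt_filterlim. intros eps Heps.
  set (e := eps / (Rabs (b - a) + 1)).
  assert (Hp : 0 < Rabs (b - a) + 1) by (pose proof (Rabs_pos (b - a)); lra).
  assert (He : 0 < e) by (apply Rdiv_lt_0_compat; lra).
  destruct (uniform_continuity_2d (fun u v => f (u, v)) (x - 1) (x + 1) (Rmin a b) (Rmax a b))
    with (eps := mkposreal e He) as [del Hdel].
  { intros. apply continuity_2d_continuous, Hf. }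
  exists (Rmin del 1). split. apply Rmin_pos; [apply cond_pos | lra].
  intros u [_ Hu]. simpl in Hu. unfold R_dist in *.
  assert (Hu1 : Rabs (u - x) < del) by (eapply Rlt_le_trans; [exact Hu | apply Rmin_l]).
  assert (Hu2 : Rabs (u - x) < 1) by (eapply Rlt_le_trans; [exact Hu | apply Rmin_r]).
  apply Rabs_def2 in Hu2.
  assert (ex : forall w, ex_RInt (fun y => f (w, y)) a b).
  { intros w. apply @ex_RInt_continuous. intros y _. apply continuous_slice_y, Hf. }
  simpl. unfold R_dist. rewrite <- (RInt_minus (fun y => f (u, y)) (fun y => f (x, y))) by auto.
  assert (Q : norm (RInt (fun y => minus (f (u, y)) (f (x, y))) a b) <= Rabs (b - a) * e).
  { eapply norm_RInt_le_const_abs with (f := fun y => minus (f (u, y)) (f (x, y))).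
    - intros y Hy. left. change (Rabs (f (u, y) - f (x, y)) < e).
      apply Hdel; try lra. rewrite Rminus_diag, Rabs_R0. apply cond_pos.
    - apply @RInt_correct, @ex_RInt_minus; auto. }
  change (Rabs (RInt (fun y => minus (f (u, y)) (f (x, y))) a b) < eps).
  eapply Rle_lt_trans; [exact Q|]. unfold e.
  apply Rmult_lt_reg_r with (Rabs (b - a) + 1); auto. field_simplify; lra.
Qed.

Lemma box_integrable_continuous (M : R) (f : pt -> R) :
  (forall z, continuous f z) -> box_integrable M f.
Proof.
  intros Hf. split.
  - intros x. apply @ex_RInt_continuous. intros y _. apply continuous_slice_y, Hf.
  - apply @ex_RInt_continuous. intros x _. now apply continuous_RInt_param.
Qed.

Lemma RInt_derivative_vanishing (f df : R -> R) (M : R) :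
  (forall x, is_derive f x (df x)) -> (forall x, continuous df x) ->
  f (- M) = 0 -> f M = 0 -> RInt df (- M) M = 0.
Proof.
  intros Hd Hc H1 H2.
  rewrite (is_RInt_unique _ _ _ _ (is_RInt_derive f df (- M) M (fun x _ => Hd x) (fun x _ => Hc x))).
  unfold minus, plus, opp; simpl. rewrite H1, H2; ring.
Qed.

Lemma iint_partial_y (M N : R) (f fy : pt -> R) :
  (forall x y, is_derive (fun t => f (x, t)) y (fy (x, y))) ->
  (forall z, continuous fy z) -> 0 < N -> N < M -> box_supported N f -> iint M fy = 0.
Proof.
  intros Hd Hc HN HM Hs. unfold iint.
  rewrite (RInt_ext _ (fun _ => 0)).
  - rewrite RInt_const. unfold scal; simpl; unfold mult; simpl; ring.
  - intros x _. apply RInt_derivative_vanishing with (f := fun t => f (x, t)); auto.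
    + intros y. apply continuous_slice_y, Hc.
    + apply Hs. right. rewrite Rabs_left; lra.
    + apply Hs. right. rewrite Rabs_right; lra.
Qed.

(** The inner integral runs over y, so the x-derivative has to be pulled out of it first; the outer
    integral then reduces to boundary values, which vanish because N < M. *)
Lemma iint_partial_x (M N : R) (f fx : pt -> R) :
  (forall x y, is_derive (fun t => f (t, y)) x (fx (x, y))) ->
  (forall z, continuous f z) ->
  (forall z, continuous fx z) -> 0 < N -> N < M -> box_supported N f -> iint M fx = 0.
Proof.
  intros Hd Hf Hc HN HM Hs. unfold iint.
  assert (D : forall u v, Derive (fun z => f (z, v)) u = fx (u, v)).
  { intros. apply is_derive_unique, Hd. }
  apply RInt_derivative_vanishing with (f := fun x => RInt (fun y => f (x, y)) (- M) M).
  - intros x.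
    evar_last.
    + apply (is_derive_RInt_param (fun x y => f (x, y))).
      * exists (mkposreal 1 Rlt_0_1). intros u _ t _. eexists; apply Hd.
      * intros t _. apply continuity_2d_pt_ext with (fun u v => fx (u, v)).
        intros; symmetry; apply D. apply continuity_2d_continuous, Hc.
      * exists (mkposreal 1 Rlt_0_1). intros u _. apply @ex_RInt_continuous.
        intros y _. apply continuous_slice_y, Hf.
    + apply RInt_ext. intros; apply D.
  - intros x. now apply continuous_RInt_param.
  - rewrite (RInt_ext _ (fun _ => 0)).
    + rewrite RInt_const. unfold scal; simpl; unfold mult; simpl; ring.
    + intros. apply Hs. left. rewrite Rabs_left; lra.
  - rewrite (RInt_ext _ (fun _ => 0)).
    + rewrite RInt_const. unfold scal; simpl; unfold mult; simpl; ring.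
    + intros. apply Hs. left. rewrite Rabs_right; lra.
Qed.

(** The factor N ^ 2 is the Jacobian of the dilation. In dimension two it is also the factor
    produced by |grad u|^2 and by u^2 / d^2, which makes both sides of the Hardy inequality
    invariant under dilations. *)
Lemma Int2_scale (f : pt -> R) (I N : R) :
  0 < N -> Int2 f I -> Int2 (fun z => N^2 * f (N * fst z, N * snd z)) I.
Proof.
  intros HN (M & HM & Hs & [H1 H2] & HI)%Int2_iint. apply Int2_iint.
  exists (M / N).
  assert (HMN : N * (M / N) + 0 = M) by (field; lra).
  assert (HMN' : N * - (M / N) + 0 = - M) by (field; lra).
  assert (A : forall x, is_RInt (fun y => N^2 * f (N * x, N * y)) (- (M / N)) (M / N)
      (N * RInt (fun y => f (N * x, y)) (- M) M)).
  { intros x.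
    assert (Q : is_RInt (fun y => scal N (f (N * x, N * y + 0))) (- (M / N)) (M / N)
       (RInt (fun y => f (N * x, y)) (- M) M)).
    { apply (is_RInt_comp_lin (fun y => f (N * x, y))). rewrite HMN, HMN'. apply @RInt_correct, H1. }
    apply (is_RInt_scal _ _ _ N) in Q.
    eapply is_RInt_ext; [|exact Q]. intros y _. simpl.
    unfold scal; simpl; unfold mult; simpl. rewrite Rplus_0_r. ring. }
  assert (B : is_RInt (fun x => RInt (fun y => N^2 * f (N * x, N * y)) (- (M / N)) (M / N))
     (- (M / N)) (M / N) I).
  { rewrite <- HI. unfold iint.
    assert (Q : is_RInt (fun x => scal N (RInt (fun y => f (N * x + 0, y)) (- M) M))
       (- (M / N)) (M / N) (RInt (fun x => RInt (fun y => f (x, y)) (- M) M) (- M) M)).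
    { apply (is_RInt_comp_lin (fun x => RInt (fun y => f (x, y)) (- M) M)).
      rewrite HMN, HMN'. apply @RInt_correct, H2. }
    eapply is_RInt_ext; [|exact Q]. intros x _. simpl.
    rewrite Rplus_0_r. symmetry. apply is_RInt_unique, A. }
  repeat split.
  - apply Rdiv_lt_0_compat; auto.
  - intros x y Hxy. simpl.
    rewrite (Hs (N * x) (N * y)). ring.
    rewrite !Rabs_mult, (Rabs_right N) by lra.
    assert (S : forall u, M / N < u -> M < N * u).
    { intros u Hu. apply Rmult_lt_compat_l with (r := N) in Hu; auto.
      replace (N * (M / N)) with M in Hu by (field; lra). lra. }
    destruct Hxy; [left | right]; auto.
  - intros x. simpl fst; simpl snd. eexists. exact (A x).
  - simpl fst; simpl snd. eexists. exact B.
  - unfold iint. simpl fst; simpl snd. exact (is_RInt_unique _ _ _ _ B).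
Qed.

(** * Differentiable functions of two variables *)

Lemma edist_ge_coords (z w : pt) :
  Rabs (fst w - fst z) <= edist z w /\ Rabs (snd w - snd z) <= edist z w.
Proof.
  unfold edist. rewrite <- !(sqrt_Rsqr_abs). unfold Rsqr.
  split; apply sqrt_le_1_alt;
  pose proof (pow2_ge_0 (fst z - fst w)); pose proof (pow2_ge_0 (snd z - snd w)); nra.
Qed.

Lemma edist_le_coords (z w : pt) :
  edist z w <= Rabs (fst w - fst z) + Rabs (snd w - snd z).
Proof.
  unfold edist. rewrite <- (sqrt_Rsqr (Rabs _ + Rabs _)).
  - apply sqrt_le_1_alt. unfold Rsqr.
    rewrite <- (pow2_abs (fst z - fst w)), <- (pow2_abs (snd z - snd w)).
    rewrite (Rabs_minus_sym (fst z)), (Rabs_minus_sym (snd z)).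
    pose proof (Rabs_pos (fst w - fst z)); pose proof (Rabs_pos (snd w - snd z)); nra.
  - pose proof (Rabs_pos (fst w - fst z)); pose proof (Rabs_pos (snd w - snd z)); lra.
Qed.

Lemma edist_pos (z w : pt) : 0 <= edist z w.
Proof. apply sqrt_pos. Qed.

Lemma edist_sym (z w : pt) : edist z w = edist w z.
Proof. unfold edist. f_equal. ring. Qed.

Lemma edist_refl (z : pt) : edist z z = 0.
Proof. unfold edist. rewrite <- sqrt_0. f_equal. ring. Qed.

Lemma edist_sqr (z w : pt) : edist z w ^ 2 = (fst z - fst w)^2 + (snd z - snd w)^2.
Proof.
  unfold edist. rewrite pow2_sqrt; auto.
  pose proof (pow2_ge_0 (fst z - fst w)); pose proof (pow2_ge_0 (snd z - snd w)); lra.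
Qed.

Lemma edist_triangle (a b c : pt) : edist a c <= edist a b + edist b c.
Proof.
  apply Rsqr_incr_0_var.
  2: { pose proof (edist_pos a b); pose proof (edist_pos b c); lra. }
  unfold Rsqr. pose proof (edist_sqr a b) as A. pose proof (edist_sqr b c) as B.
  pose proof (edist_sqr a c) as C. pose proof (edist_pos a b) as P; pose proof (edist_pos b c) as Q.
  set (d1 := edist a b) in *. set (d2 := edist b c) in *.
  destruct a as [a1 a2], b as [b1 b2], c as [c1 c2]; simpl in *.
  assert (CS : (a1 - b1) * (b1 - c1) + (a2 - b2) * (b2 - c2) <= d1 * d2).
  { apply Rsqr_incr_0_var; [|nra]. unfold Rsqr.
    pose proof (Rle_0_sqr ((a1 - b1) * (b2 - c2) - (a2 - b2) * (b1 - c1))) as S.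
    unfold Rsqr in S.
    replace (d1 * d2 * (d1 * d2)) with ((d1 * (d1 * 1)) * (d2 * (d2 * 1))) by ring.
    rewrite A, B. nra. }
  nra.
Qed.

Lemma locally_edist (z : pt) (P : pt -> Prop) :
  locally z P <-> exists e, 0 < e /\ forall w, edist z w < e -> P w.
Proof.
  split.
  - intros [e He]. exists e. split. apply cond_pos. intros w Hw. apply He.
    destruct (edist_ge_coords z w) as [H1 H2].
    split; [change (Rabs (fst w - fst z) < e) | change (Rabs (snd w - snd z) < e)]; lra.
  - intros (e & He & H). assert (He2 : 0 < e / 2) by lra.
    exists (mkposreal _ He2). intros w [H1 H2]. apply H.
    apply Rle_lt_trans with (1 := edist_le_coords z w).
    rewrite <- (Rplus_half_diag e). apply Rplus_lt_compat; [exact H1 | exact H2].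
Qed.

Lemma cont2_continuous (f : pt -> R) : cont2 f <-> forall z, continuous f z.
Proof.
  split.
  - intros H z. apply filterlim_locally. intros eps. apply locally_edist.
    destruct (H z eps (cond_pos eps)) as (d & Hd & Q). exists d. split; auto.
  - intros H z eps He. specialize (H z). apply filterlim_locally with (eps := mkposreal eps He) in H.
    apply locally_edist in H. destruct H as (d & Hd & Q). exists d. split; auto.
Qed.

(** First-order data at one point. The partial derivatives are functions rather than numbers so that
    their continuity at [z] can be expressed; the notion is stable under algebra and under local
    changes, which is how all vector fields below are built. *)
Definition PD (f fx fy : pt -> R) (z : pt) : Prop :=
  is_derive (fun t => f (t, snd z)) (fst z) (fx z) /\
  is_derive (fun t => f (fst z, t)) (snd z) (fy z) /\
  continuous f z /\ continuous fx z /\ continuous fy z.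

Lemma locally_slice_x (z : pt) (P : pt -> Prop) :
  locally z P -> locally (fst z) (fun t => P (t, snd z)).
Proof.
  intros [e H]. exists e. intros t Ht. apply H. split; auto. apply ball_center.
Qed.

Lemma locally_slice_y (z : pt) (P : pt -> Prop) :
  locally z P -> locally (snd z) (fun t => P (fst z, t)).
Proof.
  intros [e H]. exists e. intros t Ht. apply H. split; auto. apply ball_center.
Qed.

Lemma PD_ext_loc (f fx fy g gx gy : pt -> R) (z : pt) :
  locally z (fun w => f w = g w /\ fx w = gx w /\ fy w = gy w) ->
  PD f fx fy z -> PD g gx gy z.
Proof.
  intros H (A & B & C & D & E).
  pose proof (locally_singleton _ _ H) as (_ & Hx & Hy).
  assert (H1 : locally z (fun w => f w = g w)) by (eapply filter_imp; [|exact H]; intros w (Q1 & Q2 & Q3); assumption).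
  assert (H2 : locally z (fun w => fx w = gx w)) by (eapply filter_imp; [|exact H]; intros w (Q1 & Q2 & Q3); assumption).
  assert (H3 : locally z (fun w => fy w = gy w)) by (eapply filter_imp; [|exact H]; intros w (Q1 & Q2 & Q3); assumption).
  split; [|split; [|split; [|split]]].
  - rewrite <- Hx. eapply is_derive_ext_loc; [|exact A]. now apply locally_slice_x in H1.
  - rewrite <- Hy. eapply is_derive_ext_loc; [|exact B]. now apply locally_slice_y in H1.
  - eapply continuous_ext_loc; [|exact C]. exact H1.
  - eapply continuous_ext_loc; [|exact D]. exact H2.
  - eapply continuous_ext_loc; [|exact E]. exact H3.
Qed.

Lemma PD_const (c : R) (z : pt) : PD (fun _ => c) (fun _ => 0) (fun _ => 0) z.
Proof.
  split; [|split; [|split; [|split]]]; try apply continuous_const; apply @is_derive_const.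
Qed.

Lemma PD_fst (z : pt) : PD fst (fun _ => 1) (fun _ => 0) z.
Proof.
  destruct z as [x y].
  split; [|split; [|split; [|split]]].
  - exact (@is_derive_id R_AbsRing x).
  - exact (@is_derive_const R_AbsRing R_NormedModule x y).
  - apply continuous_fst.
  - apply continuous_const.
  - apply continuous_const.
Qed.

Lemma PD_snd (z : pt) : PD snd (fun _ => 0) (fun _ => 1) z.
Proof.
  destruct z as [x y].
  split; [|split; [|split; [|split]]].
  - exact (@is_derive_const R_AbsRing R_NormedModule y x).
  - exact (@is_derive_id R_AbsRing y).
  - apply continuous_snd.
  - apply continuous_const.
  - apply continuous_const.
Qed.

Lemma continuous_Rmult (f g : pt -> R) (z : pt) :
  continuous f z -> continuous g z -> continuous (fun w => f w * g w) z.
Proof. intros A B. exact (continuous_mult f g z A B). Qed.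

Lemma continuous_Rplus (f g : pt -> R) (z : pt) :
  continuous f z -> continuous g z -> continuous (fun w => f w + g w) z.
Proof. intros A B. exact (continuous_plus f g z A B). Qed.

Lemma PD_plus (f fx fy g gx gy : pt -> R) (z : pt) :
  PD f fx fy z -> PD g gx gy z ->
  PD (fun w => f w + g w) (fun w => fx w + gx w) (fun w => fy w + gy w) z.
Proof.
  intros (A & B & C & D & E) (A' & B' & C' & D' & E').
  split; [|split; [|split; [|split]]].
  - now apply @is_derive_plus.
  - now apply @is_derive_plus.
  - now apply continuous_Rplus.
  - now apply continuous_Rplus.
  - now apply continuous_Rplus.
Qed.

Lemma PD_mult (f fx fy g gx gy : pt -> R) (z : pt) :
  PD f fx fy z -> PD g gx gy z ->
  PD (fun w => f w * g w) (fun w => fx w * g w + f w * gx w)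
     (fun w => fy w * g w + f w * gy w) z.
Proof.
  intros (A & B & C & D & E) (A' & B' & C' & D' & E').
  split; [|split; [|split; [|split]]].
  - evar_last. apply @is_derive_mult; [exact A | exact A' | intros; apply Rmult_comm].
    destruct z; reflexivity.
  - evar_last. apply @is_derive_mult; [exact B | exact B' | intros; apply Rmult_comm].
    destruct z; reflexivity.
  - now apply continuous_Rmult.
  - apply continuous_Rplus; now apply continuous_Rmult.
  - apply continuous_Rplus; now apply continuous_Rmult.
Qed.

Lemma PD_comp (h dh : R -> R) (f fx fy : pt -> R) (z : pt) :
  is_derive h (f z) (dh (f z)) -> continuous dh (f z) -> PD f fx fy z ->
  PD (fun w => h (f w)) (fun w => dh (f w) * fx w) (fun w => dh (f w) * fy w) z.
Proof.
  intros Hd Hc (A & B & C & D & E).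
  split; [|split; [|split; [|split]]].
  - evar_last. apply (is_derive_comp h (fun t => f (t, snd z))).
    + destruct z; exact Hd.
    + exact A.
    + unfold scal; simpl; unfold mult; simpl. ring.
  - evar_last. apply (is_derive_comp h (fun t => f (fst z, t))).
    + destruct z; exact Hd.
    + exact B.
    + unfold scal; simpl; unfold mult; simpl. ring.
  - apply (continuous_comp f h); auto. apply @ex_derive_continuous. eexists; exact Hd.
  - apply continuous_Rmult; auto. now apply (continuous_comp f dh).
  - apply continuous_Rmult; auto. now apply (continuous_comp f dh).
Qed.

Lemma PD_eq (f fx fy gx gy : pt -> R) (z : pt) :
  (forall w, fx w = gx w) -> (forall w, fy w = gy w) -> PD f fx fy z -> PD f gx gy z.
Proof.
  intros H1 H2. apply PD_ext_loc. apply filter_forall. auto.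
Qed.

Lemma PD_lin (a b c : R) (z : pt) :
  PD (fun w => a * fst w + b * snd w + c) (fun _ => a) (fun _ => b) z.
Proof.
  eapply PD_eq; [| |
    apply (PD_plus _ _ _ _ _ _ z
      (PD_plus _ _ _ _ _ _ z
        (PD_mult _ _ _ _ _ _ z (PD_const a z) (PD_fst z))
        (PD_mult _ _ _ _ _ _ z (PD_const b z) (PD_snd z)))
      (PD_const c z))]; intros; simpl; ring.
Qed.

Lemma PD_inv (f fx fy : pt -> R) (z : pt) :
  f z <> 0 -> PD f fx fy z ->
  PD (fun w => / f w) (fun w => - / (f w)^2 * fx w) (fun w => - / (f w)^2 * fy w) z.
Proof.
  intros Hf H. apply (PD_comp Rinv (fun u => - / u^2)); auto.
  - auto_derive; auto. field; auto.
  - apply @ex_derive_continuous. auto_derive. repeat split; nra.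
Qed.

Lemma smooth_family_PD (u : pt -> R) (D : list bool -> pt -> R) (w : list bool) (z : pt) :
  smooth_family u D -> PD (D w) (D (true :: w)) (D (false :: w)) z.
Proof.
  intros [_ H]. destruct z as [x y].
  assert (C : forall v, continuous (D v) (x, y)).
  { intros v. apply cont2_continuous, H. }
  split; [|split; [|split; [|split]]]; auto; simpl; apply is_derive_Reals; apply H.
Qed.

Lemma derivative_zero_loc (f fx fy : pt -> R) (z : pt) :
  locally z (fun w => f w = 0) -> PD f fx fy z -> fx z = 0 /\ fy z = 0.
Proof.
  intros H (A & B & _). split.
  - apply locally_slice_x in H. eapply is_derive_unique in A. rewrite <- A.
    rewrite (Derive_ext_loc _ (fun _ => 0)); auto. apply Derive_const.
  - apply locally_slice_y in H. eapply is_derive_unique in B. rewrite <- B.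
    rewrite (Derive_ext_loc _ (fun _ => 0)); auto. apply Derive_const.
Qed.

(* With T = grad(phi)/phi this is the ground-state substitution u = phi v: completing the
   square in |grad u - u T|^2 >= 0 and integrating div(u^2 T) to zero. *)
Lemma hardy_ineq_of_field (Om : pt -> Prop) (c : R) (T1 T1x T1y T2 T2x T2y : pt -> R) :
  (forall z, Om z -> PD T1 T1x T1y z) -> (forall z, Om z -> PD T2 T2x T2y z) ->
  (forall z, Om z -> T1x z + T2y z + (T1 z ^ 2 + T2 z ^ 2) <= - (c / dist_bd Om z ^ 2)) ->
  hardy_ineq Om c.
Proof.
  intros HT1 HT2 HT u D HD (K & HKc & (M & HM) & HKO & HK0) I1 I2 H1 H2.
  pose proof (proj1 HD) as Du.
  assert (Z : forall z, ~ K z -> locally z (fun w => u w = 0)).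
  { intros z Hz. apply locally_edist. destruct (HKc z Hz) as (e & He & Q).
    exists e. split; auto. }
  assert (Pu : forall z, PD u (D (true :: nil)) (D (false :: nil)) z).
  { intros z. rewrite <- Du. now apply smooth_family_PD with u. }
  set (ux := D (true :: nil)) in *. set (uy := D (false :: nil)) in *.
  assert (Z3 : forall z, ~ K z -> locally z (fun w => u w = 0 /\ ux w = 0 /\ uy w = 0)).
  { intros z Hz. pose proof (Z z Hz) as Q. apply locally_locally in Q.
    eapply filter_imp; [|exact Q]. intros w Hw. split.
    - now apply locally_singleton in Hw.
    - exact (derivative_zero_loc u ux uy w Hw (Pu w)). }
  (* The field T is controlled on [Om] only, but u^2 T is C^1 on the whole plane: off the support
     [K] it vanishes in a neighbourhood, whatever T is there. *)
  assert (G : forall T Tx Ty, (forall z, Om z -> PD T Tx Ty z) -> forall z,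
     PD (fun w => u w * u w * T w)
        (fun w => 2 * u w * ux w * T w + u w * u w * Tx w)
        (fun w => 2 * u w * uy w * T w + u w * u w * Ty w) z).
  { intros T Tx Ty HPD z. destruct (classic (K z)) as [Hz | Hz].
    - eapply PD_eq; [| | apply (PD_mult _ _ _ _ _ _ z
        (PD_mult _ _ _ _ _ _ z (Pu z) (Pu z)) (HPD z (HKO z Hz)))]; intros; simpl; ring.
    - eapply PD_ext_loc; [|apply (PD_const 0)].
      eapply filter_imp; [|exact (Z3 z Hz)]. intros w (A & B & C). rewrite A, B, C.
      repeat split; ring. }
  pose proof (G _ _ _ HT1) as G1. pose proof (G _ _ _ HT2) as G2.
  destruct (Int2_eventually _ _ H1) as (M1 & HM1 & Q1).
  destruct (Int2_eventually _ _ H2) as (M2 & HM2 & Q2).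
  set (N := Rmax (Rmax M1 M2) (Rmax 1 M)).
  assert (HN : M1 <= N /\ M2 <= N /\ 1 <= N /\ M <= N).
  { unfold N. pose proof (Rmax_l M1 M2). pose proof (Rmax_r M1 M2).
    pose proof (Rmax_l 1 M). pose proof (Rmax_r 1 M).
    pose proof (Rmax_l (Rmax M1 M2) (Rmax 1 M)). pose proof (Rmax_r (Rmax M1 M2) (Rmax 1 M)).
    repeat split; lra. }
  (* The square is one unit larger than the one carrying the support, so that u^2 T vanishes on its
     boundary. *)
  destruct (Q1 (N + 1)) as (_ & B1 & J1); [lra|].
  destruct (Q2 (N + 1)) as (_ & B2 & J2); [lra|].
  assert (S : forall T, box_supported N (fun w => u w * u w * T w)).
  { intros T x y Hxy. rewrite HK0. ring. intros Hk. specialize (HM _ Hk).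
    destruct (edist_ge_coords (x, y) (0, 0)) as [E1 E2]. simpl in E1, E2.
    unfold Rminus in E1, E2. rewrite Rplus_0_l, Rabs_Ropp in E1, E2. lra. }
  set (R1 := fun w => 2 * u w * ux w * T1 w + u w * u w * T1x w).
  set (R2 := fun w => 2 * u w * uy w * T2 w + u w * u w * T2y w).
  assert (C1 : forall z, continuous R1 z) by (intros z; apply (G1 z)).
  assert (C2 : forall z, continuous R2 z) by (intros z; apply (G2 z)).
  assert (K1 : iint (N + 1) R1 = 0).
  { apply (iint_partial_x (N + 1) N (fun w => u w * u w * T1 w) R1); auto; try lra.
    - intros x y. exact (proj1 (G1 (x, y))).
    - intros z. apply (G1 z). }
  assert (K2 : iint (N + 1) R2 = 0).
  { apply (iint_partial_y (N + 1) N (fun w => u w * u w * T2 w) R2); auto; try lra.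
    intros x y. exact (proj1 (proj2 (G2 (x, y)))). }
  pose proof (box_integrable_continuous (N + 1) R1 C1) as P1.
  pose proof (box_integrable_continuous (N + 1) R2 C2) as P2.
  destruct (iint_linear (N + 1) 1 R1 R2 P1 P2) as [P3 K3].
  destruct (iint_linear (N + 1) c _ _ P3 B2) as [P4 K4].
  rewrite K3, K1, K2, J2 in K4.
  replace (c * I2) with (0 + 1 * 0 + c * I2) by ring. rewrite <- K4, <- J1.
  apply iint_le; auto. lra.
  intros z. unfold R1, R2. destruct (classic (K z)) as [Hz | Hz].
  - pose proof (HT z (HKO z Hz)) as Hp.
    pose proof (pow2_ge_0 (ux z - u z * T1 z)). pose proof (pow2_ge_0 (uy z - u z * T2 z)).
    pose proof (pow2_ge_0 (u z)) as U.
    apply Rmult_le_compat_l with (r := u z ^ 2) in Hp; auto.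
    unfold Rdiv in *. nra.
  - destruct (locally_singleton _ _ (Z3 z Hz)) as (A & B & C). rewrite A, B, C.
    unfold Rdiv. lra.
Qed.

(** * The sector and its distance function *)

Definition rad (z : pt) : R := sqrt (fst z ^ 2 + snd z ^ 2).
(* Coordinates along the axis of symmetry of the sector and orthogonally to it; the null last term
   matches the affine form a x + b y + c of [PD_lin]. *)
Definition axial (b : R) (z : pt) : R := cos (b / 2) * fst z + sin (b / 2) * snd z + 0.
Definition transv (b : R) (z : pt) : R := - sin (b / 2) * fst z + cos (b / 2) * snd z + 0.
(** The half-angle formula tan (f / 2) = sin f / (1 + cos f), with f measured from the axis of
    symmetry. The cut lies opposite the axis, so a single expression is smooth on the sector even
    for opening 2 PI. *)
Definition ang (b : R) (z : pt) : R := b / 2 + 2 * atan (transv b z / (rad z + axial b z)).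

Lemma rad_pos (z : pt) : 0 <= rad z.
Proof. apply sqrt_pos. Qed.

Lemma rad_sqr (z : pt) : rad z ^ 2 = fst z ^ 2 + snd z ^ 2.
Proof.
  unfold rad. rewrite pow2_sqrt; auto.
  pose proof (pow2_ge_0 (fst z)); pose proof (pow2_ge_0 (snd z)); lra.
Qed.

Lemma rad_edist (z : pt) : rad z = edist z (0, 0).
Proof. unfold rad, edist. simpl. f_equal. ring. Qed.

Lemma sin2_cos2' (t : R) : sin t * sin t + cos t * cos t = 1.
Proof. exact (sin2_cos2 t). Qed.

Lemma rad_sqr_axial (b : R) (z : pt) : rad z ^ 2 = axial b z ^ 2 + transv b z ^ 2.
Proof.
  rewrite rad_sqr. unfold axial, transv. pose proof (sin2_cos2' (b / 2)). nra.
Qed.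

Lemma axial_le_rad (b : R) (z : pt) : - rad z <= axial b z <= rad z.
Proof.
  pose proof (rad_sqr_axial b z). pose proof (rad_pos z).
  pose proof (pow2_ge_0 (transv b z)). split; nra.
Qed.

Lemma fst_axial (b : R) (z : pt) :
  fst z = cos (b / 2) * axial b z - sin (b / 2) * transv b z.
Proof.
  unfold axial, transv. pose proof (sin2_cos2' (b / 2)) as H.
  replace (fst z) with (fst z * 1) at 1 by ring. rewrite <- H. ring.
Qed.

Lemma snd_axial (b : R) (z : pt) :
  snd z = sin (b / 2) * axial b z + cos (b / 2) * transv b z.
Proof.
  unfold axial, transv. pose proof (sin2_cos2' (b / 2)) as H.
  replace (snd z) with (snd z * 1) at 1 by ring. rewrite <- H. ring.
Qed.

Lemma rad_polar (r t : R) : 0 <= r -> rad (r * cos t, r * sin t) = r.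
Proof.
  intros Hr. unfold rad. simpl fst; simpl snd.
  replace ((r * cos t)^2 + (r * sin t)^2) with (r ^ 2).
  now apply sqrt_pow2. pose proof (sin2_cos2' t). nra.
Qed.

Lemma axial_polar (b r t : R) : axial b (r * cos t, r * sin t) = r * cos (t - b / 2).
Proof. unfold axial; simpl. rewrite cos_minus. ring. Qed.

Lemma transv_polar (b r t : R) : transv b (r * cos t, r * sin t) = r * sin (t - b / 2).
Proof. unfold transv; simpl. rewrite sin_minus. ring. Qed.

Lemma cos_lt_cos_abs (u v : R) : Rabs u < v -> v <= PI -> cos v < cos u.
Proof.
  intros H Hv. assert (E : cos u = cos (Rabs u)).
  { unfold Rabs. destruct Rcase_abs; auto. now rewrite cos_neg. }
  rewrite E. pose proof (Rabs_pos u). apply cos_decreasing_1; lra.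
Qed.

Lemma cos_2atan (u : R) : cos (2 * atan u) = (1 - u ^ 2) / (1 + u ^ 2).
Proof.
  rewrite cos_2a_cos, cos_atan. unfold Rsqr.
  assert (H : 0 < 1 + u * u) by nra.
  pose proof (sqrt_lt_R0 _ H) as Hs. pose proof (sqrt_sqrt _ (Rlt_le _ _ H)) as Q.
  replace (1 + u^2) with (sqrt (1 + u * u) * sqrt (1 + u * u)) by (rewrite Q; ring).
  replace (1 - u ^2) with (2 - sqrt (1 + u * u) * sqrt (1 + u * u)) by (rewrite Q; ring).
  field. lra.
Qed.

Lemma sin_2atan (u : R) : sin (2 * atan u) = 2 * u / (1 + u ^ 2).
Proof.
  rewrite sin_2a, cos_atan, sin_atan. unfold Rsqr.
  assert (H : 0 < 1 + u * u) by nra.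
  pose proof (sqrt_lt_R0 _ H) as Hs. pose proof (sqrt_sqrt _ (Rlt_le _ _ H)) as Q.
  replace (1 + u^2) with (sqrt (1 + u * u) * sqrt (1 + u * u)) by (rewrite Q; ring).
  field. lra.
Qed.

(** The angle to the axis is below b / 2, expressed through cosines: openness and the location of
    the edges can be read off continuous functions, with no angle involved. *)
Definition in_sector (b : R) (z : pt) : Prop := cos (b / 2) * rad z < axial b z.

Lemma in_sector_pos (b : R) (z : pt) :
  in_sector b z -> 0 < rad z /\ 0 < rad z + axial b z.
Proof.
  unfold in_sector. intros H. pose proof (COS_bound (b / 2)).
  pose proof (rad_pos z). pose proof (axial_le_rad b z).
  assert (0 < rad z + axial b z) by nra. split; lra.
Qed.

Lemma ang_bounds (b : R) (z : pt) : b / 2 - PI < ang b z < b / 2 + PI.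
Proof. unfold ang. pose proof (atan_bound (transv b z / (rad z + axial b z))). lra. Qed.

Lemma ang_spec (b : R) (z : pt) :
  0 < rad z + axial b z ->
  z = (rad z * cos (ang b z), rad z * sin (ang b z)) /\
  axial b z = rad z * cos (ang b z - b / 2) /\ transv b z = rad z * sin (ang b z - b / 2).
Proof.
  intros H. pose proof (axial_le_rad b z). assert (Hr : 0 < rad z) by lra.
  pose proof (rad_sqr_axial b z) as Q.
  set (u := transv b z / (rad z + axial b z)).
  assert (Hu : transv b z = u * (rad z + axial b z)) by (unfold u; field; lra).
  assert (E : ang b z - b / 2 = 2 * atan u) by (unfold ang, u; ring).
  assert (P : (1 + u ^ 2) * (rad z + axial b z) = 2 * rad z).
  { apply Rmult_eq_reg_r with (rad z + axial b z); [|lra]. rewrite Hu in Q. nra. }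
  assert (Hp : 0 < 1 + u ^ 2) by nra.
  assert (A : axial b z = rad z * cos (ang b z - b / 2)).
  { rewrite E, cos_2atan. apply Rmult_eq_reg_r with (1 + u^2); [|lra].
    unfold Rdiv. rewrite !Rmult_assoc, Rinv_l by lra. lra. }
  assert (B : transv b z = rad z * sin (ang b z - b / 2)).
  { rewrite E, sin_2atan. apply Rmult_eq_reg_r with (1 + u^2); [|lra].
    unfold Rdiv. rewrite !Rmult_assoc, Rinv_l by lra. rewrite Hu.
    transitivity (u * ((1 + u ^ 2) * (rad z + axial b z))). ring. rewrite P. ring. }
  split; [|split]; auto.
  replace (ang b z) with (b / 2 + (ang b z - b / 2)) by ring.
  rewrite cos_plus, sin_plus. rewrite (surjective_pairing z) at 1. f_equal.
  - rewrite (fst_axial b z), A at 1. rewrite B. ring.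
  - rewrite (snd_axial b z), A at 1. rewrite B. ring.
Qed.

Lemma in_sector_ang (b : R) (z : pt) :
  PI <= b -> b <= 2 * PI -> in_sector b z -> 0 < ang b z < b.
Proof.
  intros H1 H2 H. destruct (in_sector_pos b z H) as [Hr Hp].
  destruct (ang_spec b z Hp) as (_ & A & _). unfold in_sector in H. rewrite A in H.
  assert (C : cos (b / 2) < cos (ang b z - b / 2)) by nra.
  assert (D : Rabs (ang b z - b / 2) < b / 2).
  { apply Rnot_le_lt. intros L.
    assert (E : cos (ang b z - b / 2) = cos (Rabs (ang b z - b / 2))).
    { unfold Rabs. destruct Rcase_abs; auto. now rewrite cos_neg. }
    rewrite E in C. pose proof (ang_bounds b z).
    assert (Rabs (ang b z - b / 2) < PI) by (apply Rabs_def1; lra).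
    assert (cos (Rabs (ang b z - b / 2)) <= cos (b / 2)); [|lra].
    apply cos_decr_1; lra. }
  apply Rabs_def2 in D. lra.
Qed.

Lemma polar_in_sector (b r t : R) :
  b <= 2 * PI -> 0 < r -> 0 < t < b -> in_sector b (r * cos t, r * sin t).
Proof.
  intros Hb Hr Ht. unfold in_sector. rewrite rad_polar, axial_polar by lra.
  assert (cos (b / 2) < cos (t - b / 2)); [|nra].
  apply cos_lt_cos_abs; [|lra]. apply Rabs_def1; lra.
Qed.

Lemma Lambda_in_sector (b : R) (z : pt) :
  PI <= b -> b <= 2 * PI -> (Lambda b z <-> in_sector b z).
Proof.
  intros H1 H2. split.
  - intros (r & t & Hr & Ht1 & Ht2 & ->). apply polar_in_sector; auto.
  - intros H. destruct (in_sector_pos b z H) as [Hr Hp].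
    pose proof (in_sector_ang b z H1 H2 H).
    exists (rad z), (ang b z). repeat split; try tauto. now apply ang_spec.
Qed.

Lemma ang_polar (b r t : R) :
  b <= 2 * PI -> 0 < r -> 0 < t < b -> ang b (r * cos t, r * sin t) = t.
Proof.
  intros Hb Hr Ht. unfold ang. rewrite rad_polar, axial_polar, transv_polar by lra.
  set (f := t - b / 2).
  assert (E : r * sin f / (r + r * cos f) = tan (f / 2)).
  { assert (Hc : 0 < cos (f / 2)) by (apply cos_gt_0; unfold f; lra).
    replace f with (2 * (f / 2)) at 1 2 by field.
    rewrite sin_2a, cos_2a_cos. unfold tan.
    pose proof (Rmult_lt_0_compat _ _ Hr (Rmult_lt_0_compat _ _ Hc Hc)).
    field. split; nra. }
  rewrite E, atan_tan. unfold f; field. unfold f; lra.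
Qed.

Lemma PD_rad (z : pt) : 0 < rad z ->
  PD rad (fun w => fst w / rad w) (fun w => snd w / rad w) z.
Proof.
  intros Hz.
  assert (H0 : 0 < fst z * fst z + snd z * snd z).
  { pose proof (rad_sqr z). nra. }
  apply PD_ext_loc with
    (f := fun w => sqrt (fst w * fst w + snd w * snd w))
    (fx := fun w => / (2 * sqrt (fst w * fst w + snd w * snd w)) * ((1 * fst w + fst w * 1) + (0 * snd w + snd w * 0)))
    (fy := fun w => / (2 * sqrt (fst w * fst w + snd w * snd w)) * ((0 * fst w + fst w * 0) + (1 * snd w + snd w * 1))).
  - apply filter_forall. intros [x y]. cbn [fst snd].
    assert (E : sqrt (x * x + y * y) = rad (x, y)) by (unfold rad; f_equal; simpl; ring).
    assert (K : forall a c r : R, / (2 * r) * ((1 * a + a * 1) + (0 * c + c * 0)) = a / r).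
    { intros a c r. unfold Rdiv. rewrite Rinv_mult. set (i := / r). field. }
    rewrite !E. split; [reflexivity|]. split; [apply K|].
    rewrite <- (K y x). f_equal. ring.
  - apply (PD_comp sqrt (fun u => / (2 * sqrt u)) (fun w => fst w * fst w + snd w * snd w)).
    + pose proof (sqrt_lt_R0 _ H0). auto_derive; auto. field. lra.
    + pose proof (sqrt_lt_R0 _ H0). apply @ex_derive_continuous. auto_derive. repeat split; auto; lra.
    + apply PD_plus; apply PD_mult; first [apply PD_fst | apply PD_snd].
Qed.

Lemma continuous_rad (z : pt) : continuous rad z.
Proof.
  apply (continuous_ext (fun w => sqrt (fst w * fst w + snd w * snd w))).
  - intros [x y]. unfold rad. simpl. f_equal. ring.
  - apply (continuous_comp (fun w : pt => fst w * fst w + snd w * snd w) sqrt).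
    + apply continuous_Rplus; apply continuous_Rmult; destruct z;
        first [apply continuous_fst | apply continuous_snd].
    + apply continuous_sqrt.
Qed.

Lemma continuous_lin (a b c : R) (z : pt) :
  continuous (fun w : pt => a * fst w + b * snd w + c) z.
Proof. apply (PD_lin a b c z). Qed.

Lemma locally_lt (f g : pt -> R) (z : pt) :
  continuous f z -> continuous g z -> f z < g z -> locally z (fun w => f w < g w).
Proof.
  intros Hf Hg H.
  assert (C : continuous (fun w => g w + -1 * f w) z).
  { apply continuous_Rplus; auto. apply continuous_Rmult; auto. apply continuous_const. }
  assert (P : 0 < g z + -1 * f z) by lra.
  apply (proj1 (filterlim_locally _ _)) with (eps := mkposreal _ P) in C.
  eapply filter_imp; [|exact C]. intros w Hw.
  change (Rabs ((g w + -1 * f w) - (g z + -1 * f z)) < g z + -1 * f z) in Hw.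
  apply Rabs_def2 in Hw. lra.
Qed.

Lemma in_sector_open (b : R) (z : pt) : in_sector b z -> locally z (in_sector b).
Proof.
  intros H. apply (locally_lt (fun w => cos (b / 2) * rad w) (axial b)); auto.
  - apply continuous_Rmult. apply continuous_const. apply continuous_rad.
  - apply continuous_lin.
Qed.

Lemma PD_ang (b : R) (z : pt) : in_sector b z ->
  PD (ang b) (fun w => - snd w / rad w ^ 2) (fun w => fst w / rad w ^ 2) z.
Proof.
  intros Hz. destruct (in_sector_pos b z Hz) as [Hr Hp].
  pose (u := fun w => transv b w * / (rad w + axial b w)).
  pose (ux := fun w => - sin (b / 2) * / (rad w + axial b w) +
     transv b w * (- / (rad w + axial b w)^2 * (fst w / rad w + cos (b / 2)))).
  pose (uy := fun w => cos (b / 2) * / (rad w + axial b w) +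
     transv b w * (- / (rad w + axial b w)^2 * (snd w / rad w + sin (b / 2)))).
  apply PD_ext_loc with
    (f := fun w => b / 2 + 2 * atan (u w))
    (fx := fun w => 0 + (0 * atan (u w) + 2 * (/ (1 + u w ^ 2) * ux w)))
    (fy := fun w => 0 + (0 * atan (u w) + 2 * (/ (1 + u w ^ 2) * uy w))).
  - eapply filter_imp; [|exact (in_sector_open b z Hz)]. intros w Hw.
    destruct (in_sector_pos b w Hw) as [Hr' Hp'].
    split; [reflexivity|].
    pose proof (rad_sqr_axial b w) as Q.
    assert (U : 1 + u w ^ 2 = 2 * rad w / (rad w + axial b w)).
    { unfold u. transitivity (((rad w + axial b w) ^ 2 + transv b w ^ 2) / (rad w + axial b w) ^ 2).
      field; lra. replace (transv b w ^ 2) with (rad w ^ 2 - axial b w ^ 2) by lra. field; lra. }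
    rewrite !U. unfold ux, uy. rewrite (fst_axial b w), (snd_axial b w).
    set (X := axial b w) in *. set (Y := transv b w) in *. set (r := rad w) in *.
    assert (Q' : Y ^ 2 = r ^ 2 - X ^ 2) by lra.
    split; field_simplify_eq; try (repeat split; lra);
      replace (Y ^ 2) with (r ^ 2 - X ^ 2) by lra; ring.
  - apply PD_plus; [apply PD_const|]. apply PD_mult; [apply PD_const|].
    apply (PD_comp atan (fun v => / (1 + v ^ 2)) u).
    + evar_last. apply is_derive_atan. simpl. now rewrite Rmult_1_r.
    + apply @ex_derive_continuous. auto_derive. nra.
    + apply PD_mult; [apply PD_lin|].
      apply (PD_inv (fun w => rad w + axial b w)); [lra|].
      apply PD_plus; [now apply PD_rad | apply PD_lin].
Qed.

(** * Gluing functions of one variable *)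

Definition pw (p : R) (f g : R -> R) (t : R) : R := if Rle_dec t p then f t else g t.

Lemma pw_left (p : R) (f g : R -> R) (t : R) : t <= p -> pw p f g t = f t.
Proof. intros H. unfold pw. destruct Rle_dec; tauto. Qed.

Lemma pw_right (p : R) (f g : R -> R) (t : R) : f p = g p -> p <= t -> pw p f g t = g t.
Proof.
  intros E H. unfold pw. destruct Rle_dec; auto. replace t with p by lra. auto.
Qed.

Lemma locally_below (t p : R) : t < p -> locally t (fun u => u < p).
Proof. intros H. apply (open_lt p t H). Qed.

Lemma locally_above (t p : R) : p < t -> locally t (fun u => p < u).
Proof. intros H. apply (open_gt p t H). Qed.

Lemma pw_derive (p : R) (f g f' g' : R -> R) (t : R) :
  (t <= p -> is_derive f t (f' t)) -> (p <= t -> is_derive g t (g' t)) ->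
  f p = g p -> f' p = g' p -> is_derive (pw p f g) t (pw p f' g' t).
Proof.
  intros Hf Hg E E'. destruct (Rtotal_order t p) as [H | [H | H]].
  - rewrite pw_left by lra. eapply is_derive_ext_loc; [|apply Hf; lra].
    eapply filter_imp; [|exact (locally_below t p H)]. intros u Hu. rewrite pw_left; auto. lra.
  - subst t. specialize (Hf (Rle_refl p)). specialize (Hg (Rle_refl p)).
    rewrite pw_left by lra. rewrite <- E' in Hg. apply is_derive_Reals in Hf, Hg.
    apply is_derive_Reals. intros eps He.
    destruct (Hf eps He) as [d1 D1]. destruct (Hg eps He) as [d2 D2].
    assert (Hd : 0 < Rmin d1 d2) by (apply Rmin_pos; apply cond_pos).
    exists (mkposreal _ Hd). intros h Hh Hl. simpl in Hl.
    pose proof (Rmin_l d1 d2). pose proof (Rmin_r d1 d2).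
    rewrite (pw_left p f g p) by lra.
    destruct (Rle_dec h 0).
    + rewrite pw_left by lra. apply D1; auto. lra.
    + rewrite pw_right by (auto; lra). rewrite E. apply D2; auto. lra.
  - rewrite pw_right by (auto; lra). eapply is_derive_ext_loc; [|apply Hg; lra].
    eapply filter_imp; [|exact (locally_above t p H)]. intros u Hu.
    rewrite pw_right; auto. lra.
Qed.

Lemma pw_continuous (p : R) (f g : R -> R) (t : R) :
  (t <= p -> continuous f t) -> (p <= t -> continuous g t) ->
  f p = g p -> continuous (pw p f g) t.
Proof.
  intros Hf Hg E. destruct (Rtotal_order t p) as [H | [H | H]].
  - eapply continuous_ext_loc; [|apply Hf; lra].
    eapply filter_imp; [|exact (locally_below t p H)]. intros u Hu. rewrite pw_left; auto. lra.
  - subst t. specialize (Hf (Rle_refl p)). specialize (Hg (Rle_refl p)).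
    apply filterlim_locally. intros eps.
    pose proof (proj1 (filterlim_locally _ _) Hf eps) as H1.
    pose proof (proj1 (filterlim_locally _ _) Hg eps) as H2.
    rewrite pw_left by lra.
    eapply filter_imp; [|exact (filter_and _ _ H1 H2)]. intros u [A B].
    unfold pw. destruct Rle_dec; auto. rewrite E. exact B.
  - eapply continuous_ext_loc; [|apply Hg; lra].
    eapply filter_imp; [|exact (locally_above t p H)]. intros u Hu.
    rewrite pw_right; auto. lra.
Qed.

(** Distance from the point at radius 1 and angle t to the sides of the sector: the sine of the
    angle to a side as long as that angle is at most PI / 2, and 1 in between, where the vertex is
    the nearest boundary point. The pieces match to first order since cos (PI / 2) = 0. *)
Definition sfun (b : R) : R -> R :=
  pw (PI / 2) sin (pw (b - PI / 2) (fun _ => 1) (fun t => sin (b - t))).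
Definition sder (b : R) : R -> R :=
  pw (PI / 2) cos (pw (b - PI / 2) (fun _ => 0) (fun t => - cos (b - t))).

Lemma sfun_left (b t : R) : t <= PI / 2 -> sfun b t = sin t.
Proof. apply pw_left. Qed.

Lemma sin_b_end (b : R) : 1 = sin (b - (b - PI / 2)).
Proof. replace (b - (b - PI / 2)) with (PI / 2) by ring. now rewrite sin_PI2. Qed.

Lemma sfun_mid (b t : R) : PI <= b -> PI / 2 <= t -> t <= b - PI / 2 -> sfun b t = 1.
Proof.
  intros Hb H1 H2. unfold sfun. rewrite pw_right; auto.
  - now rewrite pw_left.
  - rewrite sin_PI2, pw_left; lra.
Qed.

Lemma sfun_right (b t : R) : PI <= b -> b - PI / 2 <= t -> sfun b t = sin (b - t).
Proof.
  intros Hb H. unfold sfun. rewrite pw_right; try lra.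
  - rewrite pw_right; auto. apply sin_b_end.
  - rewrite sin_PI2, pw_left; lra.
Qed.

Lemma sder_left (b t : R) : t <= PI / 2 -> sder b t = cos t.
Proof. apply pw_left. Qed.

Lemma sder_mid (b t : R) : PI <= b -> PI / 2 <= t -> t <= b - PI / 2 -> sder b t = 0.
Proof.
  intros Hb H1 H2. unfold sder. rewrite pw_right; auto.
  - now rewrite pw_left.
  - rewrite cos_PI2, pw_left; lra.
Qed.

Lemma sder_right (b t : R) : PI <= b -> b - PI / 2 <= t -> sder b t = - cos (b - t).
Proof.
  intros Hb H. unfold sder. rewrite pw_right; try lra.
  - rewrite pw_right; auto. replace (b - (b - PI / 2)) with (PI / 2) by ring.
    rewrite cos_PI2; lra.
  - rewrite cos_PI2, pw_left; lra.
Qed.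

Lemma sfun_derive (b t : R) : PI <= b -> is_derive (sfun b) t (sder b t).
Proof.
  intros Hb. apply pw_derive.
  - intros _. apply is_derive_Reals, derivable_pt_lim_sin.
  - intros _. apply pw_derive.
    + intros _. apply @is_derive_const.
    + intros _. auto_derive; auto. cbv beta. unfold Rminus. ring.
    + apply sin_b_end.
    + replace (b - (b - PI / 2)) with (PI / 2) by ring. rewrite cos_PI2; lra.
  - rewrite sin_PI2, pw_left; lra.
  - rewrite cos_PI2, pw_left; lra.
Qed.

Lemma sder_continuous (b t : R) : PI <= b -> continuous (sder b) t.
Proof.
  intros Hb. apply pw_continuous.
  - intros _. apply continuous_cos.
  - intros _. apply pw_continuous.
    + intros _. apply continuous_const.
    + intros _. apply @ex_derive_continuous. auto_derive; auto.
    + replace (b - (b - PI / 2)) with (PI / 2) by ring. rewrite cos_PI2; lra.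
  - rewrite cos_PI2, pw_left; lra.
Qed.

Lemma angle_cases (b t : R) : PI <= b ->
  t <= PI / 2 \/ (PI / 2 <= t /\ t <= b - PI / 2) \/ b - PI / 2 <= t.
Proof. intros H. lra. Qed.

Lemma sfun_bounds (b t : R) : PI <= b -> 0 < t < b -> 0 < sfun b t <= 1.
Proof.
  intros Hb Ht. pose proof PI_RGT_0. destruct (angle_cases b t Hb) as [H1 | [H1 | H1]].
  - rewrite sfun_left by lra. split; [apply sin_gt_0; lra | apply SIN_bound].
  - rewrite sfun_mid; lra.
  - rewrite sfun_right by lra. split; [apply sin_gt_0; lra | apply SIN_bound].
Qed.

Lemma sfun_sym (b t : R) : PI <= b -> sfun b (b - t) = sfun b t.
Proof.
  intros Hb. destruct (angle_cases b t Hb) as [H1 | [H1 | H1]].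
  - rewrite (sfun_left b t), (sfun_right b (b - t)) by lra. f_equal; ring.
  - rewrite !sfun_mid; lra.
  - rewrite (sfun_right b t), (sfun_left b (b - t)) by lra. reflexivity.
Qed.

(** The distance to the side at angle 0: if it makes a right or obtuse angle with the point, the
    vertex is nearest, otherwise the distance to its line counts. These are the alternatives of
    [edist_polar_lower]; the other side follows from [sfun_sym]. *)
Lemma sfun_le_abs_sin (b t : R) : PI <= b -> b <= 2 * PI -> 0 < t < b ->
  cos t <= 0 \/ sfun b t <= Rabs (sin t).
Proof.
  intros Hb Hb2 Ht. pose proof PI_RGT_0.
  destruct (Rle_dec t (PI / 2)).
  - right. rewrite sfun_left by lra. apply Rle_abs.
  - destruct (Rle_dec t (3 * (PI / 2))).
    + left. apply cos_le_0; lra.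
    + right. rewrite sfun_right by lra. rewrite <- Rabs_Ropp, <- sin_neg.
      rewrite <- (sin_period (- t) 1). simpl INR.
      eapply Rle_trans; [|apply Rle_abs]. apply sin_incr_1; lra.
Qed.

Definition dsec (b : R) (z : pt) : R := rad z * sfun b (ang b z).
Definition ray (b : R) (z : pt) : Prop := (snd z = 0 /\ 0 <= fst z) \/ L3 b z.

Lemma ray_polar (b : R) (q : pt) :
  ray b q <-> exists s f, 0 <= s /\ (f = 0 \/ f = b) /\ q = (s * cos f, s * sin f).
Proof.
  split.
  - intros [[H1 H2] | (s & Hs & ->)].
    + exists (fst q), 0. rewrite cos_0, sin_0. repeat split; auto.
      rewrite (surjective_pairing q), H1. simpl. f_equal; ring.
    + exists s, b. auto.
  - intros (s & f & Hs & [-> | ->] & ->).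
    + left. rewrite cos_0, sin_0. simpl. split; lra.
    + right. exists s. auto.
Qed.

Lemma edist_polar_sqr (r t s f : R) :
  edist (r * cos t, r * sin t) (s * cos f, s * sin f) ^ 2 =
  r ^ 2 - 2 * r * s * cos (t - f) + s ^ 2.
Proof.
  rewrite edist_sqr. simpl fst; simpl snd. rewrite cos_minus.
  pose proof (sin2_cos2' t). pose proof (sin2_cos2' f).
  replace (r ^ 2) with (r ^ 2 * (sin t * sin t + cos t * cos t)) by (rewrite H; ring).
  replace (s ^ 2) with (s ^ 2 * (sin f * sin f + cos f * cos f)) by (rewrite H0; ring).
  ring.
Qed.

(** Law of cosines: r^2 - 2 r s c + s^2 is at least r^2 when c <= 0, and in general it is (s - r
    c)^2 + (r v)^2 with v the sine. *)
Lemma edist_polar_lower (r t s f m : R) :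
  0 < r -> 0 <= s -> 0 <= m <= 1 -> (cos (t - f) <= 0 \/ m <= Rabs (sin (t - f))) ->
  r * m <= edist (r * cos t, r * sin t) (s * cos f, s * sin f).
Proof.
  intros Hr Hs Hm H. apply Rsqr_incr_0_var; [|apply edist_pos].
  unfold Rsqr. pose proof (edist_polar_sqr r t s f) as Q.
  set (d := edist _ _) in *. replace (d * d) with (d ^ 2) by ring. rewrite Q.
  pose proof (sin2_cos2' (t - f)) as S. set (c := cos (t - f)) in *. set (v := sin (t - f)) in *.
  assert (M1 : m * m <= 1) by nra.
  destruct H as [H | H].
  - assert (0 <= r * s * - c) by (apply Rmult_le_pos; [nra | lra]). nra.
  - assert (M2 : m * m <= v * v).
    { apply (Rsqr_le_abs_1 m v). rewrite (Rabs_pos_eq m); lra. }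
    pose proof (pow2_ge_0 (s - r * c)). nra.
Qed.

Lemma dsec_le_edist (b : R) (z q : pt) :
  PI <= b -> b <= 2 * PI -> in_sector b z -> ray b q -> dsec b z <= edist z q.
Proof.
  intros H1 H2 Hz Hq. destruct (in_sector_pos b z Hz) as [Hr Hp].
  destruct (ang_spec b z Hp) as [E _]. pose proof (in_sector_ang b z H1 H2 Hz) as Ht.
  pose proof (sfun_bounds b _ H1 Ht) as Hs.
  apply ray_polar in Hq. destruct Hq as (s & f & Hs0 & Hf & ->).
  unfold dsec. rewrite E at 3. apply edist_polar_lower; auto; try lra.
  destruct Hf as [-> | ->].
  - rewrite Rminus_0_r. now apply sfun_le_abs_sin.
  - rewrite <- (sfun_sym b) by auto. rewrite <- Ropp_minus_distr, cos_neg, sin_neg, Rabs_Ropp.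
    apply sfun_le_abs_sin; auto. lra.
Qed.

(** The nearest point is the foot on a side or the vertex. The bound on [rad q] ensures that, for
    [z] near O, this point also belongs to the boundary of [E]. *)
Lemma dsec_attained (b : R) (z : pt) :
  PI <= b -> b <= 2 * PI -> in_sector b z ->
  exists q, ray b q /\ edist z q = dsec b z /\ rad q <= rad z.
Proof.
  intros H1 H2 Hz. destruct (in_sector_pos b z Hz) as [Hr Hp].
  destruct (ang_spec b z Hp) as [E _]. pose proof (in_sector_ang b z H1 H2 Hz) as Ht.
  pose proof (sfun_bounds b _ H1 Ht) as Hs.
  assert (K : forall s f, 0 <= s -> s <= rad z -> (f = 0 \/ f = b) ->
    rad z ^ 2 - 2 * rad z * s * cos (ang b z - f) + s ^ 2 = (rad z * sfun b (ang b z)) ^ 2 ->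
    exists q, ray b q /\ edist z q = dsec b z /\ rad q <= rad z).
  { intros s f Hs0 Hsr Hf Q. exists (s * cos f, s * sin f). split; [|split].
    - apply ray_polar. eauto 6.
    - rewrite E at 1. unfold dsec. rewrite <- edist_polar_sqr in Q.
      apply Rsqr_inj; [apply edist_pos | nra | unfold Rsqr; nra].
    - rewrite rad_polar; auto. }
  set (r := rad z) in *. set (t := ang b z) in *.
  pose proof (sin2_cos2' t). pose proof (sin2_cos2' (b - t)).
  destruct (angle_cases b t H1) as [C | [C | C]].
  - assert (0 <= cos t) by (apply cos_ge_0; lra). pose proof (COS_bound t).
    apply (K (r * cos t) 0); auto; try nra.
    rewrite sfun_left by lra. rewrite Rminus_0_r. nra.
  - apply (K 0 0); auto; try lra. rewrite sfun_mid by lra. ring.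
  - assert (0 <= cos (b - t)) by (apply cos_ge_0; lra). pose proof (COS_bound (b - t)).
    apply (K (r * cos (b - t)) b); auto; try nra.
    rewrite sfun_right by lra. rewrite <- (Ropp_minus_distr b t), cos_neg. nra.
Qed.

Lemma axial_edge_ray (b : R) (z : pt) :
  PI <= b -> b <= 2 * PI -> axial b z = cos (b / 2) * rad z -> ray b z.
Proof.
  intros H1 H2 E. pose proof (rad_sqr_axial b z) as Q. pose proof (rad_pos z) as Hr.
  pose proof (sin2_cos2' (b / 2)) as S.
  assert (Hs : 0 <= sin (b / 2)) by (apply sin_ge_0; lra).
  assert (F : (transv b z - sin (b / 2) * rad z) * (transv b z + sin (b / 2) * rad z) = 0).
  { rewrite E in Q. nra. }
  apply Rmult_integral in F. destruct F as [F | F].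
  - right. exists (rad z). split; auto. rewrite (surjective_pairing z) at 1.
    rewrite (fst_axial b z), (snd_axial b z) at 1. rewrite E.
    replace (transv b z) with (sin (b / 2) * rad z) by lra.
    assert (E2 : b = 2 * (b / 2)) by field.
    assert (C : cos b = cos (b / 2) * cos (b / 2) - sin (b / 2) * sin (b / 2))
      by (rewrite E2 at 1; apply cos_2a).
    assert (D : sin b = 2 * sin (b / 2) * cos (b / 2)) by (rewrite E2 at 1; apply sin_2a).
    rewrite C, D. f_equal; ring.
  - left.
    assert (T : transv b z = - (sin (b / 2) * rad z)) by lra.
    rewrite (fst_axial b z), (snd_axial b z), E, T. split; nra.
Qed.

Lemma ray_axial (b : R) (z : pt) :
  ray b z -> axial b z = cos (b / 2) * rad z.
Proof.
  intros H. apply ray_polar in H. destruct H as (s & f & Hs & Hf & ->).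
  rewrite axial_polar, rad_polar by auto. rewrite Rmult_comm. f_equal.
  destruct Hf as [-> | ->].
  - rewrite Rminus_0_l. apply cos_neg.
  - f_equal. field.
Qed.

Lemma ray_not_in_sector (b : R) (z : pt) : ray b z -> ~ in_sector b z.
Proof. intros H%ray_axial. unfold in_sector. lra. Qed.

Lemma boundary_sector_ray (b : R) (z : pt) :
  PI <= b -> b <= 2 * PI -> boundary (in_sector b) z -> ray b z.
Proof.
  intros H1 H2 B. destruct (Rtotal_order (cos (b / 2) * rad z) (axial b z)) as [H | [H | H]].
  - exfalso. pose proof (in_sector_open b z H) as L. apply locally_edist in L.
    destruct L as (e & He & L). destruct (B e He) as [_ (w & Hw & N)]. apply N, L, Hw.
  - now apply axial_edge_ray.
  - exfalso. assert (L : locally z (fun w => axial b w < cos (b / 2) * rad w)).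
    { apply (locally_lt (axial b) (fun w => cos (b / 2) * rad w)); auto.
      apply continuous_lin. apply continuous_Rmult. apply continuous_const. apply continuous_rad. }
    apply locally_edist in L.
    destruct L as (e & He & L). destruct (B e He) as [(w & Hw & N) _].
    specialize (L w Hw). unfold in_sector in N. lra.
Qed.

(** The point is turned into the sector by the angle [h] and pushed outward by [h]; the push takes
    care of the vertex, which turning alone leaves fixed. *)
Lemma ray_adherent (b : R) (q : pt) (eps : R) :
  PI <= b -> b <= 2 * PI -> ray b q -> 0 < eps ->
  exists w, edist q w < eps /\ in_sector b w.
Proof.
  intros H1 H2 Hq He. apply ray_polar in Hq. destruct Hq as (s & f & Hs & Hf & ->).
  pose proof PI_RGT_0.
  assert (Hsg : exists sg, forall h, 0 < h < b -> 0 < f + sg * h < b).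
  { destruct Hf as [-> | ->]; [exists 1 | exists (-1)]; intros; lra. }
  destruct Hsg as [sg Hsg].
  assert (Hc : forall g, continuous g 0 -> locally 0 (fun h => Rabs (g h - g 0) < eps / 2)).
  { intros g Hg. assert (He2 : 0 < eps / 2) by lra.
    exact (proj1 (filterlim_locally _ _) Hg (mkposreal _ He2)). }
  assert (L1 := Hc (fun h => (s + h) * cos (f + sg * h))).
  assert (L2 := Hc (fun h => (s + h) * sin (f + sg * h))).
  specialize (L1 ltac:(apply @ex_derive_continuous; auto_derive; auto)).
  specialize (L2 ltac:(apply @ex_derive_continuous; auto_derive; auto)).
  destruct (filter_and _ _ L1 L2) as [d Hd].
  set (h := Rmin (d / 2) 1).
  assert (Hh : 0 < h /\ h <= 1 /\ h <= d / 2).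
  { unfold h. pose proof (cond_pos d). pose proof (Rmin_l (d / 2) 1). pose proof (Rmin_r (d / 2) 1).
    split; [apply Rmin_pos|]; lra. }
  assert (Hb : ball 0 d h).
  { change (Rabs (h - 0) < d). pose proof (cond_pos d). apply Rabs_def1; lra. }
  destruct (Hd h Hb) as [A B]. rewrite Rmult_0_r, !Rplus_0_r in A, B.
  exists ((s + h) * cos (f + sg * h), (s + h) * sin (f + sg * h)). split.
  - eapply Rle_lt_trans; [apply edist_le_coords|]. simpl. lra.
  - apply polar_in_sector; auto; try lra. apply Hsg. pose proof PI2_1. lra.
Qed.

Lemma is_inf_unique (A : R -> Prop) (m m' : R) : is_inf A m -> is_inf A m' -> m = m'.
Proof. intros [H1 H2] [H3 H4]. apply Rle_antisym; [apply H4 | apply H2]; auto. Qed.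

Lemma dist_set_spec (S : pt -> Prop) (z : pt) :
  (exists s, S s) -> is_inf (fun t => exists s, S s /\ t = edist z s) (dist_set S z).
Proof.
  intros [s0 Hs0]. unfold dist_set. apply epsilon_spec.
  destruct (completeness (fun t => exists s, S s /\ t = - edist z s)) as [m [M1 M2]].
  - exists 0. intros t (s & Hs & ->). pose proof (edist_pos z s). lra.
  - exists (- edist z s0), s0. auto.
  - exists (- m). split.
    + intros t (s & Hs & ->). assert (- edist z s <= m) by (apply M1; eauto). lra.
    + intros m' Hm'. assert (m <= - m'); [|lra]. apply M2. intros t (s & Hs & ->).
      assert (m' <= edist z s) by (apply Hm'; eauto). lra.
Qed.

Lemma dist_bd_lower (Om : pt -> Prop) (z : pt) (m : R) :
  (exists q, boundary Om q) -> (forall q, boundary Om q -> m <= edist z q) ->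
  m <= dist_bd Om z.
Proof.
  intros Hn H. apply (dist_set_spec (boundary Om) z Hn). intros t (s & Hs & ->). auto.
Qed.

Lemma dist_bd_eq (Om : pt -> Prop) (z q : pt) :
  boundary Om q -> (forall p, boundary Om p -> edist z q <= edist z p) ->
  dist_bd Om z = edist z q.
Proof.
  intros Hq H. eapply is_inf_unique; [apply dist_set_spec; eauto|].
  split.
  - intros t (s & Hs & ->). auto.
  - intros m' Hm'. apply Hm'. eauto.
Qed.

Lemma boundary_iff (A B : pt -> Prop) (z : pt) :
  (forall w, A w <-> B w) -> boundary A z -> boundary B z.
Proof.
  intros H Hb eps He. destruct (Hb eps He) as [(w & Hw & Aw) (v & Hv & Av)].
  split; [exists w | exists v]; rewrite <- H; auto.
Qed.

Lemma dist_bd_Lambda (b : R) (z : pt) :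
  PI <= b -> b <= 2 * PI -> in_sector b z -> dist_bd (Lambda b) z = dsec b z.
Proof.
  intros H1 H2 Hz. destruct (dsec_attained b z H1 H2 Hz) as (q & Hq & E & _).
  rewrite <- E. apply dist_bd_eq.
  - apply (boundary_iff (in_sector b)). intros; symmetry; now apply Lambda_in_sector.
    intros eps He. split.
    + destruct (ray_adherent b q eps H1 H2 Hq He) as (w & Hw). eauto.
    + exists q. rewrite edist_refl. split; auto. now apply ray_not_in_sector.
  - intros p Hp. rewrite E. apply dsec_le_edist; auto. apply boundary_sector_ray; auto.
    revert Hp. apply boundary_iff. intros; now apply Lambda_in_sector.
Qed.

(** * Geometry of E *)

(* Coordinates at P along L1 and normal to it, positive on the side of E. *)
Definition tcoord (g : R) (z : pt) : R := - cos g * fst z + sin g * snd z + cos g.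
Definition lcoord (g : R) (z : pt) : R := - sin g * fst z + - cos g * snd z + sin g.

Lemma fst_tl (g : R) (z : pt) : fst z = 1 - tcoord g z * cos g - lcoord g z * sin g.
Proof.
  unfold tcoord, lcoord. pose proof (sin2_cos2' g) as H.
  transitivity (1 - (1 - fst z) * (sin g * sin g + cos g * cos g)); [rewrite H|]; ring.
Qed.

Lemma snd_tl (g : R) (z : pt) : snd z = tcoord g z * sin g - lcoord g z * cos g.
Proof.
  unfold tcoord, lcoord. pose proof (sin2_cos2' g) as H.
  transitivity (snd z * (sin g * sin g + cos g * cos g)); [rewrite H|]; ring.
Qed.

Lemma edist_tl (g : R) (z w : pt) :
  edist z w ^ 2 = (tcoord g z - tcoord g w) ^ 2 + (lcoord g z - lcoord g w) ^ 2.
Proof.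
  rewrite edist_sqr. rewrite (fst_tl g z), (fst_tl g w), (snd_tl g z), (snd_tl g w).
  pose proof (sin2_cos2' g) as H.
  set (a := tcoord g z). set (b := tcoord g w). set (c := lcoord g z). set (d := lcoord g w).
  transitivity (((a - b) ^ 2 + (c - d) ^ 2) * (sin g * sin g + cos g * cos g)); [|rewrite H]; ring.
Qed.

Lemma L1_tl (g : R) (z : pt) : L1 g z <-> lcoord g z = 0 /\ 0 <= tcoord g z.
Proof.
  split.
  - intros (t & Ht & ->). unfold lcoord, tcoord. simpl. pose proof (sin2_cos2' g). split; [ring|].
    replace (- cos g * (1 - t * cos g) + sin g * (t * sin g) + cos g) with t; auto.
    transitivity (t * (sin g * sin g + cos g * cos g)); [rewrite H|]; ring.
  - intros [H1 H2]. exists (tcoord g z). split; auto.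
    rewrite (surjective_pairing z) at 1. rewrite (fst_tl g z), (snd_tl g z) at 1.
    rewrite H1. f_equal; ring.
Qed.

Lemma L3_lin (b : R) (z : pt) :
  L3 b z <-> - sin b * fst z + cos b * snd z + 0 = 0 /\ 0 <= cos b * fst z + sin b * snd z + 0.
Proof.
  pose proof (sin2_cos2' b) as H. split.
  - intros (t & Ht & ->). simpl. split; [ring|].
    replace (cos b * (t * cos b) + sin b * (t * sin b) + 0) with t; auto.
    transitivity (t * (sin b * sin b + cos b * cos b)); [rewrite H|]; ring.
  - intros [H1 H2]. exists (cos b * fst z + sin b * snd z + 0). split; auto.
    rewrite (surjective_pairing z) at 1. f_equal.
    + transitivity (fst z * (sin b * sin b + cos b * cos b)
        + sin b * (- sin b * fst z + cos b * snd z + 0)); [rewrite H, H1|]; ring.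
    + transitivity (snd z * (sin b * sin b + cos b * cos b)
        - cos b * (- sin b * fst z + cos b * snd z + 0)); [rewrite H, H1|]; ring.
Qed.

Lemma locally_not_halfline (a1 b1 c1 a2 b2 c2 : R) (z : pt) :
  ~ (a1 * fst z + b1 * snd z + c1 = 0 /\ 0 <= a2 * fst z + b2 * snd z + c2) ->
  locally z (fun w => ~ (a1 * fst w + b1 * snd w + c1 = 0 /\ 0 <= a2 * fst w + b2 * snd w + c2)).
Proof.
  intros H. pose proof (continuous_lin a1 b1 c1 z) as C1. pose proof (continuous_lin a2 b2 c2 z) as C2.
  pose proof (continuous_const 0 z : continuous (fun _ : pt => 0) z) as C0.
  destruct (Rtotal_order (a1 * fst z + b1 * snd z + c1) 0) as [K | [K | K]].
  - pose proof (locally_lt _ _ z C1 C0 K) as L.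
    eapply filter_imp; [|exact L]. intros w Hw [E _]. exact (Rlt_not_eq _ _ Hw E).
  - assert (K2 : a2 * fst z + b2 * snd z + c2 < 0) by (apply Rnot_le_lt; tauto).
    pose proof (locally_lt _ _ z C2 C0 K2) as L.
    eapply filter_imp; [|exact L]. intros w Hw [_ E].
    exact (Rlt_not_le _ _ Hw E).
  - pose proof (locally_lt _ _ z C0 C1 K) as L.
    eapply filter_imp; [|exact L]. intros w Hw [E _]. exact (Rlt_not_eq _ _ Hw (eq_sym E)).
Qed.

Lemma Gam_closed (b g : R) (z : pt) : ~ Gam b g z -> locally z (fun w => ~ Gam b g w).
Proof.
  intros H.
  assert (A : locally z (fun w => ~ L1 g w)).
  { eapply filter_imp; [|apply (locally_not_halfline (- sin g) (- cos g) (sin g) (- cos g) (sin g) (cos g) z)].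
    - intros w Hw Hl. apply Hw. now apply L1_tl.
    - intros Hl. apply H. left. now apply L1_tl. }
  assert (B : locally z (fun w => ~ L3 b w)).
  { eapply filter_imp; [|apply (locally_not_halfline (- sin b) (cos b) 0 (cos b) (sin b) 0 z)].
    - intros w Hw Hl. apply Hw. now apply L3_lin.
    - intros Hl. apply H. right; right. now apply L3_lin. }
  assert (C : locally z (fun w => ~ L2 w)).
  { destruct (classic (0 * fst z + 1 * snd z + 0 = 0 /\ 0 <= 1 * fst z + 0 * snd z + 0)) as [K | K].
    - assert (K2 : 1 < 1 * fst z + 0 * snd z + 0).
      { apply Rnot_le_lt. intros K2. apply H. right; left. unfold L2. lra. }
      pose proof (locally_lt _ _ z (continuous_const 1 z) (continuous_lin 1 0 0 z) K2) as L.
      eapply filter_imp; [|exact L]. intros [x y] Hw [E _]. simpl in Hw, E. lra.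
    - apply locally_not_halfline in K. eapply filter_imp; [|exact K].
      intros [x y] Hw [E1 E2]. simpl in Hw, E1, E2. apply Hw. lra. }
  eapply filter_imp; [|exact (filter_and _ _ A (filter_and _ _ B C))].
  intros w (N1 & N3 & N2) [G | [G | G]]; tauto.
Qed.

Lemma path_concat (G : pt -> Prop) (z w v : pt) :
  path_avoiding G z w -> path_avoiding G w v -> path_avoiding G z v.
Proof.
  intros (p1 & p2 & Cp1 & Cp2 & P0 & P1 & PG) (q1 & q2 & Cq1 & Cq2 & Q0 & Q1 & QG).
  (* [m] is min (2t, 1) and [n] is max (2t - 1, 0), both continuous on the whole line; p(m) + q(n) -
     w then runs through the first path while q rests at w, and afterwards through the second while
     p rests there. *)
  pose (m := fun t => / 2 * (2 * t + 1 - Rabs (2 * t - 1))).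
  pose (n := fun t => / 2 * (2 * t - 1 + Rabs (2 * t - 1))).
  assert (Ca : continuity (fun t => Rabs (2 * t - 1))).
  { intros t. apply (continuity_pt_comp (fun t => 2 * t - 1) Rabs); [reg | apply Rcontinuity_abs]. }
  assert (Cm : continuity m) by (unfold m; intros t; specialize (Ca t); reg).
  assert (Cn : continuity n) by (unfold n; intros t; specialize (Ca t); reg).
  assert (ml : forall t, t <= / 2 -> m t = 2 * t /\ n t = 0).
  { intros t Ht. unfold m, n. rewrite Rabs_left1 by lra. split; field. }
  assert (mr : forall t, / 2 <= t -> m t = 1 /\ n t = 2 * t - 1).
  { intros t Ht. unfold m, n. rewrite Rabs_pos_eq by lra. split; field. }
  assert (Cc : forall p k, continuity p -> continuity k -> continuity (fun t => p (k t))).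
  { intros p k Hp Hk t. apply (continuity_pt_comp k p); auto. }
  destruct w as [w1 w2]. injection P1 as P1a P1b. injection Q0 as Q0a Q0b.
  exists (fun t => p1 (m t) + q1 (n t) - w1), (fun t => p2 (m t) + q2 (n t) - w2).
  split; [|split; [|split; [|split]]].
  - pose proof (Cc p1 m Cp1 Cm) as A. pose proof (Cc q1 n Cq1 Cn) as B.
    intros t. specialize (A t). specialize (B t). reg.
  - pose proof (Cc p2 m Cp2 Cm) as A. pose proof (Cc q2 n Cq2 Cn) as B.
    intros t. specialize (A t). specialize (B t). reg.
  - destruct (ml 0) as [-> ->]; [lra|]. rewrite Rmult_0_r, Q0a, Q0b, <- P0. f_equal; ring.
  - destruct (mr 1) as [-> ->]; [lra|]. replace (2 * 1 - 1) with 1 by ring.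
    rewrite P1a, P1b, <- Q1. f_equal; ring.
  - intros t Ht. destruct (Rle_dec t (/ 2)).
    + destruct (ml t) as [-> ->]; auto. rewrite Q0a, Q0b.
      replace (p1 (2 * t) + w1 - w1) with (p1 (2 * t)) by ring.
      replace (p2 (2 * t) + w2 - w2) with (p2 (2 * t)) by ring. apply PG. lra.
    + destruct (mr t) as [-> ->]; [lra|]. rewrite P1a, P1b.
      replace (w1 + q1 (2 * t - 1) - w1) with (q1 (2 * t - 1)) by ring.
      replace (w2 + q2 (2 * t - 1) - w2) with (q2 (2 * t - 1)) by ring. apply QG. lra.
Qed.

Lemma path_segment (G : pt -> Prop) (z w : pt) :
  (forall t, 0 <= t <= 1 ->
     ~ G (fst z + t * (fst w - fst z), snd z + t * (snd w - snd z))) ->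
  path_avoiding G z w.
Proof.
  intros H. exists (fun t => fst z + t * (fst w - fst z)), (fun t => snd z + t * (snd w - snd z)).
  split; [reg|split; [reg|split; [|split]]]; auto;
  [rewrite (surjective_pairing z) | rewrite (surjective_pairing w)]; simpl; f_equal; ring.
Qed.

Lemma E_not_Gam (b g : R) (z : pt) : E b g z -> ~ Gam b g z.
Proof.
  intros (eta & He & H). destruct (H (eta / 2)) as (p1 & p2 & _ & _ & P0 & _ & PG); [lra|].
  rewrite <- P0. apply PG. lra.
Qed.

(** Off the closed set [Gam] a whole disc avoids it, and a segment inside the disc joins any of its
    points to a point of [E]; such a disc cannot meet both [E] and its complement. *)
Lemma boundary_E_Gam (b g : R) (z : pt) : boundary (E b g) z -> Gam b g z.
Proof.
  intros B. apply NNPP. intros N. apply Gam_closed, locally_edist in N.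
  destruct N as (e & He & N). destruct (B e He) as [(w & Hw & Ew) (v & Hv & Ev)].
  apply Ev. destruct Ew as (eta & Heta & P). exists eta. split; auto. intros y Hy.
  apply path_concat with w; auto. apply path_segment. intros t Ht. apply N.
  set (q := (fst v + t * (fst w - fst v), snd v + t * (snd w - snd v))).
  apply Rle_lt_trans with ((1 - t) * edist z v + t * edist z w).
  2: { destruct (Req_dec t 0) as [-> | T]; [lra|].
       assert (0 < t * (e - edist z w)) by (apply Rmult_lt_0_compat; lra).
       assert (0 <= (1 - t) * (e - edist z v)) by (apply Rmult_le_pos; lra). lra. }
  apply Rsqr_incr_0_var.
  2: { pose proof (edist_pos z v); pose proof (edist_pos z w). nra. }
  unfold Rsqr. pose proof (edist_sqr z q) as Q. pose proof (edist_sqr z v) as V.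
  pose proof (edist_sqr z w) as W. pose proof (edist_sqr v w) as VW.
  pose proof (edist_pos v w). pose proof (edist_pos z v). pose proof (edist_pos z w).
  assert (T : (edist z v - edist z w) ^ 2 <= edist v w ^ 2).
  { pose proof (edist_triangle z v w). pose proof (edist_triangle z w v) as T2.
    rewrite (edist_sym w v) in T2.
    apply pow_maj_Rabs. apply Rabs_le. lra. }
  replace (edist z q * edist z q) with (edist z q ^ 2) by ring. rewrite Q.
  unfold q; simpl fst; simpl snd.
  (* Stewart's identity for the point dividing the segment in ratio t; it yields the convexity of
     the disc. *)
  assert (Id : (fst z - (fst v + t * (fst w - fst v))) ^ 2 + (snd z - (snd v + t * (snd w - snd v))) ^ 2
    = (1 - t) * edist z v ^ 2 + t * edist z w ^ 2 - t * (1 - t) * edist v w ^ 2).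
  { rewrite V, W, VW. ring. }
  rewrite Id. assert (0 <= t * (1 - t)) by nra. nra.
Qed.

(** * The two sectors that contain E *)

Definition radP (z : pt) : R := rad (fst z - 1, snd z).
(** Coordinate from P along the bisector of the directions PI - g of [L1] and b of [L3]; the
    half-opening of that sector is (b + g - PI) / 2. *)
Definition axialP (b g : R) (z : pt) : R :=
  cos ((b + PI - g) / 2) * fst z + sin ((b + PI - g) / 2) * snd z + - cos ((b + PI - g) / 2).

Lemma polar_P (b g r w : R) :
  0 <= r -> axialP b g (1 + r * cos w, r * sin w) = r * cos (w - (b + PI - g) / 2) /\
  radP (1 + r * cos w, r * sin w) = r.
Proof.
  intros Hr. unfold axialP, radP. simpl. split.
  - rewrite cos_minus. ring.
  - replace (1 + r * cos w - 1) with (r * cos w) by ring. now apply rad_polar.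
Qed.

Lemma edge_direction (c k u v r : R) :
  r ^ 2 = u ^ 2 + v ^ 2 -> cos c * u + sin c * v = cos k * r ->
  (u = r * cos (c - k) /\ v = r * sin (c - k)) \/ (u = r * cos (c + k) /\ v = r * sin (c + k)).
Proof.
  intros Hr H. pose proof (sin2_cos2' c) as C. pose proof (sin2_cos2' k) as K.
  set (y := - sin c * u + cos c * v).
  assert (Hu : u = cos c * (cos k * r) - sin c * y).
  { rewrite <- H. unfold y. transitivity (u * (sin c * sin c + cos c * cos c)); [rewrite C|]; ring. }
  assert (Hv : v = sin c * (cos k * r) + cos c * y).
  { rewrite <- H. unfold y. transitivity (v * (sin c * sin c + cos c * cos c)); [rewrite C|]; ring. }
  assert (Y : y ^ 2 = r ^ 2 - (cos k * r) ^ 2).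
  { rewrite Hr, <- H. unfold y.
    transitivity ((u ^ 2 + v ^ 2) * (sin c * sin c + cos c * cos c) - (cos c * u + sin c * v) ^ 2);
      [|rewrite C]; ring. }
  assert (F : (y - sin k * r) * (y + sin k * r) = 0).
  { transitivity (y ^ 2 - r ^ 2 * (sin k * sin k)); [ring|]. rewrite Y.
    replace (sin k * sin k) with (1 - cos k * cos k) by lra. ring. }
  apply Rmult_integral in F. rewrite cos_minus, cos_plus, sin_minus, sin_plus.
  destruct F as [F | F]; [right | left].
  - assert (Ey : y = sin k * r) by lra. rewrite Ey in Hu, Hv. rewrite Hu, Hv. split; ring.
  - assert (Ey : y = - (sin k * r)) by lra. rewrite Ey in Hu, Hv. rewrite Hu, Hv. split; ring.
Qed.

Lemma cos_le_between (a k : R) : 0 <= k -> k <= a <= 2 * PI - k -> k <= PI -> cos a <= cos k.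
Proof.
  intros H0 H1 H2. pose proof PI_RGT_0. destruct (Rle_dec a PI).
  - apply cos_decr_1; lra.
  - rewrite <- (cos_neg a), <- (cos_period (- a) 1). simpl INR. apply cos_decr_1; lra.
Qed.

Lemma cos_lt_between (a k : R) : 0 <= k -> k < a < 2 * PI - k -> cos a < cos k.
Proof.
  intros H0 H1. pose proof PI_RGT_0. destruct (Rle_dec a PI).
  - apply cos_decreasing_1; lra.
  - rewrite <- (cos_neg a), <- (cos_period (- a) 1). simpl INR. apply cos_decreasing_1; lra.
Qed.

Lemma fst_le_rad (z : pt) : - rad z <= fst z <= rad z /\ - rad z <= snd z <= rad z.
Proof.
  pose proof (rad_sqr z). pose proof (rad_pos z).
  pose proof (pow2_ge_0 (fst z)). pose proof (pow2_ge_0 (snd z)). repeat split; nra.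
Qed.

(* E is contained in the intersection of two sectors: that of L3 and the positive axis at O, and
   the one at P between the directions of L1 and L3; all of the boundary of that region lies in
   Gam, so no path avoiding Gam leaves it. *)
Definition two_sectors (b g : R) (z : pt) : R :=
  Rmin (axial b z + -1 * (cos (b / 2) * rad z))
       (axialP b g z + -1 * (cos ((b + g - PI) / 2) * radP z)).

Lemma two_sectors_edge (b g : R) (z : pt) :
  0 < g -> g <= PI -> PI <= b -> b <= 2 * PI -> two_sectors b g z = 0 -> Gam b g z.
Proof.
  intros G1 G2 B1 B2. unfold two_sectors. intros H.
  set (u := axial b z + -1 * (cos (b / 2) * rad z)) in *.
  set (v := axialP b g z + -1 * (cos ((b + g - PI) / 2) * radP z)) in *.
  pose proof (Rmin_l u v). pose proof (Rmin_r u v).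
  assert (K : (u = 0 /\ 0 <= v) \/ (v = 0 /\ 0 <= u)).
  { unfold Rmin in H. destruct Rle_dec; [left | right]; lra. }
  clear H. destruct K as [[U V] | [V U]].
  - assert (R : ray b z) by (apply axial_edge_ray; auto; unfold u in U; lra).
    destruct R as [[Z1 Z2] | R]; [|right; right; auto].
    destruct (Rle_dec (fst z) 1) as [L | L]; [right; left; unfold L2; lra|].
    assert (Z : z = (1 + (fst z - 1) * cos 0, (fst z - 1) * sin 0)).
    { rewrite cos_0, sin_0. rewrite (surjective_pairing z) at 1. rewrite Z1. f_equal; ring. }
    destruct (polar_P b g (fst z - 1) 0) as [P1 P2]; [lra|]. rewrite <- Z in P1, P2.
    unfold v in V. rewrite P1, P2, Rminus_0_l, cos_neg in V.
    assert (C : cos ((b + g - PI) / 2) <= cos ((b + PI - g) / 2)) by nra.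
    (* Beyond P the positive axis is outside the closed sector at P, except in the two degenerate
       cases where it carries [L1] (g = PI) or [L3] (b = 2 PI). *)
    destruct (Req_dec g PI) as [-> | Gn].
    + left. exists (fst z - 1). split; [lra|]. rewrite cos_PI, sin_PI.
      rewrite (surjective_pairing z) at 1. rewrite Z1. f_equal; ring.
    + destruct (Req_dec b (2 * PI)) as [-> | Bn].
      * right; right. exists (fst z). split; auto. rewrite cos_2PI, sin_2PI.
        rewrite (surjective_pairing z) at 1. rewrite Z1. f_equal; ring.
      * exfalso. assert (cos ((b + PI - g) / 2) < cos ((b + g - PI) / 2)); [|lra].
        apply cos_lt_between; lra.
  - assert (Q : radP z ^ 2 = (fst z - 1) ^ 2 + snd z ^ 2) by exact (rad_sqr (fst z - 1, snd z)).
    destruct (edge_direction ((b + PI - g) / 2) ((b + g - PI) / 2) (fst z - 1) (snd z) (radP z))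
      as [[D1 D2] | [D1 D2]]; auto.
    { unfold v, axialP in V. lra. }
    + replace ((b + PI - g) / 2 - (b + g - PI) / 2) with (PI - g) in D1, D2 by field.
      rewrite cos_minus, cos_PI, sin_PI in D1. rewrite sin_minus, cos_PI, sin_PI in D2.
      left. exists (radP z). split; [apply rad_pos|].
      rewrite (surjective_pairing z) at 1. f_equal; lra.
    + replace ((b + PI - g) / 2 + (b + g - PI) / 2) with b in D1, D2 by field.
      pose proof (rad_pos (fst z - 1, snd z) : 0 <= radP z) as Hr.
      set (t := radP z) in *.
      assert (A : axial b z = cos (b / 2) * (1 + t)).
      { unfold axial. rewrite D2. replace (fst z) with (1 + t * cos b) by lra.
        transitivity (cos (b / 2) + t * cos (b - b / 2)).
        rewrite cos_minus. ring. replace (b - b / 2) with (b / 2) by field. ring. }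
      unfold u in U. rewrite A in U.
      assert (C0 : cos (b / 2) <= 0) by (apply cos_le_0; lra).
      (* The edge leaving P in direction b. If cos (b / 2) < 0, membership in the closed sector at O
         forces rad z >= 1 + t, that is, equality in the triangle inequality, so t = 0 or b points
         along the positive axis. If b = PI, the edge runs back along [L2] and [L3]. *)
      destruct (Req_dec (cos (b / 2)) 0) as [C1 | C1].
      * assert (b = PI).
        { apply Rle_antisym; auto. apply Rnot_lt_le. intros L.
          assert (cos (b / 2) < cos (PI / 2)) by (apply cos_decreasing_1; lra).
          rewrite cos_PI2 in *. lra. }
        subst b. rewrite cos_PI in D1. rewrite sin_PI in D2.
        destruct (Rle_dec t 1); [right; left; unfold L2; lra|].
        right; right. exists (t - 1). rewrite cos_PI, sin_PI. split; [lra|].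
        rewrite (surjective_pairing z) at 1. f_equal; lra.
      * assert (Rz : 1 + t <= rad z) by nra.
        pose proof (rad_sqr z) as Qz. rewrite D2 in Qz.
        replace (fst z) with (1 + t * cos b) in Qz by lra.
        pose proof (sin2_cos2' b) as Sb.
        assert (Qz' : rad z ^ 2 = 1 + 2 * t * cos b + t ^ 2).
        { rewrite Qz. transitivity (1 + 2 * t * cos b + t ^ 2 * (sin b * sin b + cos b * cos b));
            [|rewrite Sb]; ring. }
        assert (T : t * (1 - cos b) <= 0) by nra.
        destruct (Req_dec t 0) as [T0 | T0].
        { right; left. unfold L2. rewrite T0 in D1, D2. lra. }
        assert (Cb : cos b = 1) by (pose proof (COS_bound b); nra).
        assert (Sb0 : sin b = 0) by nra.
        right; right. exists (1 + t). split; [lra|]. rewrite Cb, Sb0.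
        rewrite (surjective_pairing z) at 1. f_equal; nra.
Qed.

Lemma Rmin_abs (a b : R) : Rmin a b = / 2 * (a + b + -1 * Rabs (a + -1 * b)).
Proof.
  unfold Rmin. destruct Rle_dec.
  - rewrite Rabs_left1 by lra. field.
  - rewrite Rabs_right by lra. field.
Qed.

Lemma continuous_two_sectors (b g : R) (z : pt) : continuous (two_sectors b g) z.
Proof.
  assert (M : forall f h : pt -> R, continuous f z -> continuous h z ->
     continuous (fun w => Rmin (f w) (h w)) z).
  { intros f h Hf Hh.
    apply (continuous_ext (fun w => / 2 * (f w + h w + -1 * Rabs (f w + -1 * h w)))).
    - intros w. symmetry. apply Rmin_abs.
    - apply continuous_Rmult; [apply continuous_const|].
      apply continuous_Rplus; [now apply continuous_Rplus|].
      apply continuous_Rmult; [apply continuous_const|].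
      apply (continuous_comp (fun w => f w + -1 * h w) Rabs).
      + apply continuous_Rplus; auto. apply continuous_Rmult; auto. apply continuous_const.
      + apply (continuous_Rabs). }
  apply M.
  - apply continuous_Rplus; [apply continuous_lin|].
    apply continuous_Rmult; [apply continuous_const|].
    apply continuous_Rmult; [apply continuous_const | apply continuous_rad].
  - apply continuous_Rplus; [apply continuous_lin|].
    apply continuous_Rmult; [apply continuous_const|].
    apply continuous_Rmult; [apply continuous_const|].
    apply (continuous_comp_2 (fun w : pt => fst w - 1) (fun w : pt => snd w) (fun a c => rad (a, c))).
    + apply (continuous_ext (fun w : pt => 1 * fst w + 0 * snd w + -1)).
      intros [x y]; simpl; ring. apply continuous_lin.
    + destruct z; apply continuous_snd.
    + apply (continuous_ext rad). now intros [x y]. apply continuous_rad.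
Qed.

Lemma E_two_sectors (b g : R) (z : pt) :
  0 < g -> g <= PI -> PI <= b -> b <= 2 * PI -> E b g z -> 0 < two_sectors b g z.
Proof.
  intros G1 G2 B1 B2 (eta & He & H). pose proof PI_RGT_0 as HPI.
  (* The base point (1/2, tan a / 2) is seen from O in direction a and from P in direction PI - a: a
     < atan (2 eta) makes its height less than [eta], and a < g puts it inside the sector at P. *)
  set (a := Rmin (atan (2 * eta)) g / 2).
  assert (A0 : 0 < atan (2 * eta)) by (rewrite <- atan_0; apply atan_increasing; lra).
  assert (Ha : 0 < a /\ a < atan (2 * eta) /\ a < g /\ a < PI / 2).
  { unfold a. pose proof (Rmin_l (atan (2 * eta)) g). pose proof (Rmin_r (atan (2 * eta)) g).
    pose proof (Rmin_pos _ _ A0 G1). pose proof (atan_bound (2 * eta)). lra. }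
  set (y := tan a / 2).
  assert (Hc : 0 < cos a) by (apply cos_gt_0; lra).
  assert (Hs : 0 < sin a) by (apply sin_gt_0; lra).
  assert (Hy : 0 < y < eta).
  { unfold y. split.
    - pose proof (tan_gt_0 a). lra.
    - assert (tan a < tan (atan (2 * eta))) by (apply tan_increasing; pose proof (atan_bound (2 * eta)); lra).
      rewrite tan_atan in *. lra. }
  assert (S : 0 < two_sectors b g (1 / 2, y)).
  { unfold two_sectors. apply Rmin_pos.
    - assert (Q : in_sector b (1 / 2, y)).
      { replace (1 / 2, y) with (/ (2 * cos a) * cos a, / (2 * cos a) * sin a).
        apply polar_in_sector; auto. apply Rinv_0_lt_compat; lra. lra.
        unfold y, tan. f_equal; field; lra. }
      unfold in_sector in Q. lra.
    - replace (1 / 2, y) with (1 + / (2 * cos a) * cos (PI - a), / (2 * cos a) * sin (PI - a)).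
      2: { unfold y, tan. rewrite cos_minus, sin_minus, cos_PI, sin_PI. f_equal; field; lra. }
      assert (P : 0 < / (2 * cos a)) by (apply Rinv_0_lt_compat; lra).
      destruct (polar_P b g (/ (2 * cos a)) (PI - a)) as [-> ->]; [lra|].
      assert (cos ((b + g - PI) / 2) < cos (PI - a - (b + PI - g) / 2)); [|nra].
      apply cos_lt_cos_abs; [apply Rabs_def1|]; lra. }
  destruct (H y Hy) as (p1 & p2 & C1 & C2 & P0 & P1 & PG).
  apply Rnot_le_lt. intros N.
  pose (f := fun t => two_sectors b g (p1 t, p2 t)).
  assert (Cf : continuity f).
  { intros t. apply continuity_pt_filterlim.
    apply (continuous_comp_2 p1 p2 (fun x y => two_sectors b g (x, y))).
    - apply continuity_pt_filterlim, C1.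
    - apply continuity_pt_filterlim, C2.
    - apply (continuous_ext (two_sectors b g)). now intros [u v]. apply continuous_two_sectors. }
  destruct (Req_dec (two_sectors b g z) 0) as [N0 | N0].
  { apply (PG 0); [lra|]. rewrite P0. now apply two_sectors_edge. }
  destruct (IVT f 0 1 Cf) as (t & Ht & Ft); [lra | | |].
  - unfold f. rewrite P0. lra.
  - unfold f. rewrite P1. exact S.
  - apply (PG t); auto. apply two_sectors_edge; auto.
Qed.

Lemma E_in_sector (b g : R) (z : pt) :
  0 < g -> g <= PI -> PI <= b -> b <= 2 * PI -> E b g z -> in_sector b z.
Proof.
  intros G1 G2 B1 B2 H. apply E_two_sectors in H; auto. unfold two_sectors in H.
  pose proof (Rmin_l (axial b z + -1 * (cos (b / 2) * rad z))
       (axialP b g z + -1 * (cos ((b + g - PI) / 2) * radP z))).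
  unfold in_sector. lra.
Qed.

Lemma Gam_cases (b g : R) (q : pt) : Gam b g q -> L1 g q \/ ray b q.
Proof.
  intros [H | [[H1 H2] | H]]; auto.
  - right; left. lra.
  - right; right; auto.
Qed.

Lemma upper_half_polar (u v : R) : 0 <= v ->
  exists r w, 0 <= r /\ 0 <= w <= PI /\ u = r * cos w /\ v = r * sin w.
Proof.
  intros Hv. set (r := rad (u, v)). pose proof (rad_pos (u, v)) as Hr.
  pose proof (rad_sqr (u, v)) as Q. pose proof (fst_le_rad (u, v)) as F.
  fold r in Hr, Q, F. simpl fst in *; simpl snd in *.
  destruct (Req_dec r 0) as [R0 | R0].
  - exists 0, 0. rewrite R0 in F. pose proof PI_RGT_0. repeat split; lra.
  - assert (B : -1 <= u / r <= 1).
    { split; apply Rmult_le_reg_r with r; try lra; unfold Rdiv; rewrite Rmult_assoc, Rinv_l; lra. }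
    exists r, (acos (u / r)). split; [|split; [|split]]; auto.
    + apply acos_bound.
    + rewrite cos_acos by auto. field; auto.
    + rewrite sin_acos by auto. apply Rsqr_inj; auto.
      * apply Rmult_le_pos; auto. apply sqrt_pos.
      * assert (S : 0 <= 1 - (u / r)²) by (unfold Rsqr; nra).
        rewrite Rsqr_mult, Rsqr_sqrt by auto. unfold Rsqr. field_simplify; auto. nra.
Qed.

(** In the closed upper half-plane, a point beyond the line of [L1] is seen from P in a direction
    between 0 and PI - g, which the sector at P excludes. *)
Lemma E_below_axis (b g : R) (z : pt) :
  0 < g -> g <= PI -> PI <= b -> b <= 2 * PI -> E b g z -> lcoord g z < 0 -> snd z < 0.
Proof.
  intros G1 G2 B1 B2 H L. apply E_two_sectors in H; auto. apply Rnot_le_lt. intros Hv.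
  destruct (upper_half_polar (fst z - 1) (snd z) Hv) as (r & w & Hr & Hw & U & V).
  assert (Z : z = (1 + r * cos w, r * sin w)).
  { rewrite (surjective_pairing z) at 1. f_equal; lra. }
  unfold two_sectors in H.
  match type of H with 0 < Rmin ?x ?y => pose proof (Rmin_r x y) end.
  destruct (polar_P b g r w Hr) as [P1 P2]. rewrite <- Z in P1, P2. rewrite P1, P2 in H, H0.
  assert (Lw : lcoord g z = - (r * sin (w + g))).
  { unfold lcoord. rewrite sin_plus. rewrite Z. simpl. ring. }
  rewrite Lw in L. assert (S : 0 < sin (w + g)) by nra.
  assert (w + g < PI).
  { apply Rnot_le_lt. intros N. assert (sin (w + g) <= 0) by (apply sin_le_0; lra). lra. }
  assert (cos (w - (b + PI - g) / 2) <= cos ((b + g - PI) / 2)); [|nra].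
  rewrite <- (cos_neg (w - _)). apply cos_le_between; lra.
Qed.

(** * Distance to the boundary of E *)

Lemma abs_le_of_sqr (a d : R) : 0 <= d -> a ^ 2 <= d ^ 2 -> Rabs a <= d.
Proof.
  intros Hd H. rewrite <- (Rabs_pos_eq d) by auto. apply Rsqr_le_abs_0. unfold Rsqr. lra.
Qed.

Lemma Gam_dist_cases (b g : R) (z : pt) :
  0 < g -> g <= PI -> PI <= b -> b <= 2 * PI -> E b g z ->
  (forall q, Gam b g q -> dsec b z <= edist z q) \/
  (0 < tcoord g z /\ 0 < lcoord g z < dsec b z /\ forall q, Gam b g q -> lcoord g z <= edist z q).
Proof.
  intros G1 G2 B1 B2 H. pose proof (E_in_sector b g z G1 G2 B1 B2 H) as Hz.
  assert (R : forall q, ray b q -> dsec b z <= edist z q) by (intros; now apply dsec_le_edist).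
  destruct (classic (forall q, L1 g q -> dsec b z <= edist z q)) as [N | N].
  - left. intros q Hq. destruct (Gam_cases b g q Hq); auto.
  - right. apply not_all_ex_not in N. destruct N as [q N].
    assert (Hq : L1 g q) by tauto. assert (D : edist z q < dsec b z) by (apply Rnot_le_lt; tauto).
    clear N. apply L1_tl in Hq. destruct Hq as [Q1 Q2].
    pose proof (edist_tl g z q) as Ez. rewrite Q1 in Ez.
    (* If the foot of [z] on the line of [L1] did not lie beyond P, then P, which is on a side of
       the sector, would be at least as near as [q]. *)
    assert (Ht : 0 < tcoord g z).
    { apply Rnot_le_lt. intros T.
      assert (dsec b z <= edist z (1, 0)) by (apply R; left; simpl; lra).
      pose proof (edist_tl g z (1, 0)) as EP. unfold tcoord at 2, lcoord at 2 in EP. simpl fst in EP.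
      simpl snd in EP. ring_simplify (- cos g * 1 + sin g * 0 + cos g) in EP.
      ring_simplify (- sin g * 1 + - cos g * 0 + sin g) in EP.
      pose proof (edist_pos z q). pose proof (edist_pos z (1, 0)).
      assert (edist z (1, 0) ^ 2 <= edist z q ^ 2) by nra. nra. }
    assert (Hl : Rabs (lcoord g z) <= edist z q).
    { apply abs_le_of_sqr; [apply edist_pos|]. rewrite Ez. rewrite Rminus_0_r.
      pose proof (pow2_ge_0 (tcoord g z - tcoord g q)). lra. }
    assert (L0 : lcoord g z <> 0).
    { intros L0. apply (E_not_Gam b g z H). left. apply L1_tl. split; auto. lra. }
    assert (Lp : 0 < lcoord g z).
    { apply Rnot_le_lt. intros L. assert (L' : lcoord g z < 0) by lra.
      pose proof (E_below_axis b g z G1 G2 B1 B2 H L') as Y.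
      rewrite (snd_tl g z) in Y.
      assert (Hs : 0 <= sin g) by (apply sin_ge_0; lra).
      assert (Hc : cos g < 0) by nra.
      set (t := tcoord g z) in *. set (l := lcoord g z) in *.
      set (s := t * sin g / cos g).
      assert (Es : s * cos g = t * sin g) by (unfold s; field; lra).
      assert (S : l < s <= 0) by (split; nra).
      (* For [z] on the wrong side of the line of [L1], the perpendicular to that line meets the
         positive x-axis at [p], before reaching [L1]: a point on a side of the sector at distance
         at most - l, against the choice of [q]. *)
      pose (p := (1 - t * cos g - s * sin g, 0) : pt).
      assert (Rp : ray b p) by (left; unfold p; simpl; split; auto; nra).
      specialize (R p Rp).
      assert (T : tcoord g p = t /\ lcoord g p = s).
      { pose proof (sin2_cos2' g) as SC. unfold tcoord, lcoord, p; simpl. split.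
        - transitivity (t * (cos g * cos g) + sin g * (s * cos g)); [ring|]. rewrite Es.
          transitivity (t * (sin g * sin g + cos g * cos g)); [ring | rewrite SC; ring].
        - transitivity (cos g * (t * sin g) + s * (sin g * sin g)); [ring|]. rewrite <- Es.
          transitivity (s * (sin g * sin g + cos g * cos g)); [ring | rewrite SC; ring]. }
      pose proof (edist_tl g z p) as EP. destruct T as [-> ->] in EP. fold t l in EP.
      pose proof (edist_pos z p). pose proof (edist_pos z q).
      rewrite Rabs_left in Hl by auto.
      assert (edist z p ^ 2 <= l ^ 2) by (rewrite EP; nra).
      assert (edist z p <= - l) by nra. lra. }
    rewrite Rabs_pos_eq in Hl by lra.
    split; [|split]; auto; [lra|].
    intros p Hp. destruct (Gam_cases b g p Hp) as [P | P].
    + apply L1_tl in P. destruct P as [P1 P2]. pose proof (edist_tl g z p) as EP. rewrite P1 in EP.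
      rewrite <- (Rabs_pos_eq (lcoord g z)) by lra. apply abs_le_of_sqr; [apply edist_pos|].
      rewrite EP, Rminus_0_r. pose proof (pow2_ge_0 (tcoord g z - tcoord g p)). lra.
    + specialize (R p P). lra.
Qed.

Lemma L1_away_from_O (g : R) : 0 < g -> g <= PI ->
  exists r1, 0 < r1 /\ r1 <= 1 / 2 /\ forall q, L1 g q -> r1 < rad q.
Proof.
  intros G1 G2. assert (K : exists m, 0 < m /\ forall q, L1 g q -> m <= rad q).
  { destruct (Req_dec g PI) as [-> | N].
    - exists 1. split; [lra|]. intros q (t & Ht & ->). pose proof (fst_le_rad (1 - t * cos PI, t * sin PI)).
      rewrite cos_PI in *. simpl in *. lra.
    - assert (S : 0 < sin g) by (apply sin_gt_0; lra). exists (sin g). split; auto.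
      intros q (t & Ht & ->). apply Rsqr_incr_0_var; [|apply rad_pos]. unfold Rsqr.
      pose proof (rad_sqr (1 - t * cos g, t * sin g)) as Q. simpl fst in Q; simpl snd in Q.
      pose proof (sin2_cos2' g) as SC.
      assert (Id : (1 - t * cos g) ^ 2 + (t * sin g) ^ 2 = sin g * sin g + (t - cos g) ^ 2).
      { transitivity (1 - 2 * t * cos g + t ^ 2 * (sin g * sin g + cos g * cos g)); [ring|].
        transitivity ((sin g * sin g + cos g * cos g) - 2 * t * cos g + t ^ 2); [rewrite SC; ring | ring]. }
      rewrite Id in Q. pose proof (pow2_ge_0 (t - cos g)). lra. }
  destruct K as (m & Hm & K). exists (Rmin (m / 2) (1 / 2)).
  pose proof (Rmin_l (m / 2) (1 / 2)). pose proof (Rmin_r (m / 2) (1 / 2)).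
  split; [apply Rmin_pos; lra|]. split; auto. intros q Hq. specialize (K q Hq). lra.
Qed.

Lemma sector_not_Gam (b g : R) (z : pt) : in_sector b z -> ~ L1 g z -> ~ Gam b g z.
Proof.
  intros H N K. destruct (Gam_cases b g z K) as [L | L]; auto.
  exact (ray_not_in_sector b z L H).
Qed.

(** The connecting path turns about O at constant radius, too small to meet [L1], and then moves
    along the ray through the base point (1/2, y). *)
Lemma near_O_in_E (b g : R) : 0 < g -> g <= PI -> PI <= b -> b <= 2 * PI ->
  exists r1, 0 < r1 /\ r1 <= 1 / 2 /\ (forall q, L1 g q -> r1 < rad q) /\
    forall z, in_sector b z -> rad z <= r1 -> E b g z.
Proof.
  intros G1 G2 B1 B2. destruct (L1_away_from_O g G1 G2) as (r1 & R0 & R1 & RL).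
  exists r1. repeat split; auto. intros z Hz Hr.
  pose proof PI_RGT_0 as HPI.
  assert (K : exists eta, 0 < eta /\ forall x y, 0 < y -> y < eta -> x <= 1 / 2 -> ~ L1 g (x, y)).
  { destruct (Req_dec g PI) as [-> | N].
    - exists 1. split; [lra|]. intros x y Hy _ _ (t & _ & Q). injection Q as _ Q.
      rewrite sin_PI in Q. lra.
    - assert (S : 0 < sin g) by (apply sin_gt_0; lra). exists (sin g / 2). split; [lra|].
      intros x y H1 H2 H3 L. apply L1_tl in L. destruct L as [L _]. unfold lcoord in L. simpl in L.
      pose proof (COS_bound g). nra. }
  destruct K as (eta & He & K). exists eta. split; auto. intros y Hy.
  destruct (in_sector_pos b z Hz) as [Hr0 Hp]. destruct (ang_spec b z Hp) as [Ez _].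
  pose proof (in_sector_ang b z B1 B2 Hz) as Ha.
  set (r := rad z) in *. set (t0 := ang b z) in *. set (t1 := atan (2 * y)).
  assert (T1 : 0 < t1 < PI / 2).
  { unfold t1. pose proof (atan_bound (2 * y)). split; [|lra].
    rewrite <- atan_0. apply atan_increasing. lra. }
  assert (Hc : 0 < cos t1) by (apply cos_gt_0; lra).
  assert (Hs : 0 < sin t1) by (apply sin_gt_0; lra).
  assert (Et : sin t1 = 2 * y * cos t1).
  { assert (tan t1 = 2 * y) by apply tan_atan. unfold tan in *.
    apply Rmult_eq_reg_r with (/ cos t1); [|apply Rinv_neq_0_compat; lra].
    unfold Rdiv in *. rewrite H. field. lra. }
  apply path_concat with (r * cos t1, r * sin t1).
  - exists (fun t => r * cos (t0 + t * (t1 - t0))), (fun t => r * sin (t0 + t * (t1 - t0))).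
    split; [|split; [|split; [|split]]].
    + reg.
    + reg.
    + rewrite Rmult_0_l, Rplus_0_r. auto.
    + rewrite Rmult_1_l. replace (t0 + (t1 - t0)) with t1 by ring. auto.
    + intros t Ht. apply sector_not_Gam.
      * apply polar_in_sector; auto. split.
        -- destruct (Rle_dec 0 (t1 - t0)); nra.
        -- destruct (Rle_dec 0 (t1 - t0)); nra.
      * intros L. specialize (RL _ L). rewrite rad_polar in RL; lra.
  - apply path_segment. simpl. intros t Ht.
    assert (C1 := COS_bound t1).
    set (r' := / (2 * cos t1)).
    assert (Hr' : 0 < r') by (apply Rinv_0_lt_compat; lra).
    assert (E1 : 1 / 2 = r' * cos t1) by (unfold r'; field; lra).
    assert (E2 : y = r' * sin t1) by (rewrite Et; unfold r'; field; lra).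
    set (s := r + t * (r' - r)).
    assert (X : r * cos t1 + t * (1 / 2 - r * cos t1) = s * cos t1) by (rewrite E1; unfold s; ring).
    assert (Y : r * sin t1 + t * (y - r * sin t1) = s * sin t1) by (rewrite E2; unfold s; ring).
    assert (R' : / 2 <= r').
    { unfold r'. apply Rinv_le_contravar; lra. }
    assert (S : 0 < s <= r').
    { unfold s. split; [|nra]. destruct (Rle_dec 0 (r' - r)); nra. }
    assert (N : ~ L1 g (s * cos t1, s * sin t1)).
    { destruct (Req_dec s r') as [-> | Ns].
      - rewrite <- E1, <- E2. apply K; lra.
      - apply K; nra. }
    rewrite X, Y. apply sector_not_Gam; auto. apply polar_in_sector; auto; lra.
Qed.

Lemma ray_boundary_E (b g r1 : R) (q : pt) :
  PI <= b -> b <= 2 * PI -> r1 <= 1 / 2 ->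
  (forall z, in_sector b z -> rad z <= r1 -> E b g z) ->
  ray b q -> rad q < r1 -> boundary (E b g) q.
Proof.
  intros B1 B2 R1 H Hq Hr eps He. split.
  - destruct (ray_adherent b q (Rmin eps (r1 - rad q)) B1 B2 Hq) as (w & Hw & Sw).
    { apply Rmin_pos; lra. }
    pose proof (Rmin_l eps (r1 - rad q)). pose proof (Rmin_r eps (r1 - rad q)).
    exists w. split; [lra|]. apply H; auto.
    rewrite rad_edist in *. pose proof (edist_triangle w q (0, 0)) as T.
    rewrite (edist_sym w q) in T. lra.
  - exists q. rewrite edist_refl. split; auto. intros N. apply E_not_Gam in N. apply N.
    destruct Hq as [[Q1 Q2] | Q]; [|right; right; auto].
    right; left. pose proof (fst_le_rad q). unfold L2. lra.
Qed.

Lemma boundary_E_nonempty (b g : R) : 0 < g -> g <= PI -> PI <= b -> b <= 2 * PI ->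
  exists q, boundary (E b g) q.
Proof.
  intros G1 G2 B1 B2. destruct (near_O_in_E b g G1 G2 B1 B2) as (r1 & R0 & R1 & _ & H).
  exists (0, 0). apply ray_boundary_E with r1; auto.
  - left. simpl. lra.
  - rewrite rad_edist, edist_refl. auto.
Qed.

(** Lower bounds suffice, because the field inequality has - c / d ^ 2 on its right-hand side; so it
    is enough that the boundary of [E] lies in [Gam]. *)
Lemma dist_bd_E_cases (b g : R) (z : pt) :
  0 < g -> g <= PI -> PI <= b -> b <= 2 * PI -> E b g z ->
  dsec b z <= dist_bd (E b g) z \/
  (0 < tcoord g z /\ 0 < lcoord g z < dsec b z /\ lcoord g z <= dist_bd (E b g) z).
Proof.
  intros G1 G2 B1 B2 H. pose proof (boundary_E_nonempty b g G1 G2 B1 B2) as NE.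
  destruct (Gam_dist_cases b g z G1 G2 B1 B2 H) as [K | (K1 & K2 & K)].
  - left. apply dist_bd_lower; auto. intros q Hq. apply K, boundary_E_Gam, Hq.
  - right. split; [|split]; auto.
    apply dist_bd_lower; auto. intros q Hq. apply K, boundary_E_Gam, Hq.
Qed.

Lemma dist_bd_E_near_O (b g : R) : 0 < g -> g <= PI -> PI <= b -> b <= 2 * PI ->
  exists r1, 0 < r1 /\ forall z, in_sector b z -> rad z <= r1 ->
    E b g z /\ dist_bd (E b g) z = dsec b z.
Proof.
  intros G1 G2 B1 B2. destruct (near_O_in_E b g G1 G2 B1 B2) as (r1 & R0 & R1 & RL & H).
  (* Points of [L1] have radius above [r1], hence distance at least r1 / 2 from [z], which is no
     less than rad z >= dsec b z. *)
  exists (r1 / 2). split; [lra|]. intros z Hz Hr. split; [apply H; auto; lra|].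
  destruct (dsec_attained b z B1 B2 Hz) as (q & Hq & E1 & Eq). rewrite <- E1.
  apply dist_bd_eq.
  - apply ray_boundary_E with r1; auto. lra.
  - intros p Hp. apply boundary_E_Gam in Hp. rewrite E1.
    destruct (Gam_cases b g p Hp) as [P | P]; [|now apply dsec_le_edist].
    specialize (RL p P).
    assert (dsec b z <= rad z).
    { unfold dsec. destruct (sfun_bounds b (ang b z) B1 (in_sector_ang b z B1 B2 Hz)).
      pose proof (rad_pos z). nra. }
    rewrite rad_edist in RL. rewrite rad_edist in Hr, H0.
    pose proof (edist_triangle p z (0, 0)) as T. rewrite (edist_sym p z) in T. lra.
Qed.

(** * Scaling at O *)

Definition dil (N : R) (z : pt) : pt := (N * fst z, N * snd z).

Lemma rad_dil (N : R) (z : pt) : 0 < N -> rad (dil N z) = N * rad z.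
Proof.
  intros HN. unfold rad, dil. simpl fst; simpl snd.
  replace ((N * fst z) ^ 2 + (N * snd z) ^ 2) with (N ^ 2 * (fst z ^ 2 + snd z ^ 2)) by ring.
  rewrite sqrt_mult_alt by nra. f_equal. apply sqrt_pow2. lra.
Qed.

Lemma axial_dil (b N : R) (z : pt) : axial b (dil N z) = N * axial b z.
Proof. unfold axial, dil; simpl; ring. Qed.

Lemma transv_dil (b N : R) (z : pt) : transv b (dil N z) = N * transv b z.
Proof. unfold transv, dil; simpl; ring. Qed.

Lemma in_sector_dil (b N : R) (z : pt) : 0 < N -> in_sector b (dil N z) -> in_sector b z.
Proof.
  intros HN. unfold in_sector. rewrite rad_dil, axial_dil by auto. intros H.
  apply Rmult_lt_reg_l with N; auto. lra.
Qed.

Lemma dsec_dil (b N : R) (z : pt) : 0 < N -> in_sector b z -> dsec b (dil N z) = N * dsec b z.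
Proof.
  intros HN Hz. destruct (in_sector_pos b z Hz) as [H1 H2].
  assert (A : ang b (dil N z) = ang b z).
  { unfold ang. rewrite rad_dil, axial_dil, transv_dil by auto. do 3 f_equal. field. split; nra. }
  unfold dsec. rewrite A, rad_dil by auto. ring.
Qed.

Lemma edist_dil (N : R) (z w : pt) : 0 < N -> edist (dil N z) (dil N w) = N * edist z w.
Proof.
  intros HN. unfold edist, dil. simpl fst; simpl snd.
  replace ((N * fst z - N * fst w) ^ 2 + (N * snd z - N * snd w) ^ 2)
    with (N ^ 2 * ((fst z - fst w) ^ 2 + (snd z - snd w) ^ 2)) by ring.
  rewrite sqrt_mult_alt by nra. f_equal. apply sqrt_pow2. lra.
Qed.

Lemma smooth_family_dil (N : R) (u : pt -> R) (D : list bool -> pt -> R) :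
  0 < N -> smooth_family u D ->
  smooth_family (fun z => u (dil N z)) (fun w z => N ^ length w * D w (dil N z)).
Proof.
  intros HN [H0 H]. split.
  - apply functional_extensionality. intros z. rewrite <- H0. simpl. ring.
  - intros w. destruct (H w) as (C & X & Y). split; [|split].
    + apply cont2_continuous. intros z. apply continuous_Rmult; [apply continuous_const|].
      apply (continuous_comp_2 (fun z : pt => N * fst z) (fun z : pt => N * snd z)
        (fun a b => D w (a, b))).
      * apply continuous_Rmult; [apply continuous_const|]. destruct z; apply continuous_fst.
      * apply continuous_Rmult; [apply continuous_const|]. destruct z; apply continuous_snd.
      * apply (continuous_ext (D w)). now intros [a b]. now apply cont2_continuous.
    + intros x y. apply is_derive_Reals. unfold dil; simpl fst; simpl snd.
      specialize (X (N * x) (N * y)). apply is_derive_Reals in X.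
      evar_last.
      * apply @is_derive_scal. apply (is_derive_comp (fun t => D w (t, N * y)) (fun t => N * t)).
        exact X. auto_derive; auto.
      * simpl. unfold scal; simpl; unfold mult; simpl. ring.
    + intros x y. apply is_derive_Reals. unfold dil; simpl fst; simpl snd.
      specialize (Y (N * x) (N * y)). apply is_derive_Reals in Y.
      evar_last.
      * apply @is_derive_scal. apply (is_derive_comp (fun t => D w (N * x, t)) (fun t => N * t)).
        exact Y. auto_derive; auto.
      * simpl. unfold scal; simpl; unfold mult; simpl. ring.
Qed.

Lemma hardy_ineq_E_Lambda (b g c : R) :
  0 < g -> g <= PI -> PI <= b -> b <= 2 * PI ->
  hardy_ineq (E b g) c -> hardy_ineq (Lambda b) c.
Proof.
  intros G1 G2 B1 B2 H u D HD (K & HKc & (M & HM) & HKL & HK0) I1 I2 H1 H2.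
  destruct (dist_bd_E_near_O b g G1 G2 B1 B2) as (r1 & R1 & HR).
  (* [M] bounds the support of [u], so z -> u (N z) is supported in the disc of radius [r1], where
     the distances for [E] and for the sector agree. *)
  set (N := Rmax 1 (M / r1)).
  assert (HN1 : 1 <= N) by apply Rmax_l.
  assert (HN2 : M <= N * r1).
  { pose proof (Rmax_r 1 (M / r1)). fold N in H0.
    apply Rmult_le_compat_r with (r := r1) in H0; [|lra].
    unfold Rdiv in H0. rewrite Rmult_assoc, Rinv_l in H0; lra. }
  assert (HN : 0 < N) by lra.
  assert (Q : forall z, K (dil N z) -> in_sector b z /\ E b g z /\
     dist_bd (Lambda b) (dil N z) = N * dist_bd (E b g) z).
  { intros z Hz. pose proof (HKL _ Hz) as L. apply Lambda_in_sector in L; auto.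
    pose proof (in_sector_dil b N z HN L) as Sz.
    assert (Rz : rad z <= r1).
    { specialize (HM _ Hz). rewrite <- rad_edist, rad_dil in HM by auto. nra. }
    destruct (HR z Sz Rz) as [Ez Dz]. repeat split; auto.
    rewrite Dz, dist_bd_Lambda, dsec_dil; auto. }
  apply (H (fun z => u (dil N z)) (fun w z => N ^ length w * D w (dil N z))).
  - now apply smooth_family_dil.
  - exists (fun z => K (dil N z)). split; [|split; [|split]].
    + intros z Hz. destruct (HKc _ Hz) as (e & He & Hw). exists (e / N). split.
      now apply Rdiv_lt_0_compat. intros w Hzw. apply Hw. rewrite edist_dil by auto.
      apply Rmult_lt_compat_l with (r := N) in Hzw; auto.
      replace (N * (e / N)) with e in Hzw by (field; lra). auto.
    + exists (M / N). intros z Hz. specialize (HM _ Hz).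
      rewrite <- rad_edist, rad_dil in HM by auto. rewrite <- rad_edist.
      apply Rmult_le_reg_l with N; auto. replace (N * (M / N)) with M by (field; lra). auto.
    + intros z Hz. now apply Q.
    + intros z Hz. now apply HK0.
  - apply (Int2_scale _ _ N HN) in H1.
    replace (fun z => (N ^ length (true :: nil) * D (true :: nil) (dil N z)) ^ 2 +
        (N ^ length (false :: nil) * D (false :: nil) (dil N z)) ^ 2)
      with (fun z : pt => N ^ 2 * (D (true :: nil) (N * fst z, N * snd z) ^ 2 + D (false :: nil) (N * fst z, N * snd z) ^ 2)); auto.
    apply functional_extensionality. intros z. unfold dil. simpl length. ring.
  - apply (Int2_scale _ _ N HN) in H2.
    replace (fun z => u (dil N z) ^ 2 / dist_bd (E b g) z ^ 2)
      with (fun z : pt => N ^ 2 * (u (N * fst z, N * snd z) ^ 2 /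
         dist_bd (Lambda b) (N * fst z, N * snd z) ^ 2)); auto.
    apply functional_extensionality. intros z. fold (dil N z).
    destruct (classic (K (dil N z))) as [Hz | Hz].
    + destruct (Q z Hz) as (_ & _ & ->). unfold Rdiv. rewrite Rpow_mult_distr, Rinv_mult.
      generalize (/ dist_bd (E b g) z ^ 2) (u (dil N z)). intros. field; lra.
    + rewrite HK0 by auto. unfold Rdiv. ring.
Qed.

(** Least upper bounds depend only on the set of upper bounds, and an upper bound m below an
    admissible c is refuted by the midpoint of m and c. Admissibility of 0 gives m >= 0, which makes
    that midpoint positive. *)
Lemma hardy_constant_eq (A B : pt -> Prop) (H : R) :
  (forall c, hardy_ineq B c -> hardy_ineq A c) ->
  (forall c c', 0 < c' -> c' < c -> hardy_ineq A c -> hardy_ineq B c') ->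
  hardy_constant A H <-> hardy_constant B H.
Proof.
  intros BA AB.
  assert (Z : hardy_ineq B 0).
  { intros u D HD HK I1 I2 H1 H2. rewrite Rmult_0_l.
    destruct (Int2_eventually _ _ H1) as (M & HM & Q). destruct (Q M (Rle_refl M)) as (_ & Q2 & <-).
    rewrite <- (iint_zero M). apply iint_le; auto.
    - apply box_integrable_continuous. intros; apply continuous_const.
    - intros z. nra. }
  assert (U : forall m, is_upper_bound (fun c => 0 <= c /\ hardy_ineq A c) m <->
                        is_upper_bound (fun c => 0 <= c /\ hardy_ineq B c) m).
  { intros m. split; intros Hm c [Hc Hi].
    - apply Hm; auto.
    - assert (M0 : 0 <= m) by (apply Hm; split; auto; lra).
      apply Rnot_lt_le. intros L. set (c' := (m + c) / 2).
      assert (c' <= m); [|unfold c' in *; lra].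
      apply Hm. split; [unfold c'; lra|]. apply AB with c; auto; unfold c'; lra. }
  unfold hardy_constant, is_lub. split; intros [H1 H2]; split; try (now apply U);
    intros m Hm; apply H2, U, Hm.
Qed.

(** * Flux across the transition zone *)

(** Polar coordinates about the mirror centre O', the point with [tcoord] -1 and [lcoord] 0, with
    angles measured from the direction of [L1]. For g = PI this centre is O itself. *)
Definition ang2 (g : R) (z : pt) : R := atan (lcoord g z / (1 + tcoord g z)).
Definition rad2 (g : R) (z : pt) : R := sqrt ((1 + tcoord g z) ^ 2 + lcoord g z ^ 2).

Definition nearer_L1 (b g : R) (z : pt) : Prop :=
  in_sector b z /\ 0 < tcoord g z /\ 0 < lcoord g z < dsec b z.

Lemma atan_polar (p l : R) : 0 < p -> 0 < l ->
  0 < atan (l / p) < PI / 2 /\ 0 < sqrt (p ^ 2 + l ^ 2) /\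
  p = sqrt (p ^ 2 + l ^ 2) * cos (atan (l / p)) /\ l = sqrt (p ^ 2 + l ^ 2) * sin (atan (l / p)).
Proof.
  intros Hp Hl. set (r := sqrt (p ^ 2 + l ^ 2)).
  assert (S : 0 < p ^ 2 + l ^ 2) by nra.
  assert (Hr : 0 < r) by now apply sqrt_lt_R0.
  assert (Q : r ^ 2 = p ^ 2 + l ^ 2) by (unfold r; rewrite pow2_sqrt; lra).
  assert (D : 0 < l / p) by now apply Rdiv_lt_0_compat.
  assert (E : sqrt (1 + (l / p)²) = r / p).
  { apply Rsqr_inj; [apply sqrt_pos | left; now apply Rdiv_lt_0_compat |].
    rewrite Rsqr_sqrt by (unfold Rsqr; nra). unfold Rsqr.
    replace (r / p * (r / p)) with (r ^ 2 / p ^ 2) by (field; lra). rewrite Q. field; lra. }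
  repeat split; auto.
  - rewrite <- atan_0. now apply atan_increasing.
  - pose proof (atan_bound (l / p)). lra.
  - rewrite cos_atan, E. field; lra.
  - rewrite sin_atan, E. field; lra.
Qed.

Lemma tl_point (g t s : R) :
  tcoord g (1 - t * cos g - s * sin g, t * sin g - s * cos g) = t /\
  lcoord g (1 - t * cos g - s * sin g, t * sin g - s * cos g) = s.
Proof.
  pose proof (sin2_cos2' g) as SC. unfold tcoord, lcoord; simpl. split.
  - transitivity (t * (sin g * sin g + cos g * cos g)); [ring | rewrite SC; ring].
  - transitivity (s * (sin g * sin g + cos g * cos g)); [ring | rewrite SC; ring].
Qed.

(** If the perpendicular from [z] to the line of [L1] crossed the x-axis at a nonnegative abscissa,
    it would hit a side of the sector within distance [lcoord] of [z], although [dsec] is larger. *)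
Lemma foot_segment_misses_axis (b g s : R) (z : pt) :
  PI <= b -> b <= 2 * PI -> nearer_L1 b g z ->
  s * cos g = tcoord g z * sin g -> 0 <= s <= lcoord g z ->
  1 - tcoord g z * cos g - s * sin g < 0.
Proof.
  intros B1 B2 (Hz & Ht & Hl) Es Hs. apply Rnot_le_lt. intros X.
  set (t := tcoord g z) in *. set (l := lcoord g z) in *.
  pose (q := (1 - t * cos g - s * sin g, t * sin g - s * cos g) : pt).
  assert (R : dsec b z <= edist z q).
  { apply dsec_le_edist; auto. left. unfold q; simpl. lra. }
  destruct (tl_point g t s) as [T1 T2]. fold q in T1, T2.
  pose proof (edist_tl g z q) as Q. rewrite T1, T2 in Q. fold t l in Q.
  pose proof (edist_pos z q). nra.
Qed.

(** O has coordinates cos g and sin g in the frame of [L1]. So ang - PI + g is the direction of [z]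
    as seen from O, measured from the direction of [L1]. *)
Lemma sigma_coords (b g : R) (z : pt) : 0 < rad z + axial b z ->
  rad z * cos (ang b z - PI + g) = tcoord g z - cos g /\
  rad z * sin (ang b z - PI + g) = lcoord g z - sin g.
Proof.
  intros Hp. destruct (ang_spec b z Hp) as [Ez _].
  pose proof (f_equal fst Ez) as Ex. pose proof (f_equal snd Ez) as Ey. simpl in Ex, Ey.
  unfold tcoord, lcoord. rewrite Ex, Ey.
  replace (ang b z - PI + g) with (- (PI - (ang b z + g))) by ring.
  rewrite cos_neg, sin_neg, Rtrigo_facts.cos_pi_minus, Rtrigo_facts.sin_pi_minus, cos_plus, sin_plus.
  split; ring.
Qed.

(** The core is [T]: the foot of [z] on the line of [L1] lies beyond the foot of O, which makes the
    cosine of the angle positive. Below the x-axis this comes from [foot_segment_misses_axis], above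
    it mostly from signs. It remains to select the right interval among those where the cosine is
    positive. *)
Lemma nearer_L1_direction (b g : R) (z : pt) :
  0 < g -> g <= PI -> PI <= b -> b <= 2 * PI -> nearer_L1 b g z -> PI / 2 <= ang b z ->
  - (PI / 2) < ang b z - PI + g < PI / 2.
Proof.
  intros G1 G2 B1 B2 HN Ha. pose proof HN as (Hz & Ht & Hl). pose proof PI_RGT_0 as HPI.
  destruct (in_sector_pos b z Hz) as [Hr Hp]. destruct (ang_spec b z Hp) as [Ez _].
  pose proof (in_sector_ang b z B1 B2 Hz) as Hb.
  pose proof (sin2_cos2' g) as SC.
  pose proof (f_equal fst Ez) as Ex. pose proof (f_equal snd Ez) as Ey. simpl in Ex, Ey.
  pose proof (fst_tl g z) as Fx. pose proof (snd_tl g z) as Fy.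
  destruct (sigma_coords b g z Hp) as [Hc _].
  pose proof (fun s => foot_segment_misses_axis b g s z B1 B2 HN) as X.
  set (t := tcoord g z) in *. set (l := lcoord g z) in *. set (a := ang b z) in *.
  set (r := rad z) in *.
  assert (Hs : 0 <= sin g) by (apply sin_ge_0; lra).
  assert (Y0 : snd z < 0 -> 0 < cos g /\ cos g < t /\ fst z < 0).
  { intros Y. assert (Cg : 0 < cos g) by nra.
    set (s := t * sin g / cos g).
    assert (Es : s * cos g = t * sin g) by (unfold s; field; lra).
    assert (S : 0 <= s <= l) by (split; nra).
    specialize (X s Es S).
    assert (cos g < t).
    { apply Rmult_lt_compat_r with (r := cos g) in X; auto.
      replace ((1 - t * cos g - s * sin g) * cos g) with (cos g - t * (cos g * cos g) - sin g * (s * cos g)) in X by ring.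
      rewrite Es in X. replace (cos g - t * (cos g * cos g) - sin g * (t * sin g)) with
        (cos g - t * (sin g * sin g + cos g * cos g)) in X by ring. rewrite SC in X. lra. }
    split; [|split]; auto. nra. }
  assert (T : cos g < t).
  { destruct (Rlt_dec (snd z) 0) as [Y | Y]; [now apply Y0|].
    destruct (Rlt_dec (cos g) t) as [T | T]; auto. exfalso.
    assert (Cg : 0 < cos g) by lra.
    assert (Apos : a <= PI).
    { apply Rnot_lt_le. intros N. assert (sin a < 0) by (apply sin_lt_0; lra). nra. }
    assert (cos a <= 0) by (apply cos_le_0; lra).
    assert (fst z <= 0) by nra.
    assert (Gp : g < PI) by (destruct (Req_dec g PI) as [E|]; [rewrite E, cos_PI in Cg|]; lra).
    assert (Sg : 0 < sin g) by (apply sin_gt_0; lra).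
    assert (sin g <= l).
    { apply Rmult_le_reg_r with (sin g); auto. nra. }
    assert (Yn : 0 <= snd z) by lra.
    assert (l <= sin g).
    { apply Rmult_le_reg_r with (cos g); auto. nra. }
    assert (El : l = sin g) by lra.
    assert (Et : t = cos g) by nra.
    assert (X' : 1 - t * cos g - sin g * sin g < 0) by (apply X; [rewrite Et; ring | lra]).
    rewrite Et in X'. lra. }
  assert (C0 : 0 < cos (a - PI + g)) by nra.
  assert (Hup : a - PI + g < 3 * (PI / 2)).
  { destruct (Rlt_dec (snd z) 0) as [Y | Y].
    - destruct (Y0 Y) as (Cg & _ & Xn).
      assert (g < PI / 2).
      { apply Rnot_le_lt. intros N. assert (cos g <= 0) by (apply cos_le_0; lra). lra. }
      assert (a < 3 * (PI / 2)); [|lra].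
      apply Rnot_le_lt. intros N.
      assert (0 <= cos a); [|nra].
      rewrite <- (cos_neg a), <- (cos_period (- a) 1). simpl INR. apply cos_ge_0; lra.
    - assert (a <= PI); [|lra].
      apply Rnot_lt_le. intros N. assert (sin a < 0) by (apply sin_lt_0; lra). nra. }
  split; [lra|]. apply Rnot_le_lt. intros N.
  assert (cos (a - PI + g) <= 0) by (apply cos_le_0; lra). lra.
Qed.

Lemma cos_lower (u : R) : 1 - u ^ 2 / 2 <= cos u.
Proof.
  assert (S : sin (u / 2) ^ 2 <= (u / 2) ^ 2).
  { rewrite <- !Rsqr_pow2. apply Rsqr_le_abs_1.
    destruct (Rtotal_order (u / 2) 0) as [H | [H | H]].
    - rewrite (Rabs_left (u / 2)) by auto. rewrite <- Rabs_Ropp, <- sin_neg.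
      destruct (Rle_dec (- (u / 2)) 1).
      + rewrite Rabs_pos_eq. left; apply sin_lt_x; lra. left; apply sin_gt_0; pose proof PI2_1; lra.
      + apply Rle_trans with 1; [|lra]. apply Rabs_le, SIN_bound.
    - rewrite H, sin_0. lra.
    - rewrite (Rabs_right (u / 2)) by lra. destruct (Rle_dec (u / 2) 1).
      + rewrite Rabs_pos_eq. left; apply sin_lt_x; lra. left; apply sin_gt_0; pose proof PI2_1; lra.
      + apply Rle_trans with 1; [|lra]. apply Rabs_le, SIN_bound. }
  replace u with (2 * (u / 2)) at 2 by field. rewrite cos_2a_sin. lra.
Qed.

(* s is the direction of the point as seen from O and h as seen from the mirror centre O', both
   measured from L1. *)
Lemma middle_flux_trig (g s h Q k F : R) :
  0 < g <= PI -> - (PI / 2) < s < PI / 2 -> 0 < h < PI / 2 -> 1 <= Q -> 0 <= F ->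
  (h < s -> g / 2 < h) ->
  (k <= 0 \/ (k <= F /\ k <= F * (2 * (g - s) / PI) /\ 0 <= g - s)) ->
  k * cos s <= F * (Q * cos h + sin (h - s)).
Proof.
  intros Hg Hs Hh HQ HF Hgh Hk. pose proof PI_RGT_0 as HPI.
  assert (Cs : 0 < cos s) by (apply cos_gt_0; lra).
  assert (Ch : 0 < cos h) by (apply cos_gt_0; lra).
  (* Since Q >= 1, the claim reduces to finding a multiplier m: it is 0 when k <= 0, otherwise 1 if
     s <= h and 2 (g - s) / PI if h < s. *)
  assert (L : forall m, m * cos s <= cos h + sin (h - s) -> k <= F * m ->
     k * cos s <= F * (Q * cos h + sin (h - s))).
  { intros m H1 H2. apply Rle_trans with (F * m * cos s); [now apply Rmult_le_compat_r; lra|].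
    rewrite Rmult_assoc. apply Rmult_le_compat_l; auto. nra. }
  assert (I1 : cos s - cos h = 2 * sin ((h + s) / 2) * sin ((h - s) / 2)).
  { rewrite form2. replace ((s - h) / 2) with (- ((h - s) / 2)) by field.
    rewrite sin_neg. replace ((s + h) / 2) with ((h + s) / 2) by field. ring. }
  assert (I2 : sin (h - s) = 2 * sin ((h - s) / 2) * cos ((h - s) / 2)).
  { replace (h - s) with (2 * ((h - s) / 2)) at 1 by field. apply sin_2a. }
  destruct (Rle_dec s h) as [C | C].
  - assert (S0 : 0 <= sin ((h - s) / 2)) by (apply sin_ge_0; lra).
    assert (S1 : sin ((h + s) / 2) <= cos ((h - s) / 2)).
    { rewrite <- (sin_shift ((h - s) / 2)). apply sin_incr_1; lra. }
    destruct Hk as [Hk | (Hk & _)].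
    + apply (L 0); [|lra]. rewrite Rmult_0_l.
      assert (0 <= sin (h - s)) by (apply sin_ge_0; lra). lra.
    + apply (L 1); [|lra]. nra.
  - assert (Hgh' : g / 2 < h) by (apply Hgh; lra). clear Hgh.
    assert (J1 : cos h + sin (h - s) = 2 * cos ((PI / 2 + s) / 2 - h) * sin ((PI / 2 - s) / 2)).
    { replace (sin (h - s)) with (- sin (s - h)) by (rewrite <- sin_neg; f_equal; ring).
      rewrite <- (sin_shift h).
      replace (sin (PI / 2 - h) + - sin (s - h)) with (sin (PI / 2 - h) - sin (s - h)) by ring.
      rewrite form4. f_equal; [f_equal|]; f_equal; field. }
    assert (J2 : cos s = 2 * sin ((PI / 2 - s) / 2) * cos ((PI / 2 - s) / 2)).
    { rewrite <- sin_2a, <- (sin_shift s). f_equal. field. }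
    assert (P1 : 0 < sin ((PI / 2 - s) / 2)) by (apply sin_gt_0; lra).
    assert (P2 : 0 < cos ((PI / 2 - s) / 2)) by (apply cos_gt_0; lra).
    assert (P3 := COS_bound ((PI / 2 - s) / 2)).
    assert (P4 : 0 <= cos ((PI / 2 + s) / 2 - h)) by (apply cos_ge_0; lra).
    destruct Hk as [Hk | (_ & Hk & Hgs)].
    + apply (L 0); [|lra]. rewrite J1. nra.
    + apply (L (2 * (g - s) / PI)); auto. rewrite J1, J2.
      (* Both sides now contain the factor 2 sin ((PI / 2 - s) / 2), and m <= cos u is left. The
         hypothesis g / 2 < h gives m <= 1 - 4 u / PI, which is below 1 - u^2 / 2 because u is
         small. *)
      set (u := (PI / 2 + s) / 2 - h).
      assert (U : 0 < u) by (unfold u; lra).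
      assert (U2 : u <= PI / 4 - (g - s) / 2) by (unfold u; lra).
      set (m := 2 * (g - s) / PI).
      assert (M : m <= 1 - 4 * u / PI).
      { unfold m. apply Rmult_le_reg_r with PI; auto. field_simplify; lra. }
      assert (M0 : 0 <= m) by (unfold m; apply Rmult_le_pos; [lra | left; now apply Rinv_0_lt_compat]).
      assert (Pu : u ^ 2 / 2 <= 4 * u / PI).
      { apply Rmult_le_reg_r with PI; auto. field_simplify; [|lra]. pose proof PI_4. nra. }
      pose proof (cos_lower u).
      assert (m <= cos u) by lra.
      replace (m * (2 * sin ((PI / 2 - s) / 2) * cos ((PI / 2 - s) / 2))) with
        (2 * sin ((PI / 2 - s) / 2) * (m * cos ((PI / 2 - s) / 2))) by ring.
      replace (2 * cos u * sin ((PI / 2 - s) / 2)) with (2 * sin ((PI / 2 - s) / 2) * cos u) by ring.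
      apply Rmult_le_compat_l; [lra|]. nra.
Qed.

(* The requirements on the logarithmic derivative k of the angular ground state and on its
   majorant k2 that make the flux across the transition zone have the right sign. *)
Definition flux_compatible (b : R) (k k2 : R -> R) : Prop :=
  (forall s t, 0 < s -> s < PI / 2 -> s <= t -> t <= PI / 2 -> 0 <= sin t * k t <= sin s * k2 s) /\
  (forall s t, 0 < s -> s < PI / 2 -> PI / 2 <= t -> t <= b / 2 ->
     0 <= k t <= sin s * k2 s /\ k t <= sin s * k2 s * (2 * (PI - t) / PI)) /\
  (forall t, 0 < t < b -> k (b - t) = - k t).

(** In the application a0 / (r sqrt q) and b0 / (r2 sqrt q) are the cosines of the angles under
    which a point at squared distance q from P sees OP and O'P, while y and l are its distances to
    these lines. The last hypothesis orders the cotangents, hence the cosines; the claim divides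
    these by y and by l, and l <= y. *)
Lemma cotangent_compare (y l r r2 a0 b0 q : R) :
  0 < l -> l <= y -> 0 < r -> 0 < r2 -> 0 < a0 -> 0 < b0 -> 0 < q ->
  q * r ^ 2 = a0 ^ 2 + y ^ 2 -> q * r2 ^ 2 = b0 ^ 2 + l ^ 2 -> a0 * l <= b0 * y ->
  a0 / (r * y) <= b0 / (r2 * l).
Proof.
  intros Hl Hy Hr Hr2 Ha Hb Hq E1 E2 H.
  assert (Hy0 : 0 < y) by lra.
  assert (K : a0 * (r2 * l) <= b0 * (r * y)).
  { apply Rsqr_incr_0_var; [|repeat apply Rmult_le_pos; lra]. unfold Rsqr.
    apply Rmult_le_reg_l with q; auto.
    replace (q * (a0 * (r2 * l) * (a0 * (r2 * l)))) with ((a0 * l) ^ 2 * (q * r2 ^ 2)) by ring.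
    replace (q * (b0 * (r * y) * (b0 * (r * y)))) with ((b0 * y) ^ 2 * (q * r ^ 2)) by ring.
    rewrite E1, E2.
    assert (S : (a0 * l) ^ 2 <= (b0 * y) ^ 2) by (apply pow_incr; split; auto; nra).
    assert (S2 : l ^ 2 <= y ^ 2) by (apply pow_incr; lra).
    assert (S3 : (a0 * l) ^ 2 * l ^ 2 <= (b0 * y) ^ 2 * y ^ 2).
    { apply Rmult_le_compat; auto; apply pow2_ge_0. }
    assert (S4 : (a0 * b0) ^ 2 * l ^ 2 <= (a0 * b0) ^ 2 * y ^ 2).
    { apply Rmult_le_compat_l; auto; apply pow2_ge_0. }
    nra. }
  assert (P1 : 0 < r * y) by nra. assert (P2 : 0 < r2 * l) by nra.
  apply Rmult_le_reg_r with ((r * y) * (r2 * l)); [nra|].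
  replace (a0 / (r * y) * (r * y * (r2 * l))) with (a0 * (r2 * l)) by (field; split; lra).
  replace (b0 / (r2 * l) * (r * y * (r2 * l))) with (b0 * (r * y)) by (field; split; lra).
  exact K.
Qed.

(** * Ordering the fluxes in the three zones of the sector *)

Section Flux.
Context (b g : R) (k k2 : R -> R) (z : pt).
Context (G1 : 0 < g) (G2 : g <= PI) (B1 : PI <= b) (B2 : b <= 2 * PI).
Context (HC : flux_compatible b k k2) (HN : nearer_L1 b g z).

Let x := fst z.
Let y := snd z.
Let r := rad z.
Let a := ang b z.
Let t := tcoord g z.
Let l := lcoord g z.
Let r2 := rad2 g z.
Let h := ang2 g z.
Let cot_s := sder b a / sfun b a.
(* flux1 and flux2 are T1.(A - B) and T2.(A - B), where A = grad log l, B = grad log dsec,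
   T1 = k grad ang, T2 = k2 grad ang2. *)
Let flux1 := k a * ((y * sin g - x * cos g) / (r ^ 2 * l) - cot_s / r ^ 2).
Let flux2 := k2 h / r2 ^ 2 *
  ((1 + t) / l - ((l * cos g - (1 + t) * sin g) * (x / r ^ 2 + cot_s * (- y / r ^ 2)) +
                  (- l * sin g - (1 + t) * cos g) * (y / r ^ 2 + cot_s * (x / r ^ 2)))).

Lemma flux_facts :
  0 < r /\ 0 < t /\ 0 < l /\ 0 < a < b /\ 0 < h < PI / 2 /\ 0 < r2 /\
  x = r * cos a /\ y = r * sin a /\ 1 + t = r2 * cos h /\ l = r2 * sin h /\
  x = 1 - t * cos g - l * sin g /\ y = t * sin g - l * cos g /\ 0 < sfun b a <= 1 /\
  l < r * sfun b a.
Proof.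
  destruct HN as (Hz & Ht & Hl). destruct (in_sector_pos b z Hz) as [Hr Hp].
  destruct (ang_spec b z Hp) as [Ez _]. pose proof (in_sector_ang b z B1 B2 Hz) as Ha.
  pose proof (f_equal fst Ez) as Ex. pose proof (f_equal snd Ez) as Ey. simpl in Ex, Ey.
  destruct (atan_polar (1 + t) l) as (P1 & P2 & P3 & P4); [unfold t; lra | unfold l; lra|].
  pose proof (sfun_bounds b a B1 Ha).
  repeat (split; [first [assumption | apply P1 | apply Ha | apply Hl | apply fst_tl | apply snd_tl | apply H] |]).
  apply Hl.
Qed.

(** Here [dsec] is y, so the level lines of the ratio l / y pass through P. Both fluxes are sin g /
    (l y) times a value of sin k or sin k2, ordered by [HC1], times a quotient treated by
    [cotangent_compare]. *)
Lemma flux_order_left : a <= PI / 2 -> flux1 <= flux2.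
Proof.
  destruct flux_facts as (Hr & Ht & Hl & Ha & Hh & Hr2 & Ex & Ey & Ep & El & Fx & Fy & Hs & Hd).
  intros C. destruct HC as (HC1 & _ & _).
  pose proof (sin2_cos2' g) as SC. pose proof (sin2_cos2' a) as SA. pose proof (sin2_cos2' h) as SH.
  assert (Sg : 0 <= sin g) by (apply sin_ge_0; lra).
  rewrite sfun_left in Hs, Hd by auto.
  assert (Hy : l < y) by lra.
  assert (Q1 : r ^ 2 = x ^ 2 + y ^ 2).
  { rewrite Ex, Ey. transitivity (r ^ 2 * (sin a * sin a + cos a * cos a)); [rewrite SA|]; ring. }
  assert (Q2 : r2 ^ 2 = (1 + t) ^ 2 + l ^ 2).
  { rewrite Ep, El. transitivity (r2 ^ 2 * (sin h * sin h + cos h * cos h)); [rewrite SH|]; ring. }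
  assert (Cs : cot_s = x / y).
  { unfold cot_s. rewrite sfun_left, sder_left, Ex, Ey by auto. field. lra. }
  (* Scalar products of z - P with z - O and with z - O'; [q] below is the squared distance to P. *)
  set (a0 := r ^ 2 - x). set (b0 := (1 + t) * t + l ^ 2).
  set (q := t ^ 2 + l ^ 2).
  assert (Hq : q = (1 - x) ^ 2 + y ^ 2).
  { rewrite Fx, Fy. unfold q. transitivity (q * (sin g * sin g + cos g * cos g)); [rewrite SC|]; unfold q; ring. }
  assert (F1 : flux1 = k a * (sin g * a0 / (r ^ 2 * l * y))).
  { unfold flux1. rewrite Cs. f_equal. unfold a0. rewrite Q1.
    assert (Le : l = (1 - x) * sin g - y * cos g).
    { rewrite Fx, Fy. transitivity (l * (sin g * sin g + cos g * cos g)); [rewrite SC|]; ring. }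
    field_simplify_eq; [|repeat split; nra]. rewrite Le at 1. ring. }
  assert (F2 : flux2 = k2 h * (sin g * b0 / (r2 ^ 2 * l * y))).
  { unfold flux2. rewrite Cs.
    replace (x / r ^ 2 + x / y * (- y / r ^ 2)) with 0 by (field; lra).
    replace (y / r ^ 2 + x / y * (x / r ^ 2)) with (/ y) by (rewrite Q1; field; split; nra).
    unfold b0. rewrite Fy at 1 2.
    field_simplify_eq; [|repeat split; try lra; rewrite <- Fy; lra]. ring. }
  assert (D : 0 < l * y) by nra.
  assert (Hb0 : 0 < b0) by (unfold b0; nra).
  assert (Lxy : l * x <= y * (1 + t)).
  { assert (y * t + (1 - x) * l = q * sin g) by (rewrite Fx, Fy; unfold q; ring).
    assert (0 <= q * sin g) by (apply Rmult_le_pos; auto; unfold q; nra). nra. }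
  (* [Lxy] compares the slopes tan h = l / (1 + t) and tan a = y / x in product form. *)
  assert (Hah : h <= a).
  { apply Rnot_lt_le. intros N.
    assert (S : 0 < sin (h - a)) by (apply sin_gt_0; lra).
    rewrite sin_minus in S. rewrite Ex, Ey, Ep, El in Lxy.
    assert (0 < (r * r2) * (sin h * cos a - cos h * sin a)) by (apply Rmult_lt_0_compat; nra). nra. }
  destruct (HC1 h a) as [K1 K2]; try lra.
  assert (F1' : flux1 = sin g / (l * y) * (sin a * k a * (a0 / (r * y)))).
  { rewrite F1. replace (sin a) with (y / r) by (rewrite Ey; field; lra). field. repeat split; lra. }
  assert (F2' : flux2 = sin g / (l * y) * (sin h * k2 h * (b0 / (r2 * l)))).
  { rewrite F2. replace (sin h) with (l / r2) by (rewrite El; field; lra). field. repeat split; lra. }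
  rewrite F1', F2'. apply Rmult_le_compat_l.
  { apply Rmult_le_pos; auto. left. now apply Rinv_0_lt_compat. }
  assert (PB : 0 <= b0 / (r2 * l)) by (apply Rmult_le_pos; [lra | left; apply Rinv_0_lt_compat; nra]).
  (* If [z] sees OP under an angle that is not acute, flux1 <= 0 <= flux2. *)
  destruct (Rle_dec a0 0) as [A0 | A0].
  - apply Rle_trans with 0; [|apply Rmult_le_pos; lra].
    assert (0 <= / (r * y)) by (left; apply Rinv_0_lt_compat; nra).
    unfold Rdiv. assert (a0 * / (r * y) <= 0) by nra. nra.
  - assert (Z : a0 / (r * y) <= b0 / (r2 * l)).
    { apply cotangent_compare with q; try lra.
      - unfold q; nra.
      - rewrite Hq. unfold a0. rewrite Q1. ring.
      - rewrite Q2. unfold q, b0. ring.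
      - assert (Id : b0 * y - a0 * l = q * (y - l) + (y * t + (1 - x) * l)).
        { unfold a0, b0. replace (r ^ 2) with (q + 2 * x - 1) by (rewrite Hq, Q1; ring). unfold q. ring. }
        assert (y * t + (1 - x) * l = q * sin g) by (rewrite Fx, Fy; unfold q; ring).
        assert (0 <= q * sin g) by (apply Rmult_le_pos; auto; unfold q; nra).
        assert (0 <= q * (y - l)) by (apply Rmult_le_pos; [unfold q; nra | lra]). lra. }
    apply Rmult_le_compat; auto.
    apply Rmult_le_pos; [lra | left; apply Rinv_0_lt_compat; nra].
Qed.

(** The vertex is the nearest boundary point of the sector, so [dsec] is the radius and [cot_s]
    vanishes. With the common factor 1 / (r l) removed, [middle_flux_trig] remains with Q = r / l,
    which is at least 1 because [L1] is nearer. *)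
Lemma flux_order_middle : PI / 2 <= a -> a <= b - PI / 2 -> flux1 <= flux2.
Proof.
  destruct flux_facts as (Hr & Ht & Hl & Ha & Hh & Hr2 & Ex & Ey & Ep & El & Fx & Fy & Hs & Hd).
  intros C1 C2. destruct HC as (_ & HC2 & HC3). pose proof PI_RGT_0 as HPI.
  pose proof (nearer_L1_direction b g z G1 G2 B1 B2 HN C1) as Hsig. fold a in Hsig.
  destruct (sigma_coords b g z) as [Sc Ss].
  { apply in_sector_pos. apply HN. }
  fold r a t l in Sc, Ss. set (sg := a - PI + g) in *.
  rewrite sfun_mid in Hs, Hd by auto.
  assert (Cs : cot_s = 0) by (unfold cot_s; rewrite sder_mid by auto; unfold Rdiv; ring).
  pose proof (sin2_cos2' g) as SC.
  set (F := sin h * k2 h).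
  assert (HF : 0 <= F).
  { destruct HC as (HC1 & _). destruct (HC1 h h); try lra. unfold F. lra. }
  assert (T1 : flux1 = / (r * l) * (k a * cos sg)).
  { unfold flux1. rewrite Cs.
    replace (y * sin g - x * cos g) with (r * cos sg).
    - field. split; lra.
    - rewrite Sc, Fx, Fy. transitivity (t * (sin g * sin g + cos g * cos g) - cos g); [rewrite SC|]; ring. }
  assert (T2 : flux2 = / (r * l) * (F * (r / l * cos h + sin (h - sg)))).
  { unfold flux2. rewrite Cs, sin_minus. unfold F.
    replace ((l * cos g - (1 + t) * sin g) * (x / r ^ 2 + 0 * (- y / r ^ 2)) +
                  (- l * sin g - (1 + t) * cos g) * (y / r ^ 2 + 0 * (x / r ^ 2)))
      with ((- l * (t - cos g) + (1 + t) * (l - sin g)) / r ^ 2).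
    - rewrite <- Sc, <- Ss, Ep. rewrite El at 2. rewrite El at 2. rewrite El at 1.
      rewrite El at 1. field. split; [|split]; try lra.
      assert (0 < sin h) by (apply sin_gt_0; lra). lra.
    - rewrite Fx, Fy.
      transitivity ((- l * (t * (sin g * sin g + cos g * cos g) - cos g) +
         (1 + t) * (l * (sin g * sin g + cos g * cos g) - sin g)) / r ^ 2); [rewrite SC|]; field; lra. }
  rewrite T1, T2. apply Rmult_le_compat_l; [left; apply Rinv_0_lt_compat; nra|].
  apply middle_flux_trig with g; auto; try lra.
  - apply Rmult_le_reg_r with l; auto. unfold Rdiv. rewrite Rmult_assoc, Rinv_l; lra.
  (* The triangle O P O' is isosceles, so O' sees O in direction g / 2. A direction from O steeper
     than the one from O' places [z] above the line O'O; in formulas, l (1 + cos g) > (1 + t) sin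
     g. *)
  - intros Hlt. assert (Gp : g < PI).
    { unfold sg in Hsig. lra. }
    assert (S : 0 < sin (sg - h)) by (apply sin_gt_0; lra).
    rewrite sin_minus in S.
    assert (S2 : 0 < (r * r2) * (sin sg * cos h - cos sg * sin h)) by (apply Rmult_lt_0_compat; nra).
    replace (r * r2 * (sin sg * cos h - cos sg * sin h)) with
      ((r * sin sg) * (r2 * cos h) - (r * cos sg) * (r2 * sin h)) in S2 by ring.
    rewrite Sc, Ss, <- Ep, <- El in S2.
    apply Rnot_le_lt. intros N.
    assert (S3 : 0 <= sin (g / 2 - h)) by (apply sin_ge_0; lra).
    rewrite sin_minus in S3.
    assert (C0 : 0 < cos (g / 2)) by (apply cos_gt_0; lra).
    assert (S4 : 0 <= 2 * cos (g / 2) * r2 * (sin (g / 2) * cos h - cos (g / 2) * sin h)).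
    { apply Rmult_le_pos; auto. nra. }
    replace (2 * cos (g / 2) * r2 * (sin (g / 2) * cos h - cos (g / 2) * sin h)) with
      ((2 * sin (g / 2) * cos (g / 2)) * (r2 * cos h) - (2 * cos (g / 2) * cos (g / 2) - 1 + 1) * (r2 * sin h))
      in S4 by ring.
    rewrite <- sin_2a, <- cos_2a_cos, <- Ep, <- El in S4.
    replace (2 * (g / 2)) with g in S4 by field. nra.
  - destruct (Rle_dec a (b / 2)) as [A | A].
    (* Up to the axis of the sector [HC2] bounds k directly; past the axis k is nonpositive because
       it is odd about b / 2. *)
    + right. destruct (HC2 h a) as ((K1 & K2) & K3); try lra.
      fold F in K2, K3. split; [|split]; auto.
      * replace (g - sg) with (PI - a) by (unfold sg; ring). auto.
      * unfold sg; lra.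
    + left. destruct (HC2 h (b - a)) as ((K1 & K2) & K3); try lra.
      rewrite HC3 in K1; lra.
Qed.

(** The fluxes are separated by 0: past the axis k <= 0 while its factor is nonnegative, and flux2
    is nonnegative because the angle between [L1] and [L3] is at most 2 PI. *)
Lemma flux_order_right : b - PI / 2 <= a -> PI / 2 <= a -> flux1 <= flux2.
Proof.
  destruct flux_facts as (Hr & Ht & Hl & Ha & Hh & Hr2 & Ex & Ey & Ep & El & Fx & Fy & Hs & Hd).
  intros C1 C2. destruct HC as (HC1 & HC2 & HC3). pose proof PI_RGT_0 as HPI.
  pose proof (nearer_L1_direction b g z G1 G2 B1 B2 HN C2) as Hsig. fold a in Hsig.
  destruct (sigma_coords b g z) as [Sc Ss].
  { apply in_sector_pos. apply HN. }
  fold r a t l in Sc, Ss. set (sg := a - PI + g) in *.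
  rewrite sfun_right in Hs, Hd by auto. set (e := b - a) in *.
  assert (Ce : 0 <= cos e) by (apply cos_ge_0; unfold e; lra).
  assert (Csg : 0 < cos sg) by (apply cos_gt_0; lra).
  assert (Cs : cot_s = - (cos e / sin e)).
  { unfold cot_s. rewrite sfun_right, sder_right by auto. fold e. field. lra. }
  pose proof (sin2_cos2' g) as SC. pose proof (sin2_cos2' a) as SA. pose proof (sin2_cos2' e) as SE.
  assert (Q1 : r ^ 2 = x ^ 2 + y ^ 2).
  { rewrite Ex, Ey. transitivity (r ^ 2 * (sin a * sin a + cos a * cos a)); [rewrite SA|]; ring. }
  assert (Ka : k a <= 0).
  { assert (k e = - k a) by (apply HC3; unfold e; lra).
    assert (0 <= sin e * k e).
    { destruct (Rlt_dec e (PI / 2)).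
      - destruct (HC1 e e); try (unfold e in *; lra).
      - destruct (HC1 (PI / 4) e) as [K _]; unfold e in *; lra. }
    nra. }
  apply Rle_trans with 0.
  - unfold flux1. rewrite Cs.
    replace (y * sin g - x * cos g) with (r * cos sg).
    2: { rewrite Sc, Fx, Fy. transitivity (t * (sin g * sin g + cos g * cos g) - cos g); [rewrite SC|]; ring. }
    assert (0 <= r * cos sg / (r ^ 2 * l)).
    { apply Rmult_le_pos; [nra|]. left; apply Rinv_0_lt_compat. apply Rmult_lt_0_compat; nra. }
    assert (0 <= cos e / sin e / r ^ 2).
    { apply Rmult_le_pos; [apply Rmult_le_pos; auto; left; apply Rinv_0_lt_compat; lra|].
      left; apply Rinv_0_lt_compat; nra. }
    replace (- (cos e / sin e) / r ^ 2) with (- (cos e / sin e / r ^ 2)) by (field; lra). nra.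
  - assert (Kh : 0 <= k2 h).
    { destruct (HC1 h h); try lra. assert (0 < sin h) by (apply sin_gt_0; lra). nra. }
    (* The angle from the direction PI - g of [L1] to the direction b of [L3]. Since r sin e >= l,
       the sign of flux2 follows from that of cos h + cos (kap - h), a product of two cosines at
       half angles. *)
    set (kap := b + g - PI).
    assert (T2 : flux2 = k2 h / (r2 * (r * sin e)) * ((r * sin e) / l * cos h + cos (kap - h))).
    { assert (Bx : x / r ^ 2 + cot_s * (- y / r ^ 2) = sin b / (r * sin e)).
      { rewrite Cs. replace (sin b) with (sin (a + e)) by (f_equal; unfold e; ring).
        rewrite sin_plus, Ex, Ey. field. lra. }
      assert (By : y / r ^ 2 + cot_s * (x / r ^ 2) = - cos b / (r * sin e)).
      { rewrite Cs. replace (cos b) with (cos (a + e)) by (f_equal; unfold e; ring).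
        rewrite cos_plus, Ex, Ey. field. lra. }
      unfold flux2. rewrite Bx, By.
      assert (E1 : (l * cos g - (1 + t) * sin g) * (sin b / (r * sin e)) +
         (- l * sin g - (1 + t) * cos g) * (- cos b / (r * sin e)) = - (r2 * cos (kap - h)) / (r * sin e)).
      { replace (kap - h) with (- (PI - (b + g - h))) by (unfold kap; ring).
        rewrite cos_neg, Rtrigo_facts.cos_pi_minus, cos_minus, cos_plus, sin_plus, El, Ep. field. lra. }
      rewrite E1, Ep. field. repeat split; lra. }
    rewrite T2. apply Rmult_le_pos.
    { apply Rmult_le_pos; auto. left; apply Rinv_0_lt_compat. apply Rmult_lt_0_compat; lra. }
    assert (Ch : 0 < cos h) by (apply cos_gt_0; lra).
    assert (R1 : 1 <= r * sin e / l).
    { apply Rmult_le_reg_r with l; auto. unfold Rdiv. rewrite Rmult_assoc, Rinv_l; lra. }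
    assert (Ksum : kap = sg + e) by (unfold kap, sg, e; ring).
    assert (0 <= cos h + cos (kap - h)); [|nra].
    rewrite form1. replace ((h + (kap - h)) / 2) with (kap / 2) by field.
    replace ((h - (kap - h)) / 2) with (h - kap / 2) by field.
    assert (0 <= cos (h - kap / 2)) by (apply cos_ge_0; unfold kap, e in *; lra).
    assert (0 <= cos (kap / 2)) by (apply cos_ge_0; unfold kap, e in *; lra). nra.
Qed.

Lemma flux_order : flux1 <= flux2.
Proof.
  destruct (angle_cases b a B1) as [C | [C | C]].
  - now apply flux_order_left.
  - now apply flux_order_middle.
  - apply flux_order_right; auto. pose proof PI_RGT_0. lra.
Qed.

End Flux.

(** * Hardy inequality from angular ground states *)

(** The cubic 1 - 3 u^2 + 2 u^3 between 1 and 0, C^1 as [PD] requires. The transition interval stays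
    below ratio 1, so [L1] is strictly nearer wherever the gradient does not vanish, and the flux
    comparison applies there. *)
Definition cutoff (e : R) : R -> R :=
  pw (1 - 2 * e) (fun _ => 1) (pw (1 - e)
    (fun q => 1 - 3 * ((q - (1 - 2 * e)) / e) ^ 2 + 2 * ((q - (1 - 2 * e)) / e) ^ 3) (fun _ => 0)).
Definition cutoff' (e : R) : R -> R :=
  pw (1 - 2 * e) (fun _ => 0) (pw (1 - e)
    (fun q => (- 6 * ((q - (1 - 2 * e)) / e) + 6 * ((q - (1 - 2 * e)) / e) ^ 2) / e) (fun _ => 0)).

Lemma cutoff_spec (e q : R) : 0 < e ->
  is_derive (cutoff e) q (cutoff' e q) /\ continuous (cutoff' e) q /\
  0 <= cutoff e q <= 1 /\ cutoff' e q <= 0 /\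
  (1 - e <= q -> cutoff e q = 0 /\ cutoff' e q = 0) /\ (q <= 1 - 2 * e -> cutoff e q = 1).
Proof.
  intros He.
  assert (L : (1 - 2 * e - (1 - 2 * e)) / e = 0) by (field; lra).
  assert (U : (1 - e - (1 - 2 * e)) / e = 1) by (field; lra).
  assert (E1 : 1 = pw (1 - e)
    (fun q => 1 - 3 * ((q - (1 - 2 * e)) / e) ^ 2 + 2 * ((q - (1 - 2 * e)) / e) ^ 3) (fun _ => 0) (1 - 2 * e)).
  { rewrite pw_left, L by lra. ring. }
  assert (E2 : 0 = pw (1 - e)
    (fun q => (- 6 * ((q - (1 - 2 * e)) / e) + 6 * ((q - (1 - 2 * e)) / e) ^ 2) / e) (fun _ => 0) (1 - 2 * e)).
  { rewrite pw_left, L by lra. field. lra. }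
  assert (E3 : 1 - 3 * ((1 - e - (1 - 2 * e)) / e) ^ 2 + 2 * ((1 - e - (1 - 2 * e)) / e) ^ 3 = 0).
  { rewrite U. ring. }
  assert (E4 : (- 6 * ((1 - e - (1 - 2 * e)) / e) + 6 * ((1 - e - (1 - 2 * e)) / e) ^ 2) / e = 0).
  { rewrite U. field. lra. }
  split; [|split; [|split; [|split; [|split]]]].
  - apply pw_derive; auto; intros.
    + apply @is_derive_const.
    + apply pw_derive; auto; intros.
      * auto_derive; auto. field. lra.
      * apply @is_derive_const.
  - apply pw_continuous; auto; intros.
    + apply continuous_const.
    + apply pw_continuous; auto; intros.
      * apply @ex_derive_continuous. auto_derive; auto.
      * apply continuous_const.
  - unfold cutoff, pw. repeat destruct Rle_dec; try lra.
    set (u := (q - (1 - 2 * e)) / e).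
    assert (0 <= u <= 1).
    { unfold u. split; apply Rmult_le_reg_r with e; auto; unfold Rdiv;
      rewrite ?Rmult_0_l, ?Rmult_assoc, ?Rinv_l; lra. }
    assert (0 <= (1 - u) ^ 2 * (1 + 2 * u)) by (apply Rmult_le_pos; [apply pow2_ge_0 | lra]).
    assert (0 <= u ^ 2 * (3 - 2 * u)) by (apply Rmult_le_pos; [apply pow2_ge_0 | lra]).
    split; lra.
  - unfold cutoff', pw. repeat destruct Rle_dec; try lra.
    set (u := (q - (1 - 2 * e)) / e).
    assert (0 <= u <= 1).
    { unfold u. split; apply Rmult_le_reg_r with e; auto; unfold Rdiv;
      rewrite ?Rmult_0_l, ?Rmult_assoc, ?Rinv_l; lra. }
    assert (0 < / e) by now apply Rinv_0_lt_compat.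
    unfold Rdiv. assert (-6 * u + 6 * u ^ 2 <= 0) by nra. nra.
  - intros H. unfold cutoff, cutoff'. rewrite !pw_right; auto; lra.
  - intros H. apply pw_left; auto.
Qed.

(** The angle is harmonic with gradient of length 1 / rad, so k' alone contributes to the
    divergence. The partial derivatives stay existential because the estimate involves only their
    trace. *)
Lemma sector_field (b : R) (k k' : R -> R) :
  PI <= b -> b <= 2 * PI ->
  (forall t, 0 < t < b -> is_derive k t (k' t) /\ continuous k' t) ->
  exists Pxx Pxy Pyx Pyy, forall z, in_sector b z ->
    PD (fun w => k (ang b w) * (- snd w / rad w ^ 2)) Pxx Pxy z /\
    PD (fun w => k (ang b w) * (fst w / rad w ^ 2)) Pyx Pyy z /\
    Pxx z + Pyy z = k' (ang b z) / rad z ^ 2.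
Proof.
  intros B1 B2 Hk.
  pose (ix := fun w => - / (rad w * rad w) ^ 2 * (fst w / rad w * rad w + rad w * (fst w / rad w))).
  pose (iy := fun w => - / (rad w * rad w) ^ 2 * (snd w / rad w * rad w + rad w * (snd w / rad w))).
  assert (I : forall z, in_sector b z -> PD (fun w => / (rad w * rad w)) ix iy z).
  { intros z Hz. destruct (in_sector_pos b z Hz) as [Hr _].
    apply (PD_inv (fun w => rad w * rad w)); [nra|]. apply PD_mult; now apply PD_rad. }
  pose (mx := fun w : pt => k' (ang b w) * (- snd w / rad w ^ 2)).
  pose (my := fun w : pt => k' (ang b w) * (fst w / rad w ^ 2)).
  assert (Kz : forall z, in_sector b z -> PD (fun w => k (ang b w)) mx my z).
  { intros z Hz. destruct (Hk (ang b z)) as [D C]. { now apply in_sector_ang. }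
    apply PD_comp; auto. now apply PD_ang. }
  exists (fun w => mx w * (- snd w / rad w ^ 2) + k (ang b w) * (0 * / (rad w * rad w) + (0 * fst w + -1 * snd w + 0) * ix w)),
    (fun w => my w * (- snd w / rad w ^ 2) + k (ang b w) * (-1 * / (rad w * rad w) + (0 * fst w + -1 * snd w + 0) * iy w)),
    (fun w => mx w * (fst w / rad w ^ 2) + k (ang b w) * (1 * / (rad w * rad w) + (1 * fst w + 0 * snd w + 0) * ix w)),
    (fun w => my w * (fst w / rad w ^ 2) + k (ang b w) * (0 * / (rad w * rad w) + (1 * fst w + 0 * snd w + 0) * iy w)).
  intros z Hz. destruct (in_sector_pos b z Hz) as [Hr _].
  assert (X1 : PD (fun w => - snd w / rad w ^ 2) (fun w => 0 * / (rad w * rad w) + (0 * fst w + -1 * snd w + 0) * ix w)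
      (fun w => -1 * / (rad w * rad w) + (0 * fst w + -1 * snd w + 0) * iy w) z).
  { eapply PD_ext_loc; [|apply (PD_mult _ _ _ _ _ _ z (PD_lin 0 (-1) 0 z) (I z Hz))].
    apply filter_forall. intros [x y]. simpl. unfold Rdiv. rewrite Rmult_1_r. split; [ring|split; reflexivity]. }
  assert (X2 : PD (fun w => fst w / rad w ^ 2) (fun w => 1 * / (rad w * rad w) + (1 * fst w + 0 * snd w + 0) * ix w)
      (fun w => 0 * / (rad w * rad w) + (1 * fst w + 0 * snd w + 0) * iy w) z).
  { eapply PD_ext_loc; [|apply (PD_mult _ _ _ _ _ _ z (PD_lin 1 0 0 z) (I z Hz))].
    apply filter_forall. intros [x y]. simpl. unfold Rdiv. rewrite Rmult_1_r. split; [ring|split; reflexivity]. }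
  split; [|split].
  - apply (PD_mult _ _ _ _ _ _ z (Kz z Hz) X1).
  - apply (PD_mult _ _ _ _ _ _ z (Kz z Hz) X2).
  - unfold mx, my, ix, iy. pose proof (rad_sqr z) as Q.
    transitivity (k' (ang b z) * (fst z ^ 2 + snd z ^ 2) / rad z ^ 4).
    field; lra. rewrite <- Q. field; lra.
Qed.

Lemma PD_tcoord (g : R) (z : pt) :
  PD (fun w => 1 + tcoord g w) (fun _ => - cos g) (fun _ => sin g) z.
Proof.
  eapply PD_eq; [| |apply (PD_plus _ _ _ _ _ _ z (PD_const 1 z) (PD_lin (- cos g) (sin g) (cos g) z))];
    intros; simpl; ring.
Qed.

Lemma PD_lcoord (g : R) (z : pt) :
  PD (lcoord g) (fun _ => - sin g) (fun _ => - cos g) z.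
Proof. apply PD_lin. Qed.

Definition quadrant (g : R) (z : pt) : Prop := 0 < tcoord g z /\ 0 < lcoord g z.

Lemma quadrant_open (g : R) (z : pt) : quadrant g z -> locally z (quadrant g).
Proof.
  intros [H1 H2]. apply filter_and.
  - apply (locally_lt (fun _ => 0) (tcoord g)); auto. apply continuous_const. apply continuous_lin.
  - apply (locally_lt (fun _ => 0) (lcoord g)); auto. apply continuous_const. apply continuous_lin.
Qed.

Lemma rad2_sqr (g : R) (z : pt) : rad2 g z ^ 2 = (1 + tcoord g z) ^ 2 + lcoord g z ^ 2.
Proof.
  unfold rad2. rewrite pow2_sqrt; auto.
  pose proof (pow2_ge_0 (1 + tcoord g z)). pose proof (pow2_ge_0 (lcoord g z)). lra.
Qed.

Lemma mirror_field (g : R) (k k' : R -> R) :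
  (forall t, 0 < t < PI / 2 -> is_derive k t (k' t) /\ continuous k' t) ->
  exists Pxx Pxy Pyx Pyy, forall z, quadrant g z ->
    PD (fun w => k (ang2 g w) * ((lcoord g w * cos g - (1 + tcoord g w) * sin g) / rad2 g w ^ 2)) Pxx Pxy z /\
    PD (fun w => k (ang2 g w) * ((- lcoord g w * sin g - (1 + tcoord g w) * cos g) / rad2 g w ^ 2)) Pyx Pyy z /\
    Pxx z + Pyy z = k' (ang2 g z) / rad2 g z ^ 2.
Proof.
  intros Hk. pose proof (sin2_cos2' g) as SC.
  pose (p := fun w => 1 + tcoord g w). pose (l := lcoord g).
  pose (q := fun w => p w * p w + l w * l w).
  pose (qx := fun w => (- cos g * p w + p w * - cos g) + (- sin g * l w + l w * - sin g)).
  pose (qy := fun w => (sin g * p w + p w * sin g) + (- cos g * l w + l w * - cos g)).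
  assert (Pq : forall z, PD q qx qy z).
  { intros z. apply PD_plus; apply PD_mult; first [apply PD_tcoord | apply PD_lcoord]. }
  assert (Qr : forall w, rad2 g w ^ 2 = q w).
  { intros w. rewrite rad2_sqr. unfold q, p, l. ring. }
  assert (Qp : forall w, quadrant g w -> 0 < p w /\ 0 < l w /\ 0 < q w).
  { intros w [H1 H2]. unfold q, p, l. repeat split; nra. }
  (* The vector (N1, N2) is z - O' turned by a right angle, which is why its partial derivatives are
     constants; divided by rad2^2 it is the gradient of [ang2]. *)
  pose (N1 := fun w => l w * cos g - p w * sin g). pose (N2 := fun w => - l w * sin g - p w * cos g).
  assert (PN1 : forall z, PD N1 (fun _ => 0) (fun _ => -1) z).
  { intros z. eapply PD_ext_loc; [|apply (PD_lin 0 (-1) (- sin g) z)].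
    apply filter_forall. intros [x y]. unfold N1, p, l, lcoord, tcoord. simpl. repeat split.
    transitivity (- y * (sin g * sin g + cos g * cos g) - sin g); [rewrite SC|]; ring. }
  assert (PN2 : forall z, PD N2 (fun _ => 1) (fun _ => 0) z).
  { intros z. eapply PD_ext_loc; [|apply (PD_lin 1 0 (- (1 + cos g)) z)].
    apply filter_forall. intros [x y]. unfold N2, p, l, lcoord, tcoord. simpl. repeat split.
    transitivity (x * (sin g * sin g + cos g * cos g) - (sin g * sin g + cos g * cos g) - cos g); [rewrite SC|]; ring. }
  pose (ix := fun w => - / (q w) ^ 2 * qx w). pose (iy := fun w => - / (q w) ^ 2 * qy w).
  assert (I : forall z, quadrant g z -> PD (fun w => / q w) ix iy z).
  { intros z Hz. apply PD_inv; auto. destruct (Qp z Hz). lra. }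
  pose (ax := fun w => N1 w / q w). pose (ay := fun w => N2 w / q w).
  assert (A : forall z, quadrant g z -> PD (ang2 g) ax ay z).
  { intros z Hz. pose proof (Qp z Hz) as (Hp & Hl & Hq).
    pose (u := fun w => l w * / p w).
    apply PD_ext_loc with (f := fun w => atan (u w))
      (fx := fun w => / (1 + u w ^ 2) * (- sin g * / p w + l w * (- / (p w) ^ 2 * - cos g)))
      (fy := fun w => / (1 + u w ^ 2) * (- cos g * / p w + l w * (- / (p w) ^ 2 * sin g))).
    - eapply filter_imp; [|exact (quadrant_open g z Hz)]. intros w Hw.
      destruct (Qp w Hw) as (Hp' & Hl' & Hq'). split; [reflexivity|].
      unfold ax, ay, N1, N2, u. unfold q in Hq' |- *.
      split; field; split; try lra; nra.
    - apply (PD_comp atan (fun v => / (1 + v ^ 2)) u).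
      + evar_last. apply is_derive_atan. simpl. now rewrite Rmult_1_r.
      + apply @ex_derive_continuous. auto_derive. nra.
      + apply PD_mult; [apply PD_lcoord|]. apply (PD_inv p); [lra|]. apply PD_tcoord. }
  pose (mx := fun w : pt => k' (ang2 g w) * ax w). pose (my := fun w : pt => k' (ang2 g w) * ay w).
  assert (Kz : forall z, quadrant g z -> PD (fun w => k (ang2 g w)) mx my z).
  { intros z Hz. pose proof Hz as [H1 H2].
    destruct (Hk (ang2 g z)) as [D C].
    { apply atan_polar; lra. }
    apply PD_comp; auto. }
  exists (fun w => mx w * (N1 w / rad2 g w ^ 2) + k (ang2 g w) * (0 * / q w + N1 w * ix w)),
    (fun w => my w * (N1 w / rad2 g w ^ 2) + k (ang2 g w) * (-1 * / q w + N1 w * iy w)),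
    (fun w => mx w * (N2 w / rad2 g w ^ 2) + k (ang2 g w) * (1 * / q w + N2 w * ix w)),
    (fun w => my w * (N2 w / rad2 g w ^ 2) + k (ang2 g w) * (0 * / q w + N2 w * iy w)).
  intros z Hz. pose proof (Qp z Hz) as (Hp & Hl & Hq).
  assert (X1 : PD (fun w => N1 w / rad2 g w ^ 2) (fun w => 0 * / q w + N1 w * ix w)
     (fun w => -1 * / q w + N1 w * iy w) z).
  { eapply PD_ext_loc; [|apply (PD_mult _ _ _ _ _ _ z (PN1 z) (I z Hz))].
    apply filter_forall. intros w. rewrite Qr. repeat split. }
  assert (X2 : PD (fun w => N2 w / rad2 g w ^ 2) (fun w => 1 * / q w + N2 w * ix w)
     (fun w => 0 * / q w + N2 w * iy w) z).
  { eapply PD_ext_loc; [|apply (PD_mult _ _ _ _ _ _ z (PN2 z) (I z Hz))].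
    apply filter_forall. intros w. rewrite Qr. repeat split. }
  split; [|split].
  - apply (PD_mult _ _ _ _ _ _ z (Kz z Hz) X1).
  - apply (PD_mult _ _ _ _ _ _ z (Kz z Hz) X2).
  - rewrite Qr. unfold mx, my, ax, ay, ix, iy.
    assert (NN : N1 z ^ 2 + N2 z ^ 2 = q z).
    { unfold N1, N2, q. transitivity ((p z * p z + l z * l z) * (sin g * sin g + cos g * cos g)); [|rewrite SC]; ring. }
    assert (NQ : N1 z * qx z + N2 z * qy z = 0) by (unfold N1, N2, qx, qy; ring).
    transitivity (k' (ang2 g z) * (N1 z ^ 2 + N2 z ^ 2) / q z ^ 2 - k (ang2 g z) * (N1 z * qx z + N2 z * qy z) / q z ^ 2).
    field; lra. rewrite NN, NQ. field; lra.
Qed.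

Lemma PD_dsec (b : R) (z : pt) : PI <= b -> b <= 2 * PI -> in_sector b z ->
  PD (dsec b) (fun w => dsec b w * (fst w / rad w ^ 2 + sder b (ang b w) / sfun b (ang b w) * (- snd w / rad w ^ 2)))
   (fun w => dsec b w * (snd w / rad w ^ 2 + sder b (ang b w) / sfun b (ang b w) * (fst w / rad w ^ 2))) z.
Proof.
  intros B1 B2 Hz.
  pose (sx := fun w : pt => sder b (ang b w) * (- snd w / rad w ^ 2)).
  pose (sy := fun w : pt => sder b (ang b w) * (fst w / rad w ^ 2)).
  assert (S : PD (fun w => sfun b (ang b w)) sx sy z).
  { apply PD_comp; [now apply sfun_derive | now apply sder_continuous | now apply PD_ang]. }
  destruct (in_sector_pos b z Hz) as [Hr _].
  eapply PD_ext_loc; [|exact (PD_mult _ _ _ _ _ _ z (PD_rad z Hr) S)].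
  eapply filter_imp; [|exact (in_sector_open b z Hz)]. intros w Hw.
  destruct (in_sector_pos b w Hw) as [Hr' _].
  pose proof (sfun_bounds b (ang b w) B1 (in_sector_ang b w B1 B2 Hw)).
  split; [reflexivity|]. unfold sx, sy, dsec. split; field; lra.
Qed.

Lemma dsec_pos (b : R) (z : pt) : PI <= b -> b <= 2 * PI -> in_sector b z -> 0 < dsec b z.
Proof.
  intros B1 B2 Hz. destruct (in_sector_pos b z Hz) as [Hr _].
  destruct (sfun_bounds b (ang b z) B1 (in_sector_ang b z B1 B2 Hz)).
  apply Rmult_lt_0_compat; auto.
Qed.

Lemma hardy_ineq_E_of_ground_states (b g c e : R) (k k' k2 k2' : R -> R) :
  0 < g -> g <= PI -> PI <= b -> b <= 2 * PI -> 0 <= c -> 0 < e -> e < 1 / 4 ->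
  (forall t, 0 < t < b -> is_derive k t (k' t) /\ continuous k' t /\
     k' t + k t ^ 2 <= - (c / sfun b t ^ 2)) ->
  (forall t, 0 < t < PI / 2 -> is_derive k2 t (k2' t) /\ continuous k2' t /\
     k2' t + k2 t ^ 2 <= - (c / sin t ^ 2)) ->
  flux_compatible b k k2 ->
  hardy_ineq (E b g) (c * (1 - 2 * e) ^ 2).
Proof.
  intros G1 G2 B1 B2 Hc He1 He2 Hk Hk2 HC.
  destruct (sector_field b k k' B1 B2) as (Pxx & Pxy & Pyx & Pyy & HP).
  { intros t Ht. split; apply Hk; auto. }
  destruct (mirror_field g k2 k2') as (Qxx & Qxy & Qyx & Qyy & HQ).
  { intros t Ht. split; apply Hk2; auto. }
  set (m1x := fun w : pt => k (ang b w) * (- snd w / rad w ^ 2)) in HP.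
  set (m1y := fun w : pt => k (ang b w) * (fst w / rad w ^ 2)) in HP.
  set (m2x := fun w : pt => k2 (ang2 g w) * ((lcoord g w * cos g - (1 + tcoord g w) * sin g) / rad2 g w ^ 2)) in HQ.
  set (m2y := fun w : pt => k2 (ang2 g w) * ((- lcoord g w * sin g - (1 + tcoord g w) * cos g) / rad2 g w ^ 2)) in HQ.
  pose (q := fun w => lcoord g w * / dsec b w).
  pose (dx := fun w => dsec b w * (fst w / rad w ^ 2 + sder b (ang b w) / sfun b (ang b w) * (- snd w / rad w ^ 2))).
  pose (dy := fun w => dsec b w * (snd w / rad w ^ 2 + sder b (ang b w) / sfun b (ang b w) * (fst w / rad w ^ 2))).
  pose (wx := fun w => cutoff' e (q w) * (- sin g * / dsec b w + lcoord g w * (- / (dsec b w) ^ 2 * dx w))).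
  pose (wy := fun w => cutoff' e (q w) * (- cos g * / dsec b w + lcoord g w * (- / (dsec b w) ^ 2 * dy w))).
  assert (HW : forall z, in_sector b z -> PD (fun w => cutoff e (q w)) wx wy z).
  { intros z Hz. destruct (cutoff_spec e (q z) He1) as (D & C & _).
    apply PD_comp; auto. apply PD_mult; [apply PD_lcoord|].
    apply PD_inv; [apply Rgt_not_eq; now apply dsec_pos | now apply PD_dsec]. }
  (* The mirror field is controlled only in the quadrant t, l > 0; outside it the sector's field
     stands alone, and [GPD] shows that no seam arises inside [E]. *)
  pose (glue := fun (f h : pt -> R) (w : pt) =>
    if excluded_middle_informative (quadrant g w) then f w else h w).
  assert (GT : forall f h w, quadrant g w -> glue f h w = f w).
  { intros f h w Hw. unfold glue. destruct excluded_middle_informative; tauto. }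
  assert (GF : forall f h w, ~ quadrant g w -> glue f h w = h w).
  { intros f h w Hw. unfold glue. destruct excluded_middle_informative; tauto. }
  pose (W := fun w : pt => cutoff e (q w)).
  assert (GPD : forall m1 m1x m1y m2 m2x m2y z, E b g z -> PD m1 m1x m1y z ->
     (quadrant g z -> PD m2 m2x m2y z) ->
     PD (glue (fun w => m1 w + W w * (m2 w + -1 * m1 w)) m1)
        (glue (fun w => m1x w + (wx w * (m2 w + -1 * m1 w) + W w * (m2x w + (0 * m1 w + -1 * m1x w)))) m1x)
        (glue (fun w => m1y w + (wy w * (m2 w + -1 * m1 w) + W w * (m2y w + (0 * m1 w + -1 * m1y w)))) m1y) z).
  { intros n1 n1x n1y n2 n2x n2y z Ez H1 H2.
    pose proof (E_in_sector b g z G1 G2 B1 B2 Ez) as Sz.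
    destruct (classic (quadrant g z)) as [U | U].
    - eapply PD_ext_loc; [|exact (PD_plus _ _ _ _ _ _ z H1 (PD_mult _ _ _ _ _ _ z (HW z Sz)
        (PD_plus _ _ _ _ _ _ z (H2 U) (PD_mult _ _ _ _ _ _ z (PD_const (-1) z) H1))))].
      eapply filter_imp; [|exact (quadrant_open g z U)]. intros w Hw.
      rewrite !GT by auto. repeat split.
    - eapply PD_ext_loc; [|exact H1].
      (* On the edge of the quadrant, a point of [E] has t = 0 and l > 0, since l = 0 with t >= 0 is
         on [L1]. Then P is at distance l, so [dsec] <= l, the ratio is at least 1, and the cutoff
         vanishes nearby. *)
      assert (L : locally z (fun w => ~ quadrant g w \/ (in_sector b w /\ 1 - e < q w))).
      { destruct (Rlt_dec (lcoord g z) 0) as [L0 | L0].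
        { pose proof (locally_lt (lcoord g) (fun _ => 0) z (continuous_lin _ _ _ z) (continuous_const _ _) L0) as LL.
          eapply filter_imp; [|exact LL]. intros w Hw. left. intros [_ K]. exact (Rlt_asym _ _ Hw K). }
        destruct (Rlt_dec (tcoord g z) 0) as [T0 | T0].
        { pose proof (locally_lt (tcoord g) (fun _ => 0) z (continuous_lin _ _ _ z) (continuous_const _ _) T0) as LL.
          eapply filter_imp; [|exact LL]. intros w Hw. left. intros [K _]. exact (Rlt_asym _ _ Hw K). }
        assert (L1' : lcoord g z <> 0).
        { intros K. apply (E_not_Gam b g z Ez). left. apply L1_tl. split; auto. lra. }
        assert (T1 : tcoord g z = 0).
        { apply NNPP. intros K. apply U. split; lra. }
        assert (D : dsec b z <= lcoord g z).
        { apply Rle_trans with (edist z (1, 0)).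
          - apply dsec_le_edist; auto. left. simpl. lra.
          - apply Rsqr_incr_0_var; [|lra]. unfold Rsqr.
            pose proof (edist_tl g z (1, 0)) as Q. rewrite T1 in Q. unfold tcoord, lcoord at 2 in Q.
            simpl fst in Q; simpl snd in Q.
            replace (- cos g * 1 + sin g * 0 + cos g) with 0 in Q by ring.
            replace (- sin g * 1 + - cos g * 0 + sin g) with 0 in Q by ring. nra. }
        pose proof (dsec_pos b z B1 B2 Sz) as Dp.
        assert (LL : locally z (fun w => (1 - e) * dsec b w < lcoord g w)).
        { apply (locally_lt (fun w => (1 - e) * dsec b w) (lcoord g)).
          - apply continuous_Rmult; [apply continuous_const|]. now apply (PD_dsec b z).
          - apply continuous_lin.
          - nra. }
        eapply filter_imp; [|exact (filter_and _ _ LL (in_sector_open b z Sz))].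
        intros w [Hw1 Hw2]. right. split; auto. unfold q.
        apply Rmult_lt_reg_r with (dsec b w); [now apply dsec_pos|].
        rewrite Rmult_assoc, Rinv_l, Rmult_1_r; [exact Hw1|]. apply Rgt_not_eq. now apply dsec_pos. }
      eapply filter_imp; [|exact L]. intros w [Hw | [Hw1 Hw2]].
      + rewrite !GF by auto. auto.
      + destruct (classic (quadrant g w)) as [V | V]; [|rewrite !GF by auto; auto].
        rewrite !GT by auto. destruct (cutoff_spec e (q w) He1) as (_ & _ & _ & _ & Z & _).
        destruct Z as [Z1 Z2]; [lra|]. unfold W, wx, wy. rewrite Z1, Z2. repeat split; ring. }
  apply hardy_ineq_of_field with
    (T1 := glue (fun w => m1x w + W w * (m2x w + -1 * m1x w)) m1x)
    (T1x := glue (fun w => Pxx w + (wx w * (m2x w + -1 * m1x w) + W w * (Qxx w + (0 * m1x w + -1 * Pxx w)))) Pxx)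
    (T1y := glue (fun w => Pxy w + (wy w * (m2x w + -1 * m1x w) + W w * (Qxy w + (0 * m1x w + -1 * Pxy w)))) Pxy)
    (T2 := glue (fun w => m1y w + W w * (m2y w + -1 * m1y w)) m1y)
    (T2x := glue (fun w => Pyx w + (wx w * (m2y w + -1 * m1y w) + W w * (Qyx w + (0 * m1y w + -1 * Pyx w)))) Pyx)
    (T2y := glue (fun w => Pyy w + (wy w * (m2y w + -1 * m1y w) + W w * (Qyy w + (0 * m1y w + -1 * Pyy w)))) Pyy).
  { intros z Ez. apply GPD; auto.
    - now apply HP, E_in_sector with g.
    - intros U. now apply HQ. }
  { intros z Ez. apply GPD; auto.
    - now apply HP, E_in_sector with g.
    - intros U. now apply HQ. }
  intros z Ez. pose proof (E_in_sector b g z G1 G2 B1 B2 Ez) as Sz.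
  destruct (in_sector_pos b z Sz) as [Hr _].
  pose proof (in_sector_ang b z B1 B2 Sz) as Ha.
  pose proof (dsec_pos b z B1 B2 Sz) as Hd.
  destruct (sfun_bounds b (ang b z) B1 Ha) as [Hs _].
  destruct (HP z Sz) as (_ & _ & HPdiv).
  pose proof (rad_sqr z) as Qr.
  set (d := dist_bd (E b g) z). set (c' := c * (1 - 2 * e) ^ 2).
  assert (Hc' : 0 <= c') by (apply Rmult_le_pos; auto; apply pow2_ge_0).
  assert (First : Pxx z + Pyy z + (m1x z ^ 2 + m1y z ^ 2) <= - (c / dsec b z ^ 2)).
  { rewrite HPdiv. unfold m1x, m1y.
    replace (k' (ang b z) / rad z ^ 2 + ((k (ang b z) * (- snd z / rad z ^ 2)) ^ 2 + (k (ang b z) * (fst z / rad z ^ 2)) ^ 2))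
      with (/ rad z ^ 2 * (k' (ang b z) + k (ang b z) ^ 2)).
    - destruct (Hk (ang b z) Ha) as (_ & _ & K).
      apply Rle_trans with (/ rad z ^ 2 * - (c / sfun b (ang b z) ^ 2)).
      + apply Rmult_le_compat_l; auto. left. apply Rinv_0_lt_compat, pow_lt. lra.
      + unfold dsec. right. field. lra.
    - transitivity (k' (ang b z) / rad z ^ 2 + k (ang b z) ^ 2 * (fst z ^ 2 + snd z ^ 2) / rad z ^ 4).
      rewrite <- Qr. field; lra. field; lra. }
  (* The factor (1 - 2e)^2 pays for the transition zone, where [dsec] may exceed the distance to
     [L1], but by a factor of at most 1 / (1 - 2e). *)
  assert (Comp : forall u, 0 < u -> (1 - 2 * e) * u <= d -> - (c / u ^ 2) <= - (c' / d ^ 2)).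
  { intros u Hu Hud. unfold c'. apply Ropp_le_contravar.
    assert (0 < (1 - 2 * e) * u) by (apply Rmult_lt_0_compat; lra).
    unfold Rdiv. rewrite Rmult_assoc. apply Rmult_le_compat_l; auto.
    apply Rmult_le_reg_r with (d ^ 2 * u ^ 2); [apply Rmult_lt_0_compat; nra|].
    replace ((1 - 2 * e) ^ 2 * / d ^ 2 * (d ^ 2 * u ^ 2)) with (((1 - 2 * e) * u) ^ 2) by (field; lra).
    replace (/ u ^ 2 * (d ^ 2 * u ^ 2)) with (d ^ 2) by (field; lra).
    apply pow_incr. lra. }
  assert (Second : dsec b z <= d \/ (0 < tcoord g z /\ 0 < lcoord g z < dsec b z /\ lcoord g z <= d)).
  { now apply dist_bd_E_cases. }
  assert (Trivial : W z = 0 -> Pxx z + Pyy z + (m1x z ^ 2 + m1y z ^ 2) <= - (c' / d ^ 2)).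
  { intros Wz. eapply Rle_trans; [exact First|]. apply Comp; auto.
    destruct Second as [S | (S1 & S2 & S3)]; [nra|].
    apply Rle_trans with (lcoord g z); auto.
    apply Rnot_lt_le. intros N.
    assert (q z < 1 - 2 * e).
    { apply Rmult_lt_reg_r with (dsec b z); auto. unfold q. rewrite Rmult_assoc, Rinv_l; lra. }
    destruct (cutoff_spec e (q z) He1) as (_ & _ & _ & _ & _ & Z). unfold W in Wz.
    rewrite Z in Wz; lra. }
  destruct (classic (quadrant g z)) as [U | U].
  2: { rewrite !GF by auto. eapply Rle_trans; [exact First|]. apply Comp; auto.
       destruct Second as [S | (S1 & S2 & S3)]; [nra|]. exfalso. apply U. split; lra. }
  rewrite !GT by auto.
  destruct (cutoff_spec e (q z) He1) as (_ & _ & Wb & Wn & Z0 & Z1). fold (W z) in Wb, Z0, Z1.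
  destruct (Rle_dec (1 - e) (q z)) as [Hq | Hq].
  { destruct (Z0 Hq) as [Wz Wz']. unfold wx, wy. rewrite Wz, Wz'.
    match goal with |- ?lhs <= _ => replace lhs with (Pxx z + Pyy z + (m1x z ^ 2 + m1y z ^ 2)) by ring end.
    now apply Trivial. }
  destruct U as [U1 U2].
  assert (Ld : lcoord g z < dsec b z).
  { apply Rnot_le_lt. intros N. apply Hq. apply Rmult_le_reg_r with (dsec b z); auto.
    unfold q. rewrite Rmult_assoc, Rinv_l by lra. nra. }
  assert (HN : nearer_L1 b g z) by (split; [|split]; auto; lra).
  assert (Dl : lcoord g z <= d) by (destruct Second as [S | (_ & _ & S)]; lra).
  destruct (HQ z (conj U1 U2)) as (_ & _ & HQdiv).
  destruct (atan_polar (1 + tcoord g z) (lcoord g z)) as (P1 & P2 & P3 & P4); try lra.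
  fold (rad2 g z) in P2, P3, P4. fold (ang2 g z) in P1, P3, P4.
  pose proof (rad2_sqr g z) as Qr2. pose proof (sin2_cos2' g) as SC.
  assert (Mirror : Qxx z + Qyy z + (m2x z ^ 2 + m2y z ^ 2) <= - (c / lcoord g z ^ 2)).
  { rewrite HQdiv. unfold m2x, m2y.
    match goal with |- ?lhs <= _ => replace lhs with (/ rad2 g z ^ 2 * (k2' (ang2 g z) + k2 (ang2 g z) ^ 2)) end.
    - destruct (Hk2 (ang2 g z) P1) as (_ & _ & K).
      apply Rle_trans with (/ rad2 g z ^ 2 * - (c / sin (ang2 g z) ^ 2)).
      + apply Rmult_le_compat_l; auto. left. apply Rinv_0_lt_compat, pow_lt. lra.
      + rewrite P4. right. field. split; [|lra]. apply Rgt_not_eq, sin_gt_0; lra.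
    - transitivity (k2' (ang2 g z) / rad2 g z ^ 2 + k2 (ang2 g z) ^ 2 *
        (((1 + tcoord g z) ^ 2 + lcoord g z ^ 2) * (sin g * sin g + cos g * cos g)) / rad2 g z ^ 4).
      + rewrite SC, <- Qr2. field; lra.
      + field; lra. }
  (* The gradient of the cutoff is cutoff' q times the difference of the logarithmic gradients of l
     and [dsec]. So this term is cutoff' q (flux2 - flux1), with cutoff' <= 0. *)
  assert (Flux : wx z * (m2x z - m1x z) + wy z * (m2y z - m1y z) <= 0).
  { pose proof (flux_order b g k k2 z G1 G2 B1 B2 HC HN) as F. cbv zeta in F.
    set (X := fst z) in *. set (Y := snd z) in *. set (r := rad z) in *. set (l := lcoord g z) in *.
    set (p := 1 + tcoord g z) in *. set (r2 := rad2 g z) in *.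
    set (ct := sder b (ang b z) / sfun b (ang b z)) in *.
    set (ka := k (ang b z)) in *. set (kh := k2 (ang2 g z)) in *.
    match type of F with ?f1 <= ?f2 =>
      assert (Id : wx z * (m2x z - m1x z) + wy z * (m2y z - m1y z) = cutoff' e (q z) * q z * (f2 - f1)) end.
    { unfold wx, wy, dx, dy. change (dsec b z) with (dsec b z). unfold m1x, m1y, m2x, m2y, q.
      fold X Y r l p r2 ct ka kh. set (D := dsec b z) in *.
      transitivity (cutoff' e (l * / D) * (l * / D) *
        ((- sin g / l - (X / r ^ 2 + ct * (- Y / r ^ 2))) *
          (kh * ((l * cos g - p * sin g) / r2 ^ 2) - ka * (- Y / r ^ 2)) +
         (- cos g / l - (Y / r ^ 2 + ct * (X / r ^ 2))) *
          (kh * ((- l * sin g - p * cos g) / r2 ^ 2) - ka * (X / r ^ 2)))).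
      { field. repeat split; lra. }
      f_equal.
      transitivity (kh / r2 ^ 2 * (p * (sin g * sin g + cos g * cos g) / l -
        ((l * cos g - p * sin g) * (X / r ^ 2 + ct * (- Y / r ^ 2)) +
         (- l * sin g - p * cos g) * (Y / r ^ 2 + ct * (X / r ^ 2)))) -
        ka * ((Y * sin g - X * cos g) / (r ^ 2 * l) - ct * (X ^ 2 + Y ^ 2) / r ^ 4)).
      { field. repeat split; lra. }
      rewrite SC, <- Qr. field. repeat split; lra. }
    rewrite Id. assert (0 < q z) by (unfold q; apply Rmult_lt_0_compat; [auto | now apply Rinv_0_lt_compat]).
    match type of F with ?f1 <= ?f2 => assert (0 <= f2 - f1) by lra end.

    assert (S : forall u v, u <= 0 -> 0 <= v -> u * v <= 0) by (clear; intros; nra).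
    apply S; auto. apply S; lra. }
  (* The convexity defect of the squared norm: |(1 - W) T1 + W T2|^2 equals the mean of |T1|^2 and
     |T2|^2 minus this quantity. *)
  assert (Quad : 0 <= W z * (1 - W z) * ((m1x z - m2x z) ^ 2 + (m1y z - m2y z) ^ 2)).
  { apply Rmult_le_pos; [apply Rmult_le_pos; lra|].
    pose proof (pow2_ge_0 (m1x z - m2x z)). pose proof (pow2_ge_0 (m1y z - m2y z)). lra. }
  apply Rle_trans with ((1 - W z) * (Pxx z + Pyy z + (m1x z ^ 2 + m1y z ^ 2)) +
     W z * (Qxx z + Qyy z + (m2x z ^ 2 + m2y z ^ 2))).
  { lra. }
  assert (M2 : Qxx z + Qyy z + (m2x z ^ 2 + m2y z ^ 2) <= - (c' / d ^ 2)).
  { eapply Rle_trans; [exact Mirror|]. apply Comp; auto.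
    apply Rle_trans with (1 * lcoord g z); [apply Rmult_le_compat_r|]; lra. }
  destruct (Rle_dec (q z) (1 - 2 * e)) as [Hq2 | Hq2].
  { rewrite (Z1 Hq2). lra. }
  assert (M1 : Pxx z + Pyy z + (m1x z ^ 2 + m1y z ^ 2) <= - (c' / d ^ 2)).
  { eapply Rle_trans; [exact First|]. apply Comp; auto.
    apply Rle_trans with (lcoord g z); auto. apply Rnot_lt_le. intros N. apply Hq2. left.
    apply Rmult_lt_reg_r with (dsec b z); auto. unfold q. rewrite Rmult_assoc, Rinv_l; lra. }
  assert (T1 := Rmult_le_compat_l (1 - W z) _ _ ltac:(lra) M1).
  assert (T2 := Rmult_le_compat_l (W z) _ _ ltac:(lra) M2). lra.
Qed.

(** * The angular equation *)

(* Coefficients of the solution of (1 - s^2) F'' - (2 a + 1) s F' - a^2 F = 0; then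
   sin^a F(cos) solves y'' + a (1 - a) / sin^2 y = 0. *)
Fixpoint gegen (a p0 p1 : R) (n : nat) : R * R :=
  match n with
  | O => (p0, p1)
  | S m => (snd (gegen a p0 p1 m),
      (INR m + a) ^ 2 / ((INR m + 1) * (INR m + 2)) * fst (gegen a p0 p1 m))
  end.
Definition gcoef (a p0 p1 : R) (n : nat) : R := fst (gegen a p0 p1 n).

Lemma gcoef_step (a p0 p1 : R) (n : nat) :
  (INR n + 1) * (INR n + 2) * gcoef a p0 p1 (S (S n)) = (INR n + a) ^ 2 * gcoef a p0 p1 n.
Proof. unfold gcoef. simpl. pose proof (pos_INR n). field. lra. Qed.

(** For a <= 1 the factor (n + a)^2 / ((n + 1) (n + 2)) is at most 1. Bounded coefficients give a
    radius of convergence of at least 1, enough for s = cos t with 0 < t < PI. *)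
Lemma gcoef_bounded (a p0 p1 : R) (n : nat) : 0 <= a <= 1 ->
  Rabs (gcoef a p0 p1 n) <= Rabs p0 + Rabs p1.
Proof.
  intros Ha. pose proof (Rabs_pos p0). pose proof (Rabs_pos p1).
  assert (H1 : forall m, Rabs (fst (gegen a p0 p1 m)) <= Rabs p0 + Rabs p1 /\
                       Rabs (snd (gegen a p0 p1 m)) <= Rabs p0 + Rabs p1); [|apply H1].
  induction m as [|m [I1 I2]]; simpl; [lra|]. split; auto.
  pose proof (pos_INR m). set (r := (INR m + a) * ((INR m + a) * 1) / ((INR m + 1) * (INR m + 2))).
  assert (Hr : 0 <= r <= 1).
  { unfold r. assert (0 < (INR m + 1) * (INR m + 2)) by nra.
    split; apply Rmult_le_reg_r with ((INR m + 1) * (INR m + 2)); auto;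
    unfold Rdiv; rewrite ?Rmult_0_l, ?Rmult_assoc, ?Rinv_l by lra; nra. }
  rewrite Rabs_mult, (Rabs_pos_eq r) by lra.
  pose proof (Rabs_pos (fst (gegen a p0 p1 m))). nra.
Qed.

Lemma gcoef_radius (a p0 p1 s : R) : 0 <= a <= 1 -> Rabs s < 1 ->
  Rbar_lt (Rabs s) (CV_radius (gcoef a p0 p1)).
Proof.
  intros Ha Hs. apply Rbar_lt_le_trans with (Finite 1); [exact Hs|].
  apply (CV_radius_bounded (gcoef a p0 p1)). exists (Rabs p0 + Rabs p1). intros n.
  rewrite pow1, Rmult_1_r. now apply gcoef_bounded.
Qed.

Lemma gegen_ode (a p0 p1 : R) : 0 <= a <= 1 ->
  exists F F1 F2 : R -> R, F 0 = p0 /\ F1 0 = p1 /\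
    forall s, Rabs s < 1 -> is_derive F s (F1 s) /\ is_derive F1 s (F2 s) /\
      (1 - s ^ 2) * F2 s - (2 * a + 1) * s * F1 s - a ^ 2 * F s = 0.
Proof.
  intros Ha. set (A := gcoef a p0 p1).
  exists (PSeries A), (PSeries (PS_derive A)), (PSeries (PS_derive (PS_derive A))).
  split; [rewrite PSeries_0; reflexivity|].
  split; [rewrite PSeries_0; unfold PS_derive, A, gcoef; simpl; ring|].
  intros s Hs. pose proof (gcoef_radius a p0 p1 s Ha Hs) as R0. fold A in R0.
  assert (R1 : Rbar_lt (Rabs s) (CV_radius (PS_derive A))) by now rewrite CV_radius_derive.
  assert (R2 : Rbar_lt (Rabs s) (CV_radius (PS_derive (PS_derive A)))) by now rewrite CV_radius_derive.
  split; [now apply is_derive_PSeries|]. split; [now apply is_derive_PSeries|].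
  assert (X0 : ex_pseries A s) by (apply CV_radius_inside; auto).
  assert (X1 : ex_pseries (PS_derive A) s) by (apply CV_radius_inside; auto).
  assert (X2 : ex_pseries (PS_derive (PS_derive A)) s) by (apply CV_radius_inside; auto).
  assert (E : PSeries (PS_derive (PS_derive A)) s =
    PSeries (PS_plus (PS_incr_1 (PS_incr_1 (PS_derive (PS_derive A))))
      (PS_plus (PS_scal (2 * a + 1) (PS_incr_1 (PS_derive A))) (PS_scal (a ^ 2) A))) s).
  (* Coefficientwise this is [gcoef_step]; indices 0 and 1 are separate because the shifted series
     start with zeros. *)
  { apply PSeries_ext. intros n. unfold PS_plus, PS_scal, plus, scal; simpl; unfold mult; simpl.
    pose proof (gcoef_step a p0 p1 n) as G. fold A in G.
    destruct n as [|[|n]]; unfold PS_incr_1, PS_derive; rewrite ?S_INR in *; simpl INR in *;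
    unfold zero; simpl; try rewrite ?S_INR; simpl INR in *; nra. }
  rewrite PSeries_plus, PSeries_plus, !PSeries_scal, !PSeries_incr_1 in E.
  - rewrite E at 1.
    transitivity (PSeries (PS_derive (PS_derive A)) s - (s ^ 2 * PSeries (PS_derive (PS_derive A)) s
       + (2 * a + 1) * s * PSeries (PS_derive A) s + a ^ 2 * PSeries A s)).
    + rewrite <- E. ring.
    + rewrite E at 1. ring.
  - apply ex_pseries_scal; auto. intros; apply Rmult_comm. now apply ex_pseries_incr_1.
  - apply ex_pseries_scal; auto. intros; apply Rmult_comm.
  - apply ex_pseries_incr_1, ex_pseries_incr_1; auto.
  - apply ex_pseries_plus.
    + apply ex_pseries_scal; auto. intros; apply Rmult_comm. now apply ex_pseries_incr_1.
    + apply ex_pseries_scal; auto. intros; apply Rmult_comm.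
Qed.

Lemma left_solution (a lam : R) : 0 <= a <= 1 ->
  exists y y1 : R -> R, y (PI / 2) = 1 /\ y1 (PI / 2) = lam /\
    forall t, 0 < t < PI -> is_derive y t (y1 t) /\
      is_derive y1 t (- (a * (1 - a) / sin t ^ 2) * y t).
Proof.
  (* The argument cos t has derivative -1 at PI / 2, so slope [lam] for y means slope [- lam] for F
     at 0. *)
  intros Ha. destruct (gegen_ode a 1 (- lam) Ha) as (F & F1 & F2 & H0 & H1 & HF).
  pose (S := fun t => exp (a * ln (sin t))).
  exists (fun t => S t * F (cos t)), (fun t => S t * (a * cos t / sin t * F (cos t) - sin t * F1 (cos t))).
  assert (S1 : S (PI / 2) = 1).
  { unfold S. rewrite sin_PI2, ln_1, Rmult_0_r. apply exp_0. }
  rewrite S1, sin_PI2, cos_PI2, H0, H1. split; [ring|]. split; [field|].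
  intros t Ht. assert (Hs : 0 < sin t) by (apply sin_gt_0; lra).
  pose proof (sin2_cos2' t) as SC.
  assert (Hc : Rabs (cos t) < 1) by (apply Rabs_def1; nra).
  destruct (HF (cos t) Hc) as (D0 & D1 & Ode).
  assert (DS : is_derive S t (S t * (a * cos t / sin t))).
  { unfold S. auto_derive; auto. field. lra. }
  assert (DF : is_derive (fun t => F (cos t)) t (- sin t * F1 (cos t))).
  { apply (is_derive_comp F cos); auto. auto_derive; auto. ring. }
  assert (DF1 : is_derive (fun t => F1 (cos t)) t (- sin t * F2 (cos t))).
  { apply (is_derive_comp F1 cos); auto. auto_derive; auto. ring. }
  split.
  - evar_last. apply @is_derive_mult; [exact DS | exact DF | intros; apply Rmult_comm].
    unfold plus, mult; simpl. field. lra.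
  - assert (DG : is_derive (fun t => a * cos t / sin t) t (- (a / sin t ^ 2))).
    { auto_derive; [lra|]. field_simplify_eq; [|lra]. replace (sin t ^ 2) with (1 - cos t ^ 2) by lra. ring. }
    evar_last.
    + apply @is_derive_mult; [exact DS | | intros; apply Rmult_comm].
      apply @is_derive_minus; apply @is_derive_mult;
        [exact DG | exact DF | intros; apply Rmult_comm | auto_derive; [auto | reflexivity] | exact DF1
         | intros; apply Rmult_comm].
    + unfold plus, mult, minus, opp; simpl. unfold plus, mult; simpl.
      assert (E2 : sin t ^ 2 * F2 (cos t) = (2 * a + 1) * cos t * F1 (cos t) + a ^ 2 * F (cos t)).
      { replace (sin t ^ 2) with (1 - cos t ^ 2) by lra. lra. }
      transitivity (S t * (a ^ 2 * (cos t * cos t) / sin t ^ 2 * F (cos t) - a / sin t ^ 2 * F (cos t)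
         - (2 * a + 1) * cos t * F1 (cos t) + sin t ^ 2 * F2 (cos t))).
      { field. lra. }
      rewrite E2. replace (cos t * cos t) with (1 - sin t ^ 2) by lra. field. lra.
Qed.

(** The solution symmetric about b / 2. In the middle zone the weight is 1 and the solution is a
    positive multiple of cos (kap (b / 2 - t)); the last clause records its sign and its logarithmic
    derivative. *)
Definition angular_solution (b kap : R) (Y Y1 : R -> R) : Prop :=
  (forall t, 0 < t < b -> is_derive Y t (Y1 t) /\ is_derive Y1 t (- (kap ^ 2 / sfun b t ^ 2) * Y t)) /\
  (forall t, 0 < t < b -> Y (b - t) = Y t /\ Y1 (b - t) = - Y1 t) /\
  (forall t, PI / 2 <= t -> t <= b - PI / 2 -> 0 < Y t /\ Y1 t = kap * tan (kap * (b / 2 - t)) * Y t).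

Lemma angular_solution_exists (b a kap : R) :
  PI <= b -> b <= 2 * PI -> 0 <= a <= 1 -> 0 < kap -> kap ^ 2 = a * (1 - a) ->
  exists Y Y1, angular_solution b kap Y Y1.
Proof.
  intros B1 B2 Ha Hk Ek. pose proof PI_RGT_0 as HPI.
  (* From a (1 - a) <= 1/4. In the middle zone |b / 2 - t| <= PI / 2, so the argument of the cosine
     stays within PI / 4 and the cosine is positive. *)
  assert (Hk2 : kap <= 1 / 2).
  { apply Rnot_lt_le. intros N. pose proof (pow2_ge_0 (a - 1 / 2)). nra. }
  (* The slope at PI / 2 of the cosine solution normalized to 1 there, so that the pieces join to
     first order. *)
  set (lam := kap * tan (kap * (b / 2 - PI / 2))).
  destruct (left_solution a lam Ha) as (y & y1 & L0 & L1 & HL).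
  set (C := cos (kap * (b / 2 - PI / 2))).
  assert (Cp : forall t, PI / 2 <= t -> t <= b - PI / 2 -> 0 < cos (kap * (b / 2 - t))).
  { intros t H1 H2. apply cos_gt_0; nra. }
  assert (C0 : 0 < C) by (apply Cp; lra).
  pose (M := fun t => cos (kap * (b / 2 - t)) / C).
  pose (M1 := fun t => kap * sin (kap * (b / 2 - t)) / C).
  assert (DM : forall t, is_derive M t (M1 t) /\ is_derive M1 t (- (kap ^ 2) * M t)).
  { intros t. unfold M, M1. split; auto_derive; auto; unfold Rdiv, Rminus; field; lra. }
  assert (ML : M (PI / 2) = 1 /\ M1 (PI / 2) = lam).
  { unfold M, M1, lam, tan. fold C. split; field; lra. }
  assert (MR : M (b - PI / 2) = 1 /\ M1 (b - PI / 2) = - lam).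
  { destruct ML as [<- <-]. unfold M, M1.
    replace (kap * (b / 2 - (b - PI / 2))) with (- (kap * (b / 2 - PI / 2))) by field.
    rewrite cos_neg, sin_neg. split; field; lra. }
  destruct ML as [ML ML1]. destruct MR as [MR MR1].
  pose (yr := fun t => y (b - t)). pose (yr1 := fun t => - y1 (b - t)).
  assert (RE : b - (b - PI / 2) = PI / 2) by ring.
  assert (Dr : forall t, 0 < b - t < PI -> is_derive yr t (yr1 t) /\
     is_derive yr1 t (- (kap ^ 2 / sin (b - t) ^ 2) * yr t)).
  { intros t Ht. destruct (HL (b - t) Ht) as [D1 D2]. rewrite <- Ek in D2.
    assert (Db : is_derive (fun t => b - t) t (-1)) by (auto_derive; auto; ring).
    split.
    - evar_last. apply (is_derive_comp y (fun t => b - t) t _ _ D1 Db).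
      unfold yr1, scal; simpl; unfold mult; simpl; ring.
    - evar_last. apply @is_derive_opp. apply (is_derive_comp y1 (fun t => b - t) t _ _ D2 Db).
      unfold yr, scal, opp; simpl; unfold mult; simpl; ring. }
  set (Y := pw (PI / 2) y (pw (b - PI / 2) M yr)).
  set (Y1 := pw (PI / 2) y1 (pw (b - PI / 2) M1 yr1)).
  assert (JR : M (b - PI / 2) = yr (b - PI / 2)) by (unfold yr; rewrite RE; lra).
  assert (JR1 : M1 (b - PI / 2) = yr1 (b - PI / 2)) by (unfold yr1; rewrite RE; lra).
  assert (JL : y (PI / 2) = pw (b - PI / 2) M yr (PI / 2)) by (rewrite pw_left; lra).
  assert (JL1 : y1 (PI / 2) = pw (b - PI / 2) M1 yr1 (PI / 2)) by (rewrite pw_left; lra).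
  assert (EL : forall t, t <= PI / 2 -> Y t = y t /\ Y1 t = y1 t).
  { intros t H. split; now apply pw_left. }
  assert (EM : forall t, PI / 2 <= t -> t <= b - PI / 2 -> Y t = M t /\ Y1 t = M1 t).
  { intros t H H'. unfold Y, Y1. rewrite !(pw_right (PI / 2)) by auto. now rewrite !pw_left. }
  assert (ER : forall t, b - PI / 2 <= t -> Y t = yr t /\ Y1 t = yr1 t).
  { intros t H. unfold Y, Y1. rewrite !(pw_right (PI / 2)) by (auto; lra). now rewrite !pw_right. }
  exists Y, Y1. split; [|split].
  - intros t Ht. split.
    + apply pw_derive; auto; intros.
      * rewrite <- (pw_left (PI / 2) y1 (fun _ => 0)) by auto. rewrite pw_left by auto. apply HL. lra.
      * apply pw_derive; auto; intros.
        -- apply DM.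
        -- apply Dr. lra.
    + pose (q := fun t => - (kap ^ 2 / sin t ^ 2) * y t).
      pose (qm := fun t => - (kap ^ 2) * M t).
      pose (qr := fun t => - (kap ^ 2 / sin (b - t) ^ 2) * yr t).
      assert (QR : qm (b - PI / 2) = qr (b - PI / 2)).
      { unfold qm, qr. rewrite JR, RE, sin_PI2. field. }
      assert (QL : q (PI / 2) = pw (b - PI / 2) qm qr (PI / 2)).
      { rewrite pw_left by lra. unfold q, qm. rewrite L0, ML, sin_PI2. field. }
      assert (D : is_derive Y1 t (pw (PI / 2) q (pw (b - PI / 2) qm qr) t)).
      { apply pw_derive; auto; intros.
        - unfold q. rewrite Ek. apply HL. lra.
        - apply pw_derive; auto; intros.
          + apply DM.
          + apply Dr. lra. }
      evar_last; [exact D|].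
      destruct (angle_cases b t B1) as [H | [H | H]].
      * rewrite pw_left, sfun_left by lra. destruct (EL t H) as [-> _]. reflexivity.
      * rewrite pw_right, pw_left, sfun_mid by (auto; lra).
        destruct (EM t (proj1 H) (proj2 H)) as [-> _]. unfold qm. field.
      * rewrite !pw_right, sfun_right by (auto; lra). destruct (ER t H) as [-> _]. reflexivity.
  - intros t Ht. destruct (angle_cases b t B1) as [H | [H | H]].
    + destruct (EL t H) as [-> ->]. destruct (ER (b - t)) as [-> ->]; [lra|].
      unfold yr, yr1. replace (b - (b - t)) with t by ring. auto.
    + destruct (EM t) as [-> ->]; try lra. destruct (EM (b - t)) as [-> ->]; try lra.
      unfold M, M1. replace (kap * (b / 2 - (b - t))) with (- (kap * (b / 2 - t))) by field.
      rewrite cos_neg, sin_neg. split; field; lra.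
    + destruct (ER t H) as [-> ->]. destruct (EL (b - t)) as [-> ->]; [lra|].
      unfold yr, yr1. split; ring.
  - intros t H1 H2. destruct (EM t H1 H2) as [-> ->]. pose proof (Cp t H1 H2). unfold M, M1, tan. split.
    + apply Rdiv_lt_0_compat; auto.
    + field. lra.
Qed.

(** If positivity fails, p is the supremum of the points of (0, PI / 2) where Y <= 0. Beyond it,
    positivity spreads to (p, b - p) through the middle zone and by symmetry; this gives two zeros
    of Y with Y > 0 in between. *)
Lemma angular_dichotomy (b kap : R) (Y Y1 : R -> R) :
  PI <= b -> b <= 2 * PI -> angular_solution b kap Y Y1 ->
  (forall t, 0 < t < b -> 0 < Y t) \/
  (exists p, 0 < p < PI / 2 /\ Y p = 0 /\ forall t, p < t < b - p -> 0 < Y t).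
Proof.
  intros B1 B2 (H1 & H2 & H3). pose proof PI_RGT_0 as HPI.
  assert (C : forall t, 0 < t < b -> continuous Y t).
  { intros t Ht. apply @ex_derive_continuous. exists (Y1 t). exact (proj1 (H1 t Ht)). }
  assert (S : forall p, 0 <= p -> (forall t, p < t < PI / 2 -> 0 < Y t) -> forall t, p < t < b - p -> 0 < Y t).
  { intros p Hp H t Ht. destruct (Rlt_dec t (PI / 2)); [apply H; lra|].
    destruct (Rle_dec t (b - PI / 2)); [apply H3; lra|].
    destruct (H2 (b - t)) as [E _]; [lra|]. replace (b - (b - t)) with t in E by ring.
    rewrite E. apply H. lra. }
  destruct (classic (forall t, 0 < t < PI / 2 -> 0 < Y t)) as [P | P].
  - left. intros t Ht. apply (S 0); auto; lra.
  - right. apply not_all_ex_not in P. destruct P as [t0 P].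
    assert (T0 : 0 < t0 < PI / 2) by tauto. assert (Y0 : Y t0 <= 0) by (apply Rnot_lt_le; tauto).
    destruct (completeness (fun t => 0 < t < PI / 2 /\ Y t <= 0)) as [p [P1 P2]].
    { exists (PI / 2). intros t Ht. lra. }
    { exists t0. auto. }
    assert (Pt : t0 <= p) by (apply P1; auto).
    assert (Pp : p <= PI / 2) by (apply P2; intros t Ht; lra).
    assert (Yup : forall t, p < t < PI / 2 -> 0 < Y t).
    { intros t Ht. apply Rnot_le_lt. intros N. assert (t <= p); [|lra]. apply P1. lra. }
    assert (Yp : Y p = 0).
    { destruct (Rtotal_order (Y p) 0) as [K | [K | K]]; auto; exfalso.
      - assert (p < PI / 2).
        { destruct (Req_dec p (PI / 2)) as [E|]; [|lra].
          destruct (H3 p) as [Q _]; lra. }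
        assert (L : locally p (fun t => Y t < 0)).
        { apply (C p ltac:(lra) (fun v => v < 0)). apply (open_lt 0). exact K. }
        destruct L as [d Hd]. set (t := p + Rmin (d / 2) ((PI / 2 - p) / 2)).
        pose proof (cond_pos d) as Dp.
        pose proof (Rmin_l (d / 2) ((PI / 2 - p) / 2)). pose proof (Rmin_r (d / 2) ((PI / 2 - p) / 2)).
        assert (0 < Rmin (d / 2) ((PI / 2 - p) / 2)) by (apply Rmin_pos; lra).
        assert (Yt : Y t < 0).
        { apply Hd. change (Rabs (t - p) < d). unfold t. apply Rabs_def1; lra. }
        assert (0 < Y t) by (apply Yup; unfold t; lra). lra.
      - assert (L : locally p (fun t => 0 < Y t)).
        { apply (C p ltac:(lra) (fun v => 0 < v)). apply (open_gt 0). exact K. }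
        destruct L as [d Hd]. pose proof (cond_pos d) as Dp.
        assert (p <= p - d / 2); [|lra]. apply P2. intros t [Ht Yt].
        apply Rnot_lt_le. intros N. assert (t <= p) by (apply P1; auto).
        assert (0 < Y t); [|lra]. apply Hd. change (Rabs (t - p) < d). apply Rabs_def1; lra. }
    exists p. assert (p < PI / 2).
    { destruct (Req_dec p (PI / 2)) as [E|]; [|lra]. destruct (H3 p) as [Q _]; lra. }
    split; [lra|]. split; auto. apply S; auto; lra.
Qed.

Lemma decreasing_of_derive (f df : R -> R) (u v : R) :
  u <= v -> (forall t, u <= t <= v -> is_derive f t (df t)) ->
  (forall t, u <= t <= v -> df t <= 0) -> f v <= f u.
Proof.
  intros H D N. destruct (MVT_gen f u v df) as (c & Hc & E).
  - intros t Ht. rewrite Rmin_left, Rmax_right in Ht by auto. apply D. lra.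
  - intros t Ht. rewrite Rmin_left, Rmax_right in Ht by auto. apply continuity_pt_filterlim.
    apply @ex_derive_continuous. eexists. now apply D.
  - rewrite Rmin_left, Rmax_right in Hc by auto. specialize (N c Hc).
    assert (df c * (v - u) <= 0) by nra. lra.
Qed.

(** The quotient tan t / t increases, since its derivative has the sign of t - sin t cos t. This is
    the source of the linear factor 2 (PI - t) / PI in [flux_compatible]. *)
Lemma tan_star_shaped (u v : R) : 0 <= u -> u <= v -> v < PI / 2 -> v * tan u <= u * tan v.
Proof.
  intros H0 H1 H2. pose proof PI_RGT_0.
  destruct (Req_dec u 0) as [-> | U]; [rewrite tan_0; lra|].
  assert (Cp : forall t, u <= t <= v -> 0 < cos t) by (intros; apply cos_gt_0; lra).
  assert (D : - (tan v / v) <= - (tan u / u)).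
  { apply (decreasing_of_derive (fun t => - (tan t / t))
      (fun t => - (((tan t ^ 2 + 1) * t - tan t) / t ^ 2))); auto.
    - intros t Ht. specialize (Cp t Ht).
      evar_last. apply @is_derive_opp. apply is_derive_div; [apply is_derive_tan; lra | apply is_derive_id | lra].
      unfold opp, one; simpl. field. lra.
    - intros t Ht. specialize (Cp t Ht).
      assert (0 <= ((tan t ^ 2 + 1) * t - tan t) / t ^ 2); [|lra].
      apply Rmult_le_pos; [|left; apply Rinv_0_lt_compat; nra].
      assert (Sx : sin t <= t) by (left; apply sin_lt_x; lra).
      assert (S0 : 0 <= sin t) by (apply sin_ge_0; lra).
      pose proof (COS_bound t). pose proof (sin2_cos2' t) as SC.
      unfold tan. replace (((sin t / cos t) ^ 2 + 1) * t - sin t / cos t) with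
        (/ (cos t) ^ 2 * ((sin t * sin t + cos t * cos t) * t - sin t * cos t)) by (field; lra).
      rewrite SC. apply Rmult_le_pos; [left; apply Rinv_0_lt_compat; nra | nra]. }
  assert (D' : tan u / u <= tan v / v) by lra.
  apply Rmult_le_compat_r with (r := u * v) in D'; [|nra].
  replace (tan u / u * (u * v)) with (v * tan u) in D' by (field; lra).
  replace (tan v / v * (u * v)) with (u * tan v) in D' by (field; lra). exact D'.
Qed.

(* F1 = sin Y1 / Y satisfies Y^2 F1' = J, and J is decreasing where Y1 >= 0, so F1 increases up
   to some s0 and decreases afterwards; F2 is its decreasing envelope F1 (max s0 .). *)
Lemma decreasing_majorant (kap : R) (Y Y1 : R -> R) :
  0 < kap -> 0 <= Y1 (PI / 2) ->
  (forall t, 0 < t <= PI / 2 -> 0 < Y t /\ is_derive Y t (Y1 t) /\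
     is_derive Y1 t (- (kap ^ 2 / sin t ^ 2) * Y t)) ->
  (forall t, 0 < t <= PI / 2 -> 0 <= Y1 t) /\
  exists k2 k2', (forall t, 0 < t < PI / 2 -> is_derive k2 t (k2' t) /\ continuous k2' t /\
     k2' t + k2 t ^ 2 <= - (kap ^ 2 / sin t ^ 2)) /\
  (forall s t, 0 < s -> s < PI / 2 -> s <= t -> t <= PI / 2 -> sin t * (Y1 t / Y t) <= sin s * k2 s).
Proof.
  intros Hk HY1 HY. pose proof PI_RGT_0 as HPI.
  assert (Sp : forall t, 0 < t <= PI / 2 -> 0 < sin t) by (intros; apply sin_gt_0; lra).
  assert (Y1p : forall t, 0 < t <= PI / 2 -> 0 <= Y1 t).
  { intros t Ht. apply Rle_trans with (Y1 (PI / 2)); auto.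
    apply decreasing_of_derive with (df := fun t => - (kap ^ 2 / sin t ^ 2) * Y t); [lra| |].
    - intros u Hu. apply HY. lra.
    - intros u Hu. destruct (HY u) as [Yu _]; [lra|]. specialize (Sp u ltac:(lra)).
      assert (0 < kap ^ 2 / sin u ^ 2) by (apply Rdiv_lt_0_compat; apply pow_lt; lra). nra. }
  split; auto.
  pose (F1 := fun t => sin t * (Y1 t / Y t)).
  pose (J := fun t => cos t * (Y t * Y1 t) - kap ^ 2 * (Y t * Y t) / sin t - sin t * (Y1 t * Y1 t)).
  pose (F1' := fun t => J t / (Y t * Y t)).
  assert (DF : forall t, 0 < t <= PI / 2 -> is_derive F1 t (F1' t)).
  { intros t Ht. destruct (HY t Ht) as (Yt & D0 & D1). specialize (Sp t Ht).
    evar_last.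
    - apply @is_derive_mult; [apply is_derive_Reals, derivable_pt_lim_sin | | intros; apply Rmult_comm].
      apply is_derive_div; [exact D1 | exact D0 | lra].
    - unfold F1', J, plus, mult; simpl. field. lra. }
  assert (DJ : forall t, 0 < t <= PI / 2 -> is_derive J t (- (sin t * (Y t * Y1 t)))).
  { intros t Ht. destruct (HY t Ht) as (Yt & D0 & D1). specialize (Sp t Ht).
    assert (Xs : is_derive sin t (cos t)) by (apply is_derive_Reals, derivable_pt_lim_sin).
    assert (Xc : is_derive cos t (- sin t)) by (apply is_derive_Reals, derivable_pt_lim_cos).
    evar_last.
    - apply @is_derive_minus; [apply @is_derive_minus|].
      + apply @is_derive_mult; [exact Xc | apply @is_derive_mult; [exact D0 | exact D1 | intros; apply Rmult_comm] | intros; apply Rmult_comm].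
      + apply is_derive_div; [apply @is_derive_scal; apply @is_derive_mult; [exact D0 | exact D0 | intros; apply Rmult_comm] | exact Xs | lra].
      + apply @is_derive_mult; [exact Xs | apply @is_derive_mult; [exact D1 | exact D1 | intros; apply Rmult_comm] | intros; apply Rmult_comm].
    - unfold plus, mult, minus, opp, scal; simpl. unfold plus, mult; simpl. field. lra. }
  assert (Jmon : forall s t, 0 < s -> s <= t -> t <= PI / 2 -> J t <= J s).
  { intros s t H1 H2 H3. apply decreasing_of_derive with (df := fun t => - (sin t * (Y t * Y1 t))); auto.
    - intros u Hu. apply DJ. lra.
    - intros u Hu. destruct (HY u) as [Yu _]; [lra|]. specialize (Sp u ltac:(lra)).
      specialize (Y1p u ltac:(lra)). assert (0 <= sin u * (Y u * Y1 u)) by (apply Rmult_le_pos; nra). lra. }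
  (* The Riccati equation of Y1 / Y rewritten for F1 = sin Y1 / Y. For a field an inequality
     suffices, which leaves room to replace F1 by a larger function. *)
  assert (Ricc : forall t, 0 < t <= PI / 2 -> sin t * F1' t = cos t * F1 t - kap ^ 2 - F1 t ^ 2).
  { intros t Ht. destruct (HY t Ht) as (Yt & _). specialize (Sp t Ht). unfold F1', J, F1. field. lra. }
  assert (F1p : forall t, 0 < t <= PI / 2 -> 0 <= F1 t).
  { intros t Ht. destruct (HY t Ht) as (Yt & _). specialize (Sp t Ht). specialize (Y1p t Ht).
    apply Rmult_le_pos; [lra|]. apply Rmult_le_pos; auto. left. now apply Rinv_0_lt_compat. }
  assert (CF1' : forall t, 0 < t <= PI / 2 -> continuous F1' t).
  { intros t Ht. destruct (HY t Ht) as (Yt & D0 & D1).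
    assert (X0 : ex_derive Y t) by (eexists; exact D0).
    apply (@continuous_mult R_UniformSpace R_AbsRing J (fun t => / (Y t * Y t)) t).
    - apply @ex_derive_continuous. eexists. now apply DJ.
    - apply @ex_derive_continuous. apply ex_derive_inv; [|nra]. apply @ex_derive_mult; auto. }
  assert (Finish : forall F F' : R -> R,
    (forall t, 0 < t < PI / 2 -> is_derive F t (F' t) /\ continuous F' t /\
       sin t * F' t <= cos t * F t - kap ^ 2 - F t ^ 2) ->
    (forall s t, 0 < s -> s < PI / 2 -> s <= t -> t <= PI / 2 -> F1 t <= F s) ->
    exists k2 k2', (forall t, 0 < t < PI / 2 -> is_derive k2 t (k2' t) /\ continuous k2' t /\
     k2' t + k2 t ^ 2 <= - (kap ^ 2 / sin t ^ 2)) /\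
    (forall s t, 0 < s -> s < PI / 2 -> s <= t -> t <= PI / 2 -> sin t * (Y1 t / Y t) <= sin s * k2 s)).
  { intros F F' HF Hmaj. exists (fun t => F t / sin t), (fun t => (F' t * sin t - F t * cos t) / sin t ^ 2).
    split.
    - intros t Ht. destruct (HF t Ht) as (D & C & R). assert (S : 0 < sin t) by (apply Sp; lra).
      split; [|split].
      + apply is_derive_div; [exact D | apply is_derive_Reals, derivable_pt_lim_sin | lra].
      + assert (Cs : continuous sin t) by apply continuous_sin.
        apply (@continuous_mult R_UniformSpace R_AbsRing (fun t => F' t * sin t - F t * cos t) (fun t => / sin t ^ 2) t).
        * apply (@continuous_minus R_UniformSpace R_AbsRing R_NormedModule (fun t => F' t * sin t) (fun t => F t * cos t)).
          -- apply (@continuous_mult R_UniformSpace R_AbsRing F' sin); auto.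
          -- apply (@continuous_mult R_UniformSpace R_AbsRing F cos); [|apply continuous_cos].
             apply @ex_derive_continuous. eexists; exact D.
        * apply @ex_derive_continuous. auto_derive. nra.
      + apply Rmult_le_reg_r with (sin t ^ 2); [nra|].
        replace (((F' t * sin t - F t * cos t) / sin t ^ 2 + (F t / sin t) ^ 2) * sin t ^ 2)
          with (sin t * F' t - cos t * F t + F t ^ 2) by (field; lra).
        replace (- (kap ^ 2 / sin t ^ 2) * sin t ^ 2) with (- kap ^ 2) by (field; lra). lra.
    - intros s t H1 H2 H3 H4. replace (sin s * (F s / sin s)) with (F s).
      now apply Hmaj. field. apply Rgt_not_eq, Sp. lra. }
  assert (Dec : forall s t, 0 < s -> s <= t -> t <= PI / 2 -> J s <= 0 -> F1 t <= F1 s).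
  { intros s t H1 H2 H3 HJ. apply decreasing_of_derive with (df := F1'); auto.
    - intros u Hu. apply DF. lra.
    - intros u Hu. destruct (HY u) as [Yu _]; [lra|]. unfold F1'.
      assert (J u <= J s) by (apply Jmon; lra).
      assert (0 < / (Y u * Y u)) by (apply Rinv_0_lt_compat; nra). unfold Rdiv. nra. }
  destruct (classic (forall t, 0 < t < PI / 2 -> J t <= 0)) as [Jn | Jp].
  - apply (Finish F1 F1').
    + intros t Ht. split; [apply DF; lra|]. split; [apply CF1'; lra|]. rewrite Ricc; lra.
    + intros s t H1 H2 H3 H4. apply Dec; auto.
  - apply not_all_ex_not in Jp. destruct Jp as [t0 Jp].
    assert (T0 : 0 < t0 < PI / 2) by tauto. assert (J0 : 0 < J t0) by (apply Rnot_le_lt; tauto).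
    (* At PI / 2 the term with the cosine drops out and only negative terms remain; hence J changes
       sign before PI / 2. *)
    assert (Jend : J (PI / 2) < 0).
    { destruct (HY (PI / 2)) as (Yt & _); [lra|]. unfold J. rewrite sin_PI2, cos_PI2.
      assert (0 < kap ^ 2 * (Y (PI / 2) * Y (PI / 2))) by (apply Rmult_lt_0_compat; nra).
      replace (kap ^ 2 * (Y (PI / 2) * Y (PI / 2)) / 1) with (kap ^ 2 * (Y (PI / 2) * Y (PI / 2))) by field.
      nra. }
    destruct (Ranalysis5.IVT_interv (fun t => - J t) t0 (PI / 2)) as (s0 & Hs0 & Js0); try lra.
    { intros t Ht. apply continuity_pt_opp, continuity_pt_filterlim.
      apply @ex_derive_continuous. eexists. apply DJ. lra. }
    assert (Js : J s0 = 0) by lra.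
    assert (S0 : 0 < s0 < PI / 2).
    { split; [lra|]. destruct (Req_dec s0 (PI / 2)) as [E|]; [rewrite E in Js|]; lra. }
    assert (F0 : F1' s0 = 0) by (unfold F1'; rewrite Js; unfold Rdiv; ring).
    assert (Max : forall t, 0 < t <= PI / 2 -> F1 t <= F1 s0).
    { intros t Ht. destruct (Rle_dec s0 t); [apply Dec; lra|].
      assert (- F1 s0 <= - F1 t); [|lra].
      apply decreasing_of_derive with (f := fun t => - F1 t) (df := fun t => - F1' t); [lra| |].
      - intros u Hu. apply @is_derive_opp, DF. lra.
      - intros u Hu. destruct (HY u) as [Yu _]; [lra|]. unfold F1'.
        assert (J s0 <= J u) by (apply Jmon; lra).
        assert (0 < / (Y u * Y u)) by (apply Rinv_0_lt_compat; nra). unfold Rdiv. nra. }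
    apply (Finish (pw s0 (fun _ => F1 s0) F1) (pw s0 (fun _ => 0) F1')).
    + intros t Ht. split; [|split].
      * apply pw_derive; auto; intros. apply @is_derive_const. apply DF; lra.
      * apply pw_continuous; auto; intros. apply continuous_const. apply CF1'; lra.
      * destruct (Rle_dec t s0).
        (* On the constant part the inequality reads 0 <= cos t F - kap^2 - F^2. It is an equality
           at [s0], where F1' vanishes, and persists for t <= s0 because the cosine is larger there
           and F >= 0. *)
        -- rewrite !pw_left by auto. rewrite Rmult_0_r.
           pose proof (Ricc s0 ltac:(lra)) as R0. rewrite F0, Rmult_0_r in R0.
           assert (cos s0 <= cos t) by (apply cos_decr_1; lra).
           pose proof (F1p s0 ltac:(lra)). nra.
        -- rewrite !pw_right by (auto; lra). rewrite Ricc; lra.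
    + intros s t H1 H2 H3 H4. destruct (Rle_dec s s0).
      * rewrite pw_left by auto. apply Max. lra.
      * rewrite pw_right by (auto; lra). apply Dec; auto.
        rewrite <- Js. apply Jmon; lra.
Qed.

Lemma hardy_ineq_E_of_positive_solution (b g kap e : R) (Y Y1 : R -> R) :
  0 < g -> g <= PI -> PI <= b -> b <= 2 * PI -> 0 < kap <= 1 / 2 -> 0 < e -> e < 1 / 4 ->
  angular_solution b kap Y Y1 -> (forall t, 0 < t < b -> 0 < Y t) ->
  hardy_ineq (E b g) (kap ^ 2 * (1 - 2 * e) ^ 2).
Proof.
  intros G1 G2 B1 B2 Hk He1 He2 (H1 & H2 & H3) HY. pose proof PI_RGT_0 as HPI.
  assert (Tp : forall u, 0 <= u -> u <= PI / 2 -> 0 <= tan (kap * u)).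
  { intros u U1 U2. destruct (Req_dec u 0) as [-> | U]; [rewrite Rmult_0_r, tan_0; lra|].
    left. apply tan_gt_0; nra. }
  assert (L0 : Y1 (PI / 2) / Y (PI / 2) = kap * tan (kap * (b / 2 - PI / 2))).
  { destruct (H3 (PI / 2)) as [P ->]; try lra. field. lra. }
  destruct (decreasing_majorant kap Y Y1) as [Yp (k2 & k2' & K1 & K2)].
  - lra.
  - destruct (H3 (PI / 2)) as [P ->]; try lra.
    apply Rmult_le_pos; [|lra]. apply Rmult_le_pos; [lra|]. apply Tp; lra.
  - intros t Ht. split; [apply HY; lra|]. rewrite <- (sfun_left b t) by lra. apply H1. lra.
  - apply hardy_ineq_E_of_ground_states with (k := fun t => Y1 t / Y t)
      (k' := fun t => - (kap ^ 2 / sfun b t ^ 2) - (Y1 t / Y t) ^ 2) (k2 := k2) (k2' := k2'); auto.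
    + nra.
    + intros t Ht. destruct (H1 t Ht) as [D0 D1]. specialize (HY t Ht).
      destruct (sfun_bounds b t B1 Ht) as [S0 _].
      assert (D : is_derive (fun t => Y1 t / Y t) t (- (kap ^ 2 / sfun b t ^ 2) - (Y1 t / Y t) ^ 2)).
      { evar_last. apply is_derive_div; [exact D1 | exact D0 | lra]. field. lra. }
      split; [exact D|]. split; [|lra].
      apply (@continuous_minus R_UniformSpace R_AbsRing R_NormedModule
        (fun t => - (kap ^ 2 / sfun b t ^ 2)) (fun t => (Y1 t / Y t) ^ 2)).
      * apply @ex_derive_continuous.
        apply (ex_derive_comp (fun u => - (kap ^ 2 / u ^ 2)) (sfun b)).
        -- auto_derive. nra.
        -- eexists. now apply sfun_derive.
      * apply @ex_derive_continuous.
        apply (ex_derive_comp (fun u => u ^ 2) (fun t => Y1 t / Y t)).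
        -- auto_derive. auto.
        -- eexists. exact D.
    + split; [|split].
      * intros s t S1 S2 S3 S4. split; [|now apply K2].
        assert (0 < sin t) by (apply sin_gt_0; lra).
        apply Rmult_le_pos; [lra|]. apply Rmult_le_pos; [apply Yp; lra|].
        left; apply Rinv_0_lt_compat, HY; lra.
      * intros s t S1 S2 S3 S4.
        assert (Kt : Y1 t / Y t = kap * tan (kap * (b / 2 - t))).
        { destruct (H3 t) as [P ->]; try lra. field. lra. }
        (* The majorant at [s] dominates the value at PI / 2, which is kap tan (kap v); from there
           to b / 2 the quotient Y1 / Y only decreases. *)
        pose proof (K2 s (PI / 2) S1 S2 ltac:(lra) ltac:(lra)) as M. rewrite sin_PI2, Rmult_1_l, L0 in M.
        rewrite Kt. set (F := sin s * k2 s) in *.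
        set (u := b / 2 - t). set (v := b / 2 - PI / 2) in *.
        assert (Uv : 0 <= u <= v) by (unfold u, v; lra). assert (V2 : v <= PI / 2) by (unfold v; lra).
        assert (Tu : 0 <= tan (kap * u)) by (apply Tp; lra).
        assert (Tv : 0 <= tan (kap * v)) by (apply Tp; lra).
        assert (Tuv : v * tan (kap * u) <= u * tan (kap * v)).
        { apply Rmult_le_reg_l with kap; [lra|].
          rewrite <- !Rmult_assoc. apply tan_star_shaped; nra. }
        assert (Mon : tan (kap * u) <= tan (kap * v)).
        { destruct (Req_dec u v) as [-> | N]; [lra|]. left. apply tan_increasing; nra. }
        assert (Ku : 0 <= kap * tan (kap * u)) by (apply Rmult_le_pos; lra).
        assert (Kuv : kap * tan (kap * u) <= kap * tan (kap * v)) by (apply Rmult_le_compat_l; lra).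
        split; [split; lra|].
        (* PI / 2 and PI - t exceed v and u by the same nonnegative amount PI - b / 2, so
           star-shapedness and monotonicity of the tangent add up. *)
        assert (Fin : kap * tan (kap * u) * (PI / 2) <= kap * tan (kap * v) * (PI - t)).
        { replace (PI / 2) with (v + (PI - b / 2)) by (unfold v; field).
          replace (PI - t) with (u + (PI - b / 2)) by (unfold u; field).
          assert (kap * (v * tan (kap * u)) <= kap * (u * tan (kap * v))) by (apply Rmult_le_compat_l; lra).
          assert ((PI - b / 2) * (kap * tan (kap * u)) <= (PI - b / 2) * (kap * tan (kap * v))) by (apply Rmult_le_compat_l; lra).
          lra. }
        apply Rmult_le_reg_r with (PI / 2); [lra|].
        replace (F * (2 * (PI - t) / PI) * (PI / 2)) with (F * (PI - t)) by (field; lra).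
        eapply Rle_trans; [exact Fin|]. apply Rmult_le_compat_r; lra.
      * intros t Ht. destruct (H2 t Ht) as [-> ->]. field. apply Rgt_not_eq, HY; auto.
Qed.

(** * The one-dimensional Hardy inequality *)

Definition zext (b : R) (f : pt -> R) (z : pt) : R :=
  if excluded_middle_informative (in_sector b z) then f z else 0.

Lemma zext_in (b : R) (f : pt -> R) (z : pt) : in_sector b z -> zext b f z = f z.
Proof. intros H. unfold zext. destruct excluded_middle_informative; tauto. Qed.

Lemma zext_out (b : R) (f : pt -> R) (z : pt) : ~ in_sector b z -> zext b f z = 0.
Proof. intros H. unfold zext. destruct excluded_middle_informative; tauto. Qed.

(** The box p <= theta <= b - p, |ln r| <= m, written without angle and logarithm so that it is
    meaningful, and closed, in the whole plane. *)
Definition polar_box (b p m : R) (z : pt) : Prop :=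
  cos (b / 2 - p) * rad z <= axial b z /\ exp (- m) <= rad z <= exp m.

Lemma polar_box_closed (b p m : R) (z : pt) :
  ~ polar_box b p m z -> locally z (fun w => ~ polar_box b p m w).
Proof.
  intros H. assert (C : continuous (fun w => cos (b / 2 - p) * rad w) z).
  { apply continuous_Rmult; [apply continuous_const | apply continuous_rad]. }
  destruct (Rlt_dec (axial b z) (cos (b / 2 - p) * rad z)) as [K | K].
  - pose proof (locally_lt _ _ z (continuous_lin _ _ _ z : continuous (axial b) z) C K) as L.
    eapply filter_imp; [|exact L]. intros w Hw [Q _]. exact (Rlt_not_le _ _ Hw Q).
  - destruct (Rlt_dec (rad z) (exp (- m))) as [K2 | K2].
    + pose proof (locally_lt _ _ z (continuous_rad z) (continuous_const (exp (- m)) z) K2) as L.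
      eapply filter_imp; [|exact L]. intros w Hw [_ [Q _]]. exact (Rlt_not_le _ _ Hw Q).
    + destruct (Rlt_dec (exp m) (rad z)) as [K3 | K3].
      * pose proof (locally_lt _ _ z (continuous_const (exp m) z) (continuous_rad z) K3) as L.
        eapply filter_imp; [|exact L]. intros w Hw [_ [_ Q]]. exact (Rlt_not_le _ _ Hw Q).
      * exfalso. apply H. unfold polar_box. lra.
Qed.

Lemma polar_box_sector (b p m : R) (z : pt) :
  b <= 2 * PI -> 0 < p -> p < b / 2 -> polar_box b p m z -> in_sector b z.
Proof.
  intros Hb H1 H2 [K1 [K2 _]]. pose proof (exp_pos (- m)).
  assert (cos (b / 2) < cos (b / 2 - p)) by (apply cos_decreasing_1; lra).
  unfold in_sector. nra.
Qed.

Lemma not_polar_box (b p m : R) (z : pt) :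
  PI <= b -> b <= 2 * PI -> 0 < p -> p < b / 2 -> in_sector b z -> ~ polar_box b p m z ->
  (ang b z < p \/ b - p < ang b z) \/ (ln (rad z) < - m \/ m < ln (rad z)).
Proof.
  intros B1 B2 H1 H2 Hz N. destruct (in_sector_pos b z Hz) as [Hr Hp].
  destruct (ang_spec b z Hp) as (_ & A & _).
  apply NNPP. intros K. apply N. split; [|split].
  - rewrite A, Rmult_comm. apply Rmult_le_compat_l; [lra|].
    destruct (Req_dec (Rabs (ang b z - b / 2)) (b / 2 - p)) as [E | E].
    + right. unfold Rabs in E. destruct Rcase_abs; rewrite <- E; auto. apply cos_neg.
    + left. apply cos_lt_cos_abs; [|lra].
      assert (Rabs (ang b z - b / 2) <= b / 2 - p) by (apply Rabs_le; lra). lra.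
  - rewrite <- (exp_ln (rad z)) by auto. apply Rnot_lt_le. intros L. apply exp_lt_inv in L. lra.
  - rewrite <- (exp_ln (rad z)) by auto. apply Rnot_lt_le. intros L. apply exp_lt_inv in L. lra.
Qed.

Definition vanishes_off (b p m : R) (f : pt -> R) : Prop :=
  forall z, in_sector b z -> ~ polar_box b p m z -> f z = 0.

Section PolarBox.
Context (b p m : R) (B1 : PI <= b) (B2 : b <= 2 * PI) (P1 : 0 < p) (P2 : p < b / 2).

Lemma zext_off (f : pt -> R) (z : pt) :
  vanishes_off b p m f -> ~ polar_box b p m z -> zext b f z = 0.
Proof.
  intros H N. destruct (classic (in_sector b z)) as [S | S].
  - rewrite zext_in by auto. now apply H.
  - now apply zext_out.
Qed.

Lemma zext_locally_zero (f : pt -> R) (z : pt) :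
  vanishes_off b p m f -> ~ in_sector b z -> locally z (fun w => 0 = zext b f w).
Proof.
  intros H N. assert (K : ~ polar_box b p m z) by (intros K; apply N; now apply polar_box_sector with p m).
  eapply filter_imp; [|exact (polar_box_closed b p m z K)]. intros w Hw. symmetry. now apply zext_off.
Qed.

Lemma zext_continuous (f : pt -> R) :
  (forall z, in_sector b z -> continuous f z) -> vanishes_off b p m f ->
  forall z, continuous (zext b f) z.
Proof.
  intros Hc H z. destruct (classic (in_sector b z)) as [S | S].
  - eapply continuous_ext_loc; [|exact (Hc z S)].
    eapply filter_imp; [|exact (in_sector_open b z S)]. intros w Hw. symmetry. now apply zext_in.
  - eapply continuous_ext_loc; [exact (zext_locally_zero f z H S)|]. apply continuous_const.
Qed.

Lemma zext_box (f : pt -> R) : vanishes_off b p m f -> box_supported (exp m) (zext b f).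
Proof.
  intros H x y Hxy. apply zext_off; auto. intros [_ [_ K]].
  pose proof (fst_le_rad (x, y)) as F. simpl in F. unfold Rabs in Hxy.
  destruct Hxy as [Hxy | Hxy]; destruct Rcase_abs in Hxy; lra.
Qed.

Lemma vanishes_derivative (f fx fy : pt -> R) :
  (forall z, in_sector b z -> PD f fx fy z) -> vanishes_off b p m f ->
  vanishes_off b p m fx /\ vanishes_off b p m fy.
Proof.
  intros HD H.
  assert (K : forall z, in_sector b z -> ~ polar_box b p m z -> fx z = 0 /\ fy z = 0).
  { intros z S N. apply derivative_zero_loc with f; auto.
    eapply filter_imp; [|exact (filter_and _ _ (in_sector_open b z S) (polar_box_closed b p m z N))].
    intros w [Hw1 Hw2]. now apply H. }
  split; intros z S N; now apply K.
Qed.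

Lemma zext_PD (f fx fy : pt -> R) :
  (forall z, in_sector b z -> PD f fx fy z) -> vanishes_off b p m f ->
  forall z, PD (zext b f) (zext b fx) (zext b fy) z.
Proof.
  intros HD H z. destruct (vanishes_derivative f fx fy HD H) as [Hx Hy].
  destruct (classic (in_sector b z)) as [S | S].
  - eapply PD_ext_loc; [|exact (HD z S)].
    eapply filter_imp; [|exact (in_sector_open b z S)]. intros w Hw. rewrite !zext_in by auto. auto.
  - eapply PD_ext_loc; [|exact (PD_const 0 z)].
    eapply filter_imp; [|exact (filter_and _ _ (zext_locally_zero f z H S)
      (filter_and _ _ (zext_locally_zero fx z Hx S) (zext_locally_zero fy z Hy S)))].
    intros w (A & A1 & A2). auto.
Qed.

Lemma zext_divergence (f1 f1x f1y f2 f2x f2y j : pt -> R) (N : R) :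
  (forall z, in_sector b z -> PD f1 f1x f1y z) -> (forall z, in_sector b z -> PD f2 f2x f2y z) ->
  vanishes_off b p m f1 -> vanishes_off b p m f2 ->
  (forall z, in_sector b z -> f1x z + f2y z = j z) -> exp m < N -> iint N (zext b j) = 0.
Proof.
  intros D1 D2 V1 V2 Hj HN.
  pose proof (zext_PD f1 f1x f1y D1 V1) as E1. pose proof (zext_PD f2 f2x f2y D2 V2) as E2.
  replace (zext b j) with (fun z => zext b f1x z + 1 * zext b f2y z).
  - destruct (iint_linear N 1 (zext b f1x) (zext b f2y)) as [_ ->].
    + apply box_integrable_continuous. intros z. apply (E1 z).
    + apply box_integrable_continuous. intros z. apply (E2 z).
    + rewrite (iint_partial_x N (exp m) (zext b f1)), (iint_partial_y N (exp m) (zext b f2)); try ring;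
        try apply exp_pos; auto using zext_box.
      * intros x y. exact (proj1 (proj2 (E2 (x, y)))).
      * intros z. apply (E2 z).
      * intros x y. exact (proj1 (E1 (x, y))).
      * intros z. apply (E1 z).
      * intros z. apply (E1 z).
  - apply functional_extensionality. intros z. destruct (classic (in_sector b z)) as [S | S].
    + rewrite !zext_in by auto. rewrite <- Hj by auto. ring.
    + rewrite !zext_out by auto. ring.
Qed.

End PolarBox.

Lemma PD_ln_rad (b : R) (z : pt) : in_sector b z ->
  PD (fun w => ln (rad w)) (fun w => fst w / rad w ^ 2) (fun w => snd w / rad w ^ 2) z.
Proof.
  intros Hz. destruct (in_sector_pos b z Hz) as [Hr _].
  eapply PD_ext_loc; [|apply (PD_comp ln Rinv rad (fun w => fst w / rad w) (fun w => snd w / rad w) z)].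
  - eapply filter_imp; [|exact (in_sector_open b z Hz)]. intros w Hw.
    destruct (in_sector_pos b w Hw) as [Hr' _]. split; [reflexivity|]. split.
    + field. lra.
    + field. lra.
  - now apply is_derive_ln.
  - apply @ex_derive_continuous. auto_derive. lra.
  - now apply PD_rad.
Qed.

Lemma PD_inv_rad2 (b : R) (z : pt) : in_sector b z ->
  PD (fun w => / rad w ^ 2) (fun w => -2 * (fst w / rad w ^ 4)) (fun w => -2 * (snd w / rad w ^ 4)) z.
Proof.
  intros Hz. destruct (in_sector_pos b z Hz) as [Hr _].
  assert (N : rad z * rad z <> 0) by nra.
  eapply PD_ext_loc; [|exact (PD_inv _ _ _ z N (PD_mult _ _ _ _ _ _ z (PD_rad z Hr) (PD_rad z Hr)))].
  - eapply filter_imp; [|exact (in_sector_open b z Hz)]. intros w Hw.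
    destruct (in_sector_pos b w Hw) as [Hr' _]. simpl.
    split; [f_equal; ring|]. split; field; lra.
Qed.

(** In the coordinates ln r and theta the area element is r^2, so the plane integral of [jf] would
    be the product of the integrals of h and g. *)
Definition jf (b : R) (h g : R -> R) (z : pt) : R := h (ln (rad z)) * g (ang b z) / rad z ^ 2.

Definition off (p q : R) (f : R -> R) : Prop := forall t, t < p \/ q < t -> f t = 0.

Lemma product_vanishes (b p m : R) (h g : R -> R) (k : pt -> R) :
  PI <= b -> b <= 2 * PI -> 0 < p -> p < b / 2 -> off (- m) m h -> off p (b - p) g ->
  vanishes_off b p m (fun z => h (ln (rad z)) * g (ang b z) * k z).
Proof.
  intros B1 B2 P1 P2 Hh Hg z S N. destruct (not_polar_box b p m z B1 B2 P1 P2 S N) as [K | K].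
  - rewrite (Hg _ K). ring.
  - rewrite (Hh _ K). ring.
Qed.

Lemma jf_vanishes (b p m : R) (h g : R -> R) :
  PI <= b -> b <= 2 * PI -> 0 < p -> p < b / 2 -> off (- m) m h -> off p (b - p) g ->
  vanishes_off b p m (jf b h g).
Proof. intros. now apply product_vanishes with (k := fun z => / rad z ^ 2). Qed.

Lemma jf_continuous (b p m : R) (h g : R -> R) :
  PI <= b -> b <= 2 * PI -> 0 < p -> p < b / 2 -> off (- m) m h -> off p (b - p) g ->
  (forall t, continuous h t) -> (forall t, 0 < t < b -> continuous g t) ->
  forall z, continuous (zext b (jf b h g)) z.
Proof.
  intros B1 B2 P1 P2 Hh Hg Ch Cg. apply zext_continuous with p m; auto.
  - intros z S. apply continuous_Rmult; [apply continuous_Rmult|].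
    + apply (continuous_comp (fun w => ln (rad w)) h); auto. apply (PD_ln_rad b z S).
    + apply (continuous_comp (ang b) g). apply (PD_ang b z S). apply Cg. now apply in_sector_ang.
    + now apply (PD_inv_rad2 b z).
  - now apply jf_vanishes.
Qed.

Lemma PD_polar_product (b : R) (h h1 g g1 : R -> R) (z : pt) :
  in_sector b z -> (forall t, is_derive h t (h1 t) /\ continuous h1 t) ->
  (is_derive g (ang b z) (g1 (ang b z)) /\ continuous g1 (ang b z)) ->
  PD (fun w => h (ln (rad w)) * g (ang b w))
     (fun w => h1 (ln (rad w)) * (fst w / rad w ^ 2) * g (ang b w) + h (ln (rad w)) * (g1 (ang b w) * (- snd w / rad w ^ 2)))
     (fun w => h1 (ln (rad w)) * (snd w / rad w ^ 2) * g (ang b w) + h (ln (rad w)) * (g1 (ang b w) * (fst w / rad w ^ 2))) z.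
Proof.
  intros S Hh [Hg1 Hg2]. apply PD_mult.
  - apply PD_comp; try apply Hh. now apply (PD_ln_rad b).
  - apply PD_comp; auto. now apply PD_ang.
Qed.

(* Without polar coordinates: the integral of h(ln r) g(theta) / r^2 vanishes as soon as h or g has
   zero mean, since the integrand is then the divergence of a compactly supported field. *)
Lemma jf_angular_zero (b p m N : R) (h h1 G G1 : R -> R) :
  PI <= b -> b <= 2 * PI -> 0 < p -> p < b / 2 -> off (- m) m h -> off p (b - p) G ->
  (forall t, is_derive h t (h1 t) /\ continuous h1 t) ->
  (forall t, 0 < t < b -> is_derive G t (G1 t) /\ continuous G1 t) ->
  exp m < N -> iint N (zext b (jf b h G1)) = 0.
Proof.
  intros B1 B2 P1 P2 Hh HG Dh DG HN.
  pose (A := fun w => h (ln (rad w)) * G (ang b w)).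
  eapply (zext_divergence b p m B2 P1 P2 (fun w => A w * ((0 * fst w + -1 * snd w + 0) * / rad w ^ 2)) _ _
    (fun w => A w * ((1 * fst w + 0 * snd w + 0) * / rad w ^ 2)) _ _ (jf b h G1) N); auto.
  - intros z S. apply PD_mult.
    apply PD_polar_product; auto. apply DG; now apply in_sector_ang.
    apply PD_mult; [apply PD_lin | now apply (PD_inv_rad2 b)].
  - intros z S. apply PD_mult.
    apply PD_polar_product; auto. apply DG; now apply in_sector_ang.
    apply PD_mult; [apply PD_lin | now apply (PD_inv_rad2 b)].
  - apply product_vanishes; auto.
  - apply product_vanishes; auto.
  - intros z S. destruct (in_sector_pos b z S) as [Hr _]. pose proof (rad_sqr z) as Q.
    unfold A, jf. cbv beta.
    transitivity (h (ln (rad z)) * G1 (ang b z) * (fst z ^ 2 + snd z ^ 2) / rad z ^ 4).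
    field; lra. rewrite <- Q. field; lra.
Qed.

Lemma jf_radial_zero (b p m N : R) (H H1 g g1 : R -> R) :
  PI <= b -> b <= 2 * PI -> 0 < p -> p < b / 2 -> off (- m) m H -> off p (b - p) g ->
  (forall t, is_derive H t (H1 t) /\ continuous H1 t) ->
  (forall t, 0 < t < b -> is_derive g t (g1 t) /\ continuous g1 t) ->
  exp m < N -> iint N (zext b (jf b H1 g)) = 0.
Proof.
  intros B1 B2 P1 P2 Hh HG Dh DG HN.
  pose (A := fun w => H (ln (rad w)) * g (ang b w)).
  eapply (zext_divergence b p m B2 P1 P2 (fun w => A w * ((1 * fst w + 0 * snd w + 0) * / rad w ^ 2)) _ _
    (fun w => A w * ((0 * fst w + 1 * snd w + 0) * / rad w ^ 2)) _ _ (jf b H1 g) N); auto.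
  - intros z S. apply PD_mult.
    apply PD_polar_product; auto. apply DG; now apply in_sector_ang.
    apply PD_mult; [apply PD_lin | now apply (PD_inv_rad2 b)].
  - intros z S. apply PD_mult.
    apply PD_polar_product; auto. apply DG; now apply in_sector_ang.
    apply PD_mult; [apply PD_lin | now apply (PD_inv_rad2 b)].
  - apply product_vanishes; auto.
  - apply product_vanishes; auto.
  - intros z S. destruct (in_sector_pos b z S) as [Hr _]. pose proof (rad_sqr z) as Q.
    unfold A, jf. cbv beta.
    transitivity (H1 (ln (rad z)) * g (ang b z) * (fst z ^ 2 + snd z ^ 2) / rad z ^ 4
      + 2 * H (ln (rad z)) * g (ang b z) * (rad z ^ 2 - (fst z ^ 2 + snd z ^ 2)) / rad z ^ 4).
    field; lra. rewrite <- Q. field; lra.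
Qed.

(** * Smooth test functions of product form *)

Definition tower (F : nat -> R -> R) : Prop := forall n t, is_derive (F n) t (F (S n) t).

Lemma tower_continuous (F : nat -> R -> R) : tower F -> forall n t, continuous (F n) t.
Proof. intros H n t. apply @ex_derive_continuous. eexists. apply H. Qed.

Lemma tower_off (F : nat -> R -> R) (p q : R) : tower F -> off p q (F O) -> forall n, off p q (F n).
Proof.
  intros HF H0. induction n as [|n IH]; auto. intros t Ht.
  assert (L : locally t (fun u => F n u = 0)).
  { destruct Ht as [Ht | Ht].
    - eapply filter_imp; [|exact (locally_below t p Ht)]. intros u Hu. apply IH. now left.
    - eapply filter_imp; [|exact (locally_above t q Ht)]. intros u Hu. apply IH. now right. }
  rewrite <- (is_derive_unique _ _ _ (HF n t)). rewrite (Derive_ext_loc _ (fun _ => 0)); auto.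
  apply Derive_const.
Qed.

(* Iterated partial derivatives of X(ln r) Psi(theta), computed syntactically. *)
Inductive texpr : Type :=
  | TX (n : nat) | TP (n : nat) | Tx | Ty | Ti | Tc (c : R)
  | Tadd (e f : texpr) | Tmul (e f : texpr).

Fixpoint teval (b : R) (X Ps : nat -> R -> R) (e : texpr) (z : pt) : R :=
  match e with
  | TX n => X n (ln (rad z))
  | TP n => Ps n (ang b z)
  | Tx => fst z
  | Ty => snd z
  | Ti => / rad z ^ 2
  | Tc c => c
  | Tadd e f => teval b X Ps e z + teval b X Ps f z
  | Tmul e f => teval b X Ps e z * teval b X Ps f z
  end.

Fixpoint tderiv (d : bool) (e : texpr) : texpr :=
  match e with
  | TX n => Tmul (TX (S n)) (Tmul (if d then Tx else Ty) Ti)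
  | TP n => Tmul (TP (S n)) (if d then Tmul (Tc (-1)) (Tmul Ty Ti) else Tmul Tx Ti)
  | Tx => Tc (if d then 1 else 0)
  | Ty => Tc (if d then 0 else 1)
  | Ti => Tmul (Tc (-2)) (Tmul (if d then Tx else Ty) (Tmul Ti Ti))
  | Tc _ => Tc 0
  | Tadd e f => Tadd (tderiv d e) (tderiv d f)
  | Tmul e f => Tadd (Tmul (tderiv d e) f) (Tmul e (tderiv d f))
  end.

Lemma teval_PD (b : R) (X Ps : nat -> R -> R) (e : texpr) (z : pt) :
  tower X -> tower Ps -> in_sector b z ->
  PD (teval b X Ps e) (teval b X Ps (tderiv true e)) (teval b X Ps (tderiv false e)) z.
Proof.
  intros HX HP Hz.
  assert (L : locally z (fun w => in_sector b w)) by exact (in_sector_open b z Hz).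
  induction e as [n|n| | | |c|e IHe f IHf|e IHe f IHf].
  - eapply PD_ext_loc; [|apply (PD_comp (X n) (X (S n)) _ _ _ z (HX n _) (tower_continuous X HX _ _) (PD_ln_rad b z Hz))].
    apply filter_forall. intros w. simpl. repeat split.
  - eapply PD_ext_loc; [|apply (PD_comp (Ps n) (Ps (S n)) _ _ _ z (HP n _) (tower_continuous Ps HP _ _) (PD_ang b z Hz))].
    apply filter_forall. intros w. simpl. unfold Rdiv. repeat split. f_equal. ring.
  - apply PD_fst.
  - apply PD_snd.
  - eapply PD_ext_loc; [|exact (PD_inv_rad2 b z Hz)].
    eapply filter_imp; [|exact L]. intros w Hw. destruct (in_sector_pos b w Hw) as [Hr' _].
    simpl. split; [reflexivity|]. split; field; lra.
  - apply PD_const.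
  - apply (PD_plus _ _ _ _ _ _ z IHe IHf).
  - apply (PD_mult _ _ _ _ _ _ z IHe IHf).
Qed.

Fixpoint tword (w : list bool) : texpr :=
  match w with
  | nil => Tmul (TX O) (TP O)
  | d :: w => tderiv d (tword w)
  end.

Lemma tword_vanishes (b p m : R) (X Ps : nat -> R -> R) (w : list bool) :
  PI <= b -> b <= 2 * PI -> 0 < p -> p < b / 2 -> tower X -> tower Ps ->
  off (- m) m (X O) -> off p (b - p) (Ps O) -> vanishes_off b p m (teval b X Ps (tword w)).
Proof.
  intros B1 B2 P1 P2 HX HP OX OP. induction w as [|d w IH].
  - intros z S N. simpl. destruct (not_polar_box b p m z B1 B2 P1 P2 S N) as [K | K].
    + rewrite (OP _ K). ring.
    + rewrite (OX _ K). ring.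
  - destruct (vanishes_derivative b p m _ _ _ (fun z S => teval_PD b X Ps (tword w) z HX HP S) IH) as [V1 V2].
    now destruct d.
Qed.

Lemma polar_test_function (b p m : R) (X Ps : nat -> R -> R) :
  PI <= b -> b <= 2 * PI -> 0 < p -> p < b / 2 -> tower X -> tower Ps ->
  off (- m) m (X O) -> off p (b - p) (Ps O) ->
  smooth_family (zext b (teval b X Ps (tword nil))) (fun w => zext b (teval b X Ps (tword w))) /\
  compact_support_in (Lambda b) (zext b (teval b X Ps (tword nil))).
Proof.
  intros B1 B2 P1 P2 HX HP OX OP.
  assert (V : forall w, vanishes_off b p m (teval b X Ps (tword w))).
  { intros w. now apply tword_vanishes. }
  assert (D : forall w z, PD (zext b (teval b X Ps (tword w))) (zext b (teval b X Ps (tword (true :: w))))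
     (zext b (teval b X Ps (tword (false :: w)))) z).
  { intros w. apply zext_PD with p m; auto. intros z S. now apply teval_PD. }
  split; [split; auto|].
  - intros w. split; [apply cont2_continuous; intros z; apply (D w z)|].
    split; intros x y; apply is_derive_Reals; apply (D w (x, y)).
  - exists (polar_box b p m). split; [|split; [|split]].
    + intros z Hz. apply locally_edist. now apply polar_box_closed.
    + exists (exp m). intros z [_ [_ H]]. now rewrite <- rad_edist.
    + intros z Hz. apply Lambda_in_sector; auto. now apply polar_box_sector with p m.
    + intros z Hz. now apply zext_off with p m.
Qed.

Lemma RInt_pos_at (f : R -> R) (u v x0 : R) :
  u < x0 < v -> (forall x, continuous f x) -> (forall x, 0 <= f x) -> 0 < f x0 -> 0 < RInt f u v.
Proof.
  intros Hx Hc Hf H0.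
  assert (L : locally x0 (fun x => 0 < f x)) by (apply (Hc x0 (fun y => 0 < y)); apply (open_gt 0); auto).
  destruct L as [d Hd]. pose proof (cond_pos d) as Dp.
  set (w := x0 + Rmin (d / 2) ((v - x0) / 2)).
  pose proof (Rmin_l (d / 2) ((v - x0) / 2)). pose proof (Rmin_r (d / 2) ((v - x0) / 2)).
  assert (0 < Rmin (d / 2) ((v - x0) / 2)) by (apply Rmin_pos; lra).
  assert (Ex : forall s t, ex_RInt f s t) by (intros; apply @ex_RInt_continuous; auto).
  rewrite <- (RInt_Chasles f u x0 v), <- (RInt_Chasles f x0 w v) by auto.
  assert (0 <= RInt f u x0) by (apply RInt_ge_0; auto; lra).
  assert (0 <= RInt f w v) by (apply RInt_ge_0; auto; unfold w; lra).
  assert (0 < RInt f x0 w).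
  { apply RInt_gt_0; auto. unfold w; lra. intros x Hx'. apply Hd. change (Rabs (x - x0) < d).
    unfold w in Hx'. apply Rabs_def1; lra. }
  unfold plus; simpl. lra.
Qed.

Lemma iint_pos_at (f : pt -> R) (M : R) (z : pt) :
  Rabs (fst z) < M -> Rabs (snd z) < M -> (forall w, continuous f w) -> (forall w, 0 <= f w) ->
  0 < f z -> 0 < iint M f.
Proof.
  intros H1 H2 Hc Hf H0. apply Rabs_def2 in H1, H2. destruct z as [x y]. simpl in *.
  apply RInt_pos_at with x; try lra.
  - intros t. now apply continuous_RInt_param.
  - intros t. apply RInt_ge_0; auto; [lra|]. apply @ex_RInt_continuous. intros s _. apply continuous_slice_y, Hc.
  - apply RInt_pos_at with y; auto; try lra. intros t. apply continuous_slice_y, Hc.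
Qed.

Lemma RInt_zero_on (f : R -> R) (u v : R) :
  (forall x, Rmin u v < x < Rmax u v -> f x = 0) -> RInt f u v = 0.
Proof.
  intros H. rewrite (RInt_ext _ (fun _ => 0)) by auto. rewrite RInt_const.
  unfold scal; simpl; unfold mult; simpl; ring.
Qed.

(** Zero mean brings the antiderivative back to 0 beyond q; this supplies the compactly supported
    potentials of [jf_angular_zero] and [jf_radial_zero]. *)
Lemma antiderivative_off (f : R -> R) (u v p q : R) :
  (forall t, continuous f t) -> off p q f -> u <= p -> p <= q -> q <= v -> RInt f u v = 0 ->
  (forall t, is_derive (fun t => RInt f u t) t (f t)) /\ off p q (fun t => RInt f u t).
Proof.
  intros Hc Hf H1 H2 H3 H0.
  assert (Ex : forall s t, ex_RInt f s t) by (intros; apply @ex_RInt_continuous; auto).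
  split.
  - intros t. apply (is_derive_RInt f (fun t => RInt f u t) u t); auto.
    apply filter_forall. intros x. apply @RInt_correct; auto.
  - intros t [Ht | Ht].
    + apply RInt_zero_on. intros x Hx. apply Hf. left.
      apply Rlt_le_trans with (1 := proj2 Hx). apply Rmax_lub; lra.
    + assert (Z : RInt f v t = 0).
      { apply RInt_zero_on. intros x Hx. apply Hf. right.
        apply Rle_lt_trans with (2 := proj1 Hx). apply Rmin_glb; lra. }
      rewrite <- (RInt_Chasles f u v t), H0, Z by auto. unfold plus; simpl; ring.
Qed.

Lemma continuous_sqr (f : R -> R) (t : R) : continuous f t -> continuous (fun t => f t ^ 2) t.
Proof.
  intros H. apply (continuous_comp f (fun u => u ^ 2)); auto.
  apply @ex_derive_continuous. auto_derive. auto.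
Qed.

Lemma continuous_lincomb (f g : R -> R) (c t : R) :
  continuous f t -> continuous g t -> continuous (fun t => f t + c * g t) t.
Proof.
  intros Hf Hg. apply (@continuous_plus R_UniformSpace R_AbsRing R_NormedModule f (fun t => c * g t)); auto.
  apply (@continuous_scal_r R_UniformSpace R_AbsRing R_NormedModule c g); auto.
Qed.

Lemma hardy_weight_continuous (b p : R) (f : R -> R) :
  PI <= b -> 0 < p -> (forall t, continuous f t) -> off p (b - p) f ->
  forall t, continuous (fun t => f t / sfun b t ^ 2) t.
Proof.
  intros B1 P1 Hc Hf t.
  assert (Z : t <= 0 \/ b <= t -> continuous (fun t => f t / sfun b t ^ 2) t).
  { intros Ht. apply continuous_ext_loc with (fun _ => 0); [|apply continuous_const].
    destruct Ht as [Ht | Ht].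
    - eapply filter_imp; [|apply (locally_below t p); lra]. intros u Hu. rewrite Hf by (now left).
      symmetry. apply Rmult_0_l.
    - eapply filter_imp; [|apply (locally_above t (b - p)); lra]. intros u Hu. rewrite Hf by (now right).
      symmetry. apply Rmult_0_l. }
  destruct (Rle_dec t 0); [apply Z; auto|]. destruct (Rle_dec b t); [apply Z; auto|].
  destruct (sfun_bounds b t B1) as [S0 _]; [lra|].
  apply (@continuous_mult R_UniformSpace R_AbsRing f (fun t => / sfun b t ^ 2)); auto.
  apply @ex_derive_continuous. apply (ex_derive_comp (fun u => / u ^ 2) (sfun b)).
  - auto_derive. nra.
  - exists (sder b t). now apply sfun_derive.
Qed.

Definition hardy_form (b c : R) (f f1 : R -> R) : R :=
  RInt (fun t => f1 t ^ 2 + - c * (f t ^ 2 / sfun b t ^ 2)) 0 b.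

Lemma tower_scale (X : nat -> R -> R) (N : R) : 0 < N -> tower X ->
  tower (fun n t => / N ^ n * X n (t / N)).
Proof.
  intros HN HX n t.
  evar_last.
  - apply @is_derive_scal. apply (is_derive_comp (X n) (fun t => t / N)). apply HX. auto_derive; auto.
  - unfold scal; simpl; unfold mult; simpl. field. split; try apply pow_nonzero; lra.
Qed.

Lemma RInt_dilate (f : R -> R) (N : R) : 0 < N -> (forall t, continuous f t) ->
  RInt (fun t => f (t / N)) (- (2 * N)) (2 * N) = N * RInt f (-2) 2.
Proof.
  intros HN Hc.
  assert (Q : is_RInt (fun t => scal (/ N) (f (/ N * t + 0))) (- (2 * N)) (2 * N) (RInt f (-2) 2)).
  { apply (is_RInt_comp_lin f (/ N) 0).
    replace (/ N * - (2 * N) + 0) with (-2) by (field; lra).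
    replace (/ N * (2 * N) + 0) with 2 by (field; lra).
    apply @RInt_correct, @ex_RInt_continuous; auto. }
  apply is_RInt_unique. apply (is_RInt_scal _ _ _ N) in Q.
  eapply is_RInt_ext; [|exact Q]. intros t _. unfold scal; simpl; unfold mult; simpl.
  replace (/ N * t + 0) with (t / N) by (field; lra). field. lra.
Qed.

(** The Hardy inequality for X(ln r / N) Ps(theta), divided by [J0], the integral of the square of
    this function over r^2. The radial energy and the angular form are each a multiple of [J0],
    since subtracting the right multiple leaves a factor of zero mean. Stretching X by N leaves 1 /
    N^2 in front of the radial energy. *)
Lemma hardy_1d_scaled (b c p N : R) (X Ps : nat -> R -> R) (t0 : R) :
  PI <= b -> b <= 2 * PI -> 0 < p -> p < b / 2 -> 0 < N ->
  tower X -> tower Ps -> off (-1) 1 (X O) -> off p (b - p) (Ps O) -> X O 0 <> 0 -> Ps O t0 <> 0 ->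
  hardy_ineq (Lambda b) c ->
  0 <= / N ^ 2 * (RInt (fun t => X 1%nat t ^ 2) (-2) 2 / RInt (fun t => X O t ^ 2) (-2) 2) +
       hardy_form b c (Ps O) (Ps 1%nat) / RInt (fun t => Ps O t ^ 2) 0 b.
Proof.
  intros B1 B2 P1 P2 HN HX HP OX OP X0 Pt0 HI. pose proof PI_RGT_0 as HPI.
  set (Z := fun n t => / N ^ n * X n (t / N)).
  assert (HZ : tower Z) by now apply tower_scale.
  assert (OZ : off (- N) N (Z O)).
  { intros t Ht. unfold Z. rewrite OX; [ring|].
    destruct Ht as [Ht | Ht]; [left | right]; apply Rmult_lt_reg_r with N; auto;
    unfold Rdiv; rewrite Rmult_assoc, Rinv_l; lra. }
  pose proof (tower_off Z _ _ HZ OZ) as OZn. pose proof (tower_off Ps _ _ HP OP) as OPn.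
  pose proof (tower_continuous Z HZ) as CZ. pose proof (tower_continuous Ps HP) as CP.
  pose proof (tower_continuous X HX) as CX.
  set (A := RInt (fun t => X 1%nat t ^ 2) (-2) 2). set (B := RInt (fun t => X O t ^ 2) (-2) 2).
  set (Q := RInt (fun t => Ps O t ^ 2) 0 b). set (Rr := hardy_form b c (Ps O) (Ps 1%nat)).
  assert (Tb : p <= t0 <= b - p).
  { split; apply Rnot_lt_le; intros K; apply Pt0, OP; auto. }
  assert (HB : 0 < B).
  { apply RInt_pos_at with 0; [lra| | |].
    - intros t. apply continuous_sqr, CX.
    - intros t. apply pow2_ge_0.
    - apply pow2_gt_0; auto. }
  assert (HQ : 0 < Q).
  { apply RInt_pos_at with t0; [lra| | |].
    - intros t. apply continuous_sqr, CP.
    - intros t. apply pow2_ge_0.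
    - apply pow2_gt_0; auto. }
  assert (Sq : forall p q f, off p q f -> off p q (fun t => f t ^ 2)).
  { intros p' q' f Hf t Ht. rewrite Hf by auto. ring. }
  pose (Z2 := fun t => Z O t ^ 2). pose (Zd2 := fun t => Z 1%nat t ^ 2).
  pose (Q2 := fun t => Ps O t ^ 2). pose (Qd2 := fun t => Ps 1%nat t ^ 2).
  pose (W := fun t => Q2 t / sfun b t ^ 2).
  assert (CZ2 : forall t, continuous Z2 t) by (intros; apply continuous_sqr, CZ).
  assert (CZd2 : forall t, continuous Zd2 t) by (intros; apply continuous_sqr, CZ).
  assert (CQ2 : forall t, continuous Q2 t) by (intros; apply continuous_sqr, CP).
  assert (CQd2 : forall t, continuous Qd2 t) by (intros; apply continuous_sqr, CP).
  assert (OZ2 : off (- N) N Z2) by (apply Sq, OZn). assert (OZd2 : off (- N) N Zd2) by (apply Sq, OZn).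
  assert (OQ2 : off p (b - p) Q2) by (apply Sq, OPn). assert (OQd2 : off p (b - p) Qd2) by (apply Sq, OPn).
  assert (CW : forall t, continuous W t) by (apply hardy_weight_continuous with p; auto).
  assert (OW : off p (b - p) W) by (intros t Ht; unfold W; rewrite OQ2 by auto; unfold Rdiv; ring).
  set (M := exp N + 1).
  assert (CJ : forall h g : R -> R, (forall t, continuous h t) -> (forall t, continuous g t) ->
    off (- N) N h -> off p (b - p) g -> forall z, continuous (zext b (jf b h g)) z).
  { intros h g Ch Cg Oh Og. apply jf_continuous with p N; auto. }
  assert (BI : forall h g : R -> R, (forall t, continuous h t) -> (forall t, continuous g t) ->
    off (- N) N h -> off p (b - p) g -> box_integrable M (zext b (jf b h g))).
  { intros h g Ch Cg Oh Og. now apply box_integrable_continuous, CJ. }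
  set (J0 := iint M (zext b (jf b Z2 Q2))).
  assert (HJ0 : 0 < J0).
  { pose (z0 := (1 * cos t0, 1 * sin t0) : pt).
    assert (S0 : in_sector b z0) by (apply polar_in_sector; lra).
    assert (V : zext b (jf b Z2 Q2) z0 = Z2 0 * Q2 t0).
    { rewrite zext_in by auto. unfold jf. unfold z0. rewrite rad_polar, ang_polar, ln_1 by lra. field. }
    assert (R0 : rad z0 = 1) by (unfold z0; apply rad_polar; lra).
    pose proof (fst_le_rad z0) as F. pose proof (exp_pos N).
    apply iint_pos_at with z0.
    - rewrite R0 in F. unfold M. apply Rabs_def1; lra.
    - rewrite R0 in F. unfold M. apply Rabs_def1; lra.
    - apply CJ; auto.
    - intros w. destruct (classic (in_sector b w)) as [S | S]; [|rewrite zext_out by auto; lra].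
      rewrite zext_in by auto. destruct (in_sector_pos b w S) as [Hr _]. unfold jf, Z2, Q2.
      apply Rmult_le_pos; [apply Rmult_le_pos; apply pow2_ge_0|]. left. apply Rinv_0_lt_compat. nra.
    - rewrite V. apply Rmult_lt_0_compat; apply pow2_gt_0; auto. unfold Z. simpl.
      unfold Rdiv. rewrite Rinv_1, !Rmult_1_l, Rmult_0_l. auto. }
  assert (ExN : forall f u v, (forall t : R, continuous f t) -> ex_RInt f u v) by (intros; apply @ex_RInt_continuous; auto).
  assert (Lin : forall (h1 h2 g1 g2 h3 g3 : R -> R) k,
    (forall t, continuous h1 t) -> (forall t, continuous h2 t) -> (forall t, continuous g1 t) -> (forall t, continuous g2 t) ->
    off (- N) N h1 -> off (- N) N h2 -> off p (b - p) g1 -> off p (b - p) g2 ->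
    (forall z, in_sector b z -> jf b h3 g3 z = jf b h1 g1 z + k * jf b h2 g2 z) ->
    iint M (zext b (jf b h3 g3)) = iint M (zext b (jf b h1 g1)) + k * iint M (zext b (jf b h2 g2))).
  { intros h1 h2 g1 g2 h3 g3 k C1 C2 C3 C4 O1 O2 O3 O4 E.
    destruct (iint_linear M k _ _ (BI h1 g1 C1 C3 O1 O3) (BI h2 g2 C2 C4 O2 O4)) as [_ <-].
    f_equal. apply functional_extensionality. intros z. destruct (classic (in_sector b z)) as [S | S].
    - rewrite !zext_in by auto. auto.
    - rewrite !zext_out by auto. ring. }
  assert (Ang : iint M (zext b (jf b Z2 (fun t => Qd2 t + - c * W t))) = Rr / Q * J0).
  (* The multiple of [Q2] is chosen so that [g] has zero mean on (0, b). *)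
  { set (g := fun t => (Qd2 t + - c * W t) + - (Rr / Q) * Q2 t).
    assert (Cg0 : forall t, continuous (fun t => Qd2 t + - c * W t) t) by (intros; now apply continuous_lincomb).
    assert (Cg : forall t, continuous g t) by (intros; now apply continuous_lincomb).
    assert (Og0 : off p (b - p) (fun t => Qd2 t + - c * W t)) by (intros t Ht; rewrite OQd2, OW by auto; ring).
    assert (Og : off p (b - p) g) by (intros t Ht; unfold g; rewrite OQd2, OW, OQ2 by auto; ring).
    assert (Ig : RInt g 0 b = 0).
    { unfold g. rewrite (RInt_plus (fun t => Qd2 t + - c * W t) (fun t => - (Rr / Q) * Q2 t)).
      - rewrite (RInt_scal Q2) by auto. fold Q. change (RInt (fun t => Qd2 t + - c * W t) 0 b) with Rr.
        change (RInt Q2 0 b) with Q.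
        unfold plus, scal; simpl; unfold mult; simpl. field. lra.
      - auto.
      - apply @ex_RInt_scal. auto. }
    destruct (antiderivative_off g 0 b p (b - p) Cg Og) as [DG OG]; try lra.
    assert (Z0 : iint M (zext b (jf b Z2 g)) = 0).
    { apply jf_angular_zero with (p := p) (m := N) (h1 := fun t => 2 * Z O t * Z 1%nat t) (G := fun t => RInt g 0 t); auto.
      - intros t. split.
        + unfold Z2. evar_last. apply (is_derive_pow (Z O) 2 t _ (HZ O t)). simpl. ring.
        + apply (@continuous_mult R_UniformSpace R_AbsRing (fun t => 2 * Z O t) (Z 1%nat)); auto.
          apply (@continuous_scal_r R_UniformSpace R_AbsRing R_NormedModule 2 (Z O)). apply CZ.
      - unfold M; lra. }
    rewrite (Lin Z2 Z2 (fun t => Qd2 t + - c * W t) Q2 Z2 g (- (Rr / Q))) in Z0; auto.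
    - fold J0 in Z0. lra.
    - intros z _. unfold jf, g, Rdiv. ring. }
  assert (Rad : iint M (zext b (jf b Zd2 Q2)) = / N ^ 2 * (A / B) * J0).
  { assert (IA : RInt Zd2 (- (2 * N)) (2 * N) = / N * A).
    { unfold Zd2, Z. rewrite (RInt_ext _ (fun t => (fun u => / N ^ 2 * X 1%nat u ^ 2) (t / N))).
      - rewrite (RInt_dilate (fun u => / N ^ 2 * X 1%nat u ^ 2)); auto.
        + rewrite (RInt_scal (fun u => X 1%nat u ^ 2)). fold A. unfold scal; simpl; unfold mult; simpl. field; lra.
          apply ExN. intros; apply continuous_sqr, CX.
        + intros t. apply (@continuous_scal_r R_UniformSpace R_AbsRing R_NormedModule (/ N ^ 2) (fun u => X 1%nat u ^ 2)).
          apply continuous_sqr, CX.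
      - intros t _. simpl. field. lra. }
    assert (IB : RInt Z2 (- (2 * N)) (2 * N) = N * B).
    { unfold Z2, Z. rewrite (RInt_ext _ (fun t => (fun u => X O u ^ 2) (t / N))).
      - apply (RInt_dilate (fun u => X O u ^ 2)); auto. intros; apply continuous_sqr, CX.
      - intros t _. simpl. field. }
    set (k := / N ^ 2 * (A / B)).
    set (h := fun t => Zd2 t + - k * Z2 t).
    assert (Ch : forall t, continuous h t) by (intros; now apply continuous_lincomb).
    assert (Oh : off (- N) N h) by (intros t Ht; unfold h; rewrite OZd2, OZ2 by auto; ring).
    assert (Ih : RInt h (- (2 * N)) (2 * N) = 0).
    { unfold h. rewrite (RInt_plus Zd2 (fun t => - k * Z2 t)).
      - rewrite (RInt_scal Z2) by auto. rewrite IA, IB.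
        unfold k, plus, scal; simpl; unfold mult; simpl. field. lra.
      - auto.
      - apply @ex_RInt_scal. auto. }
    destruct (antiderivative_off h (- (2 * N)) (2 * N) (- N) N Ch Oh) as [DH OH]; try lra.
    assert (Z0 : iint M (zext b (jf b h Q2)) = 0).
    { apply jf_radial_zero with (p := p) (m := N) (g1 := fun t => 2 * Ps O t * Ps 1%nat t)
        (H := fun t => RInt h (- (2 * N)) t); auto.
      - intros t _. split.
        + unfold Q2. evar_last. apply (is_derive_pow (Ps O) 2 t _ (HP O t)). simpl. ring.
        + apply (@continuous_mult R_UniformSpace R_AbsRing (fun t => 2 * Ps O t) (Ps 1%nat)); auto.
          apply (@continuous_scal_r R_UniformSpace R_AbsRing R_NormedModule 2 (Ps O)). apply CP.
      - unfold M; lra. }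
    rewrite (Lin Zd2 Z2 Q2 Q2 h Q2 (- k)) in Z0; auto.
    - fold J0 in Z0. lra.
    - intros z _. unfold jf, h, Rdiv. ring. }
  destruct (polar_test_function b p N Z Ps B1 B2 P1 P2 HZ HP OZ OP) as [SF CS].
  assert (I2M : Int2 (fun z => zext b (teval b Z Ps (tword nil)) z ^ 2 / dist_bd (Lambda b) z ^ 2)
     (iint M (zext b (jf b Z2 W)))).
  { replace (fun z => zext b (teval b Z Ps (tword nil)) z ^ 2 / dist_bd (Lambda b) z ^ 2) with (zext b (jf b Z2 W)).
    - apply Int2_iint. exists M. split; [unfold M; pose proof (exp_pos N); lra|]. split; [|split]; auto.
      intros x y Hxy. apply (zext_box b p N); [now apply jf_vanishes|]. unfold M in Hxy. lra.
    - apply functional_extensionality. intros z. destruct (classic (in_sector b z)) as [S | S].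
      + rewrite !zext_in, dist_bd_Lambda by auto. destruct (in_sector_pos b z S) as [Hr _].
        destruct (sfun_bounds b _ B1 (in_sector_ang b z B1 B2 S)) as [Hs _].
        unfold jf, W, Z2, Q2, dsec. simpl. field. lra.
      + rewrite !zext_out by auto. unfold Rdiv. ring. }
  assert (I1M : Int2 (fun z => zext b (teval b Z Ps (tword (true :: nil))) z ^ 2 +
       zext b (teval b Z Ps (tword (false :: nil))) z ^ 2)
     (iint M (zext b (jf b Zd2 Q2)) + 1 * iint M (zext b (jf b Z2 Qd2)))).
  { destruct (iint_linear M 1 _ _ (BI Zd2 Q2 CZd2 CQ2 OZd2 OQ2) (BI Z2 Qd2 CZ2 CQd2 OZ2 OQd2)) as [L1 <-].
    replace (fun z => zext b (teval b Z Ps (tword (true :: nil))) z ^ 2 + zext b (teval b Z Ps (tword (false :: nil))) z ^ 2)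
      with (fun z => zext b (jf b Zd2 Q2) z + 1 * zext b (jf b Z2 Qd2) z).
    - apply Int2_iint. exists M. split; [unfold M; pose proof (exp_pos N); lra|]. split; [|split]; auto.
      intros x y Hxy. rewrite !(zext_box b p N); try (now apply jf_vanishes); try (unfold M in Hxy; lra).
    - apply functional_extensionality. intros z. destruct (classic (in_sector b z)) as [S | S].
      + rewrite !zext_in by auto. destruct (in_sector_pos b z S) as [Hr _]. pose proof (rad_sqr z) as E.
        unfold jf, Zd2, Z2, Q2, Qd2. cbn [teval tderiv tword].
        set (x0 := Z O (ln (rad z))). set (x1 := Z 1%nat (ln (rad z))).
        set (y0 := Ps O (ang b z)). set (y1 := Ps 1%nat (ang b z)).
        transitivity ((x1 ^ 2 * y0 ^ 2 + x0 ^ 2 * y1 ^ 2) * (fst z ^ 2 + snd z ^ 2) / rad z ^ 4).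
        rewrite <- E. field; lra. field; lra.
      + rewrite !zext_out by auto. ring. }
  pose proof (HI _ _ SF CS _ _ I1M I2M) as Fin.
  assert (Split : iint M (zext b (jf b Z2 (fun t => Qd2 t + - c * W t))) =
     iint M (zext b (jf b Z2 Qd2)) + - c * iint M (zext b (jf b Z2 W))).
  { apply Lin; auto. intros z _. unfold jf, Rdiv. ring. }
  assert (Tot : 0 <= (/ N ^ 2 * (A / B) + Rr / Q) * J0).
  { replace ((/ N ^ 2 * (A / B) + Rr / Q) * J0) with (/ N ^ 2 * (A / B) * J0 + Rr / Q * J0) by ring.
    rewrite <- Ang, <- Rad, Split. lra. }
  apply Rmult_le_reg_r with J0; auto. rewrite Rmult_0_l. exact Tot.
Qed.

Lemma hardy_1d_smooth (b c p : R) (X Ps : nat -> R -> R) (t0 : R) :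
  PI <= b -> b <= 2 * PI -> 0 < p -> p < b / 2 ->
  tower X -> tower Ps -> off (-1) 1 (X O) -> off p (b - p) (Ps O) -> X O 0 <> 0 -> Ps O t0 <> 0 ->
  hardy_ineq (Lambda b) c -> 0 <= hardy_form b c (Ps O) (Ps 1%nat).
Proof.
  intros B1 B2 P1 P2 HX HP OX OP X0 Pt0 HI.
  pose proof (fun N HN => hardy_1d_scaled b c p N X Ps t0 B1 B2 P1 P2 HN HX HP OX OP X0 Pt0 HI) as K.
  assert (Tb : p <= t0 <= b - p).
  { split; apply Rnot_lt_le; intros L; apply Pt0, OP; auto. }
  assert (HQ : 0 < RInt (fun t => Ps O t ^ 2) 0 b).
  { apply RInt_pos_at with t0; [lra| | |].
    - intros t. apply continuous_sqr, tower_continuous, HP.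
    - intros t. apply pow2_ge_0.
    - apply pow2_gt_0; auto. }
  set (k := RInt (fun t => X 1%nat t ^ 2) (-2) 2 / RInt (fun t => X O t ^ 2) (-2) 2) in *.
  apply Rnot_lt_le. intros N.
  set (rho := hardy_form b c (Ps O) (Ps 1%nat) / RInt (fun t => Ps O t ^ 2) 0 b) in *.
  assert (Hr : rho < 0).
  { unfold rho. apply Rmult_lt_reg_r with (RInt (fun t => Ps O t ^ 2) 0 b); auto.
    unfold Rdiv. rewrite Rmult_assoc, Rinv_l; lra. }
  (* A stretching factor with |k| / T < - rho: then the radial energy can no longer compensate a
     negative angular form. *)
  set (T := 1 + Rabs k / - rho).
  assert (Hk : 0 <= Rabs k / - rho).
  { apply Rmult_le_pos; [apply Rabs_pos|]. left; apply Rinv_0_lt_compat; lra. }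
  assert (HT : 1 <= T) by (unfold T; lra).
  specialize (K T ltac:(lra)).
  assert (Tk : T * - rho = - rho + Rabs k) by (unfold T; field; lra).
  assert (L : / T ^ 2 * k <= / T * Rabs k).
  { apply Rle_trans with (/ T ^ 2 * Rabs k).
    - apply Rmult_le_compat_l; [|apply Rle_abs]. left; apply Rinv_0_lt_compat; nra.
    - apply Rmult_le_compat_r; [apply Rabs_pos|]. apply Rinv_le_contravar; nra. }
  assert (L2 : / T * Rabs k < - rho).
  { apply Rmult_lt_reg_l with T; [lra|]. rewrite <- Rmult_assoc, Rinv_r by lra. lra. }
  lra.
Qed.

(** * Bump functions and mollification *)

(** Polynomials as syntax: the functions P(1 / x) exp (- 1 / x), extended by 0, are closed under
    differentiation, and a syntactic P lets this be iterated to all orders. *)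
Inductive pexp : Type := Pc (c : R) | Pt | Padd (e f : pexp) | Pmul (e f : pexp).

Fixpoint peval (e : pexp) (t : R) : R :=
  match e with
  | Pc c => c
  | Pt => t
  | Padd e f => peval e t + peval f t
  | Pmul e f => peval e t * peval f t
  end.

Fixpoint pderiv (e : pexp) : pexp :=
  match e with
  | Pc _ => Pc 0
  | Pt => Pc 1
  | Padd e f => Padd (pderiv e) (pderiv f)
  | Pmul e f => Padd (Pmul (pderiv e) f) (Pmul e (pderiv f))
  end.

Lemma peval_derive (e : pexp) (t : R) : is_derive (peval e) t (peval (pderiv e) t).
Proof.
  induction e as [c| |e IHe f IHf|e IHe f IHf]; simpl.
  - apply @is_derive_const.
  - apply @is_derive_id.
  - exact (is_derive_plus _ _ _ _ _ IHe IHf).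
  - evar_last. apply @is_derive_mult; [exact IHe | exact IHf | intros; apply Rmult_comm]. reflexivity.
Qed.

Lemma peval_growth (e : pexp) : exists C k, 0 <= C /\ forall t, 1 <= t -> Rabs (peval e t) <= C * t ^ k.
Proof.
  induction e as [c| |e (C & k & HC & He) f (D & l & HD & Hf)|e (C & k & HC & He) f (D & l & HD & Hf)]; simpl.
  - exists (Rabs c), O. split; [apply Rabs_pos|]. intros. simpl. lra.
  - exists 1, 1%nat. split; [lra|]. intros. rewrite Rabs_pos_eq; lra.
  - exists (C + D), (k + l)%nat. split; [lra|]. intros t Ht. specialize (He t Ht). specialize (Hf t Ht).
    eapply Rle_trans; [apply Rabs_triang|]. rewrite pow_add.
    pose proof (pow_R1_Rle t k Ht). pose proof (pow_R1_Rle t l Ht).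
    assert (t ^ k <= t ^ k * t ^ l) by nra. assert (t ^ l <= t ^ k * t ^ l) by nra. nra.
  - exists (C * D), (k + l)%nat. split; [nra|]. intros t Ht. specialize (He t Ht). specialize (Hf t Ht).
    rewrite Rabs_mult, pow_add. replace (C * D * (t ^ k * t ^ l)) with ((C * t ^ k) * (D * t ^ l)) by ring.
    apply Rmult_le_compat; auto; apply Rabs_pos.
Qed.

Lemma exp_INR_mult (x : R) (n : nat) : exp (INR n * x) = exp x ^ n.
Proof.
  induction n as [|n IH]; [simpl; rewrite Rmult_0_l; apply exp_0|].
  rewrite S_INR, Rmult_plus_distr_r, exp_plus, IH, Rmult_1_l. simpl. ring.
Qed.

(** The n-th power of t / n <= exp (t / n). *)
Lemma pow_exp_bound (n : nat) (t : R) : (0 < n)%nat -> 0 <= t -> t ^ n * exp (- t) <= INR n ^ n.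
Proof.
  intros Hn Ht. assert (Hn' : 0 < INR n) by now apply lt_0_INR.
  assert (H : t ^ n <= INR n ^ n * exp t).
  { replace t with (INR n * (t / INR n)) by (field; lra).
    rewrite exp_INR_mult, Rpow_mult_distr. apply Rmult_le_compat_l; [apply pow_le; lra|].
    assert (0 <= t / INR n) by (apply Rmult_le_pos; [|left; apply Rinv_0_lt_compat]; lra).
    apply pow_incr. split; auto.
    destruct (Req_dec (t / INR n) 0) as [-> | N]; [left; apply exp_pos|].
    pose proof (exp_ineq1 _ N). lra. }
  apply Rmult_le_reg_r with (exp t); [apply exp_pos|].
  rewrite Rmult_assoc, <- exp_plus, Rplus_opp_l, exp_0, Rmult_1_r. exact H.
Qed.

Definition flat (e : pexp) (x : R) : R := if Rlt_dec 0 x then peval e (/ x) * exp (- / x) else 0.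
(** With t = 1 / x, the x-derivative of P(t) exp (- t) is t^2 (P - P')(t) exp (- t). *)
Definition flat_step (e : pexp) : pexp := Pmul (Pmul Pt Pt) (Padd e (Pmul (Pc (-1)) (pderiv e))).

Lemma flat_nonpos (e : pexp) (x : R) : x <= 0 -> flat e x = 0.
Proof. intros H. unfold flat. destruct Rlt_dec; lra. Qed.

Lemma flat_pos (e : pexp) (x : R) : 0 < x -> flat e x = peval e (/ x) * exp (- / x).
Proof. intros H. unfold flat. destruct Rlt_dec; lra. Qed.

Lemma flat_derive (e : pexp) (x : R) : is_derive (flat e) x (flat (flat_step e) x).
Proof.
  destruct (Rtotal_order x 0) as [H | [H | H]].
  - rewrite flat_nonpos by lra. apply is_derive_ext_loc with (fun _ => 0).
    + eapply filter_imp; [|exact (locally_below x 0 H)]. intros u Hu. symmetry. apply flat_nonpos. lra.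
    + apply @is_derive_const.
  - subst x. rewrite flat_nonpos by lra. apply is_derive_Reals. intros eps He.
    destruct (peval_growth e) as (C & k & HC & Hg).
    set (M := C * INR (k + 2) ^ (k + 2)).
    assert (HM : 0 <= M) by (apply Rmult_le_pos; auto; apply pow_le, pos_INR).
    assert (Hd : 0 < Rmin 1 (eps / (M + 1))) by (apply Rmin_pos; [lra | apply Rdiv_lt_0_compat; lra]).
    exists (mkposreal _ Hd). intros h Hh Hl. simpl in Hl.
    pose proof (Rmin_l 1 (eps / (M + 1))). pose proof (Rmin_r 1 (eps / (M + 1))).
    rewrite Rplus_0_l, (flat_nonpos e 0), !Rminus_0_r by lra.
    destruct (Rlt_dec h 0) as [Hn | Hn].
    + rewrite flat_nonpos by lra. unfold Rdiv. rewrite Rmult_0_l, Rabs_R0. auto.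
    + assert (Hp : 0 < h) by lra. rewrite Rabs_pos_eq in Hl by lra. rewrite flat_pos by auto.
      set (t := / h). assert (Ht : 1 <= t) by (unfold t; rewrite <- Rinv_1; apply Rinv_le_contravar; lra).
      (* Writing 1 / h as t^2 h makes room for a factor h: the remaining polynomial of degree at
         most k + 2 times exp (- t) is bounded by [M]. *)
      assert (B : Rabs (peval e t * exp (- t) / h) <= M * h).
      { replace (peval e t * exp (- t) / h) with (peval e t * (t ^ 2 * exp (- t)) * h) by (unfold t; field; lra).
        rewrite !Rabs_mult, (Rabs_pos_eq h), (Rabs_pos_eq (exp _)), (Rabs_pos_eq (t ^ 2)) by
          (try lra; try apply pow2_ge_0; left; apply exp_pos).
        apply Rmult_le_compat_r; [lra|].
        apply Rle_trans with (C * t ^ k * (t ^ 2 * exp (- t))).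
        - apply Rmult_le_compat_r; auto. apply Rmult_le_pos; [apply pow2_ge_0 | left; apply exp_pos].
        - unfold M. replace (C * t ^ k * (t ^ 2 * exp (- t))) with (C * (t ^ (k + 2) * exp (- t))) by (rewrite pow_add; ring).
          apply Rmult_le_compat_l; auto. apply pow_exp_bound; [lia | lra]. }
      eapply Rle_lt_trans; [exact B|].
      apply Rle_lt_trans with ((M + 1) * h); [nra|].
      apply Rmult_lt_reg_r with (/ (M + 1)); [apply Rinv_0_lt_compat; lra|].
      replace ((M + 1) * h * / (M + 1)) with h by (field; lra). unfold Rdiv in *. lra.
  - rewrite flat_pos by auto. apply is_derive_ext_loc with (fun x => peval e (/ x) * exp (- / x)).
    + eapply filter_imp; [|exact (locally_above x 0 H)]. intros u Hu. symmetry. now apply flat_pos.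
    + assert (I : is_derive Rinv x (- / x ^ 2)) by (auto_derive; [lra | field; lra]).
      evar_last.
      * apply @is_derive_mult; [apply (is_derive_comp (peval e) Rinv x _ _ (peval_derive e (/ x)) I) | | intros; apply Rmult_comm].
        auto_derive; [lra | reflexivity].
      * unfold plus, mult, scal; simpl; unfold mult; simpl. field. lra.
Qed.

Definition pair_sum (F G : nat -> R -> R) (l : list (nat * nat)) (t : R) : R :=
  fold_right (fun ij acc => F (fst ij) t * G (snd ij) t + acc) 0 l.

(** A pair (i, j) stands for the product of the i-th and j-th derivatives; pairs are repeated in
    place of binomial coefficients. *)
Definition leibniz (l : list (nat * nat)) : list (nat * nat) :=
  flat_map (fun ij => (S (fst ij), snd ij) :: (fst ij, S (snd ij)) :: nil) l.

Lemma tower_mult (F G : nat -> R -> R) : tower F -> tower G ->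
  tower (fun n => pair_sum F G (Nat.iter n leibniz ((O, O) :: nil))).
Proof.
  intros HF HG n t. simpl. generalize (Nat.iter n leibniz ((O, O) :: nil)). intros l.
  induction l as [|[i j] l IH].
  - apply @is_derive_const.
  - evar_last.
    + apply @is_derive_plus; [|exact IH].
      apply @is_derive_mult; [apply HF | apply HG | intros; apply Rmult_comm].
    + unfold plus, mult; simpl. ring.
Qed.

Lemma bump_tower : exists X, tower X /\ off (-1) 1 (X O) /\ (forall t, 0 <= X O t) /\ 0 < X O 0.
Proof.
  pose (e := fun n => flat (Nat.iter n flat_step (Pc 1))).
  pose (F := fun n t => e n (1 + t)). pose (G := fun n t => (-1) ^ n * e n (1 - t)).
  assert (He : tower e) by (intros n t; apply flat_derive).
  assert (e0 : forall t, 0 <= e O t).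
  { intros t. unfold e, flat. simpl. destruct Rlt_dec; [|lra]. rewrite Rmult_1_l. left; apply exp_pos. }
  exists (fun n => pair_sum F G (Nat.iter n leibniz ((O, O) :: nil))). split; [|split; [|split]].
  - apply tower_mult.
    + intros n t. evar_last. apply (is_derive_comp (e n) (fun t => 1 + t)). apply He. auto_derive; auto.
      unfold scal; simpl; unfold mult; simpl. unfold F. ring.
    + intros n t. evar_last. apply @is_derive_scal. apply (is_derive_comp (e n) (fun t => 1 - t)). apply He. auto_derive; auto.
      unfold scal; simpl; unfold mult; simpl. unfold G. simpl. ring.
  - intros t [Ht | Ht]; simpl; unfold F, G, e; [rewrite (flat_nonpos _ (1 + t)) | rewrite (flat_nonpos _ (1 - t))]; try ring; lra.
  - intros t. simpl. unfold F, G. simpl. pose proof (e0 (1 + t)). pose proof (e0 (1 - t)). nra.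
  - simpl. unfold F, G, e. rewrite !flat_pos by lra. simpl.
    rewrite !Rmult_1_l, Rplus_0_r. apply Rmult_lt_0_compat; apply exp_pos.
Qed.

(** * Mollification by convolution *)

Lemma convolution_tower (f : R -> R) (K : nat -> R -> R) (u v : R) :
  (forall t, continuous f t) -> tower K ->
  tower (fun n x => RInt (fun s => f s * K n (x - s)) u v).
Proof.
  intros Hf HK n x.
  assert (Hd : forall n x s, is_derive (fun x => f s * K n (x - s)) x (f s * K (S n) (x - s))).
  { clear n x. intros n x s. evar_last. apply @is_derive_scal.
    apply (is_derive_comp (K n) (fun x => x - s)). apply HK. auto_derive; auto.
    unfold scal; simpl; unfold mult; simpl. ring. }
  assert (Hc : forall n z, continuous (fun z : pt => f (snd z) * K n (fst z - snd z)) z).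
  { intros m z. apply continuous_Rmult.
    - apply (continuous_comp snd f); auto. destruct z; apply continuous_snd.
    - apply (continuous_comp (fun z : pt => fst z - snd z) (K m)); [|apply tower_continuous; auto].
      apply (continuous_ext (fun z : pt => 1 * fst z + -1 * snd z + 0)).
      intros [a c]; simpl; ring. apply continuous_lin. }
  assert (Ex : forall n x, ex_RInt (fun s => f s * K n (x - s)) u v).
  { intros m y. apply @ex_RInt_continuous. intros s _.
    exact (continuous_slice_y (fun z : pt => f (snd z) * K m (fst z - snd z)) y s (Hc m (y, s))). }
  evar_last.
  - apply (is_derive_RInt_param (fun x s => f s * K n (x - s))).
    + apply filter_forall. intros y s _. eexists. apply Hd.
    + intros s _. apply continuity_2d_pt_ext with (fun a c => f c * K (S n) (a - c)).
      * intros a c. symmetry. apply is_derive_unique, Hd.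
      * apply (continuity_2d_continuous (fun z : pt => f (snd z) * K (S n) (fst z - snd z))), Hc.
    + apply filter_forall. intros y. apply Ex.
  - apply RInt_ext. intros s _. apply is_derive_unique, Hd.
Qed.

Lemma continuous_off_bounded (f : R -> R) (p q : R) : p <= q ->
  (forall t, continuous f t) -> off p q f -> exists B, 0 <= B /\ forall t, Rabs (f t) <= B.
Proof.
  intros Hpq Hc Hf.
  destruct (continuity_ab_maj (fun t => Rabs (f t)) p q Hpq) as (m & Hm & _).
  { intros t _. apply (continuity_pt_comp f Rabs). apply continuity_pt_filterlim, Hc. apply Rcontinuity_abs. }
  exists (Rabs (f m)). split; [apply Rabs_pos|]. intros t.
  destruct (Rlt_dec t p); [rewrite Hf by auto; rewrite Rabs_R0; apply Rabs_pos|].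
  destruct (Rlt_dec q t); [rewrite Hf by auto; rewrite Rabs_R0; apply Rabs_pos|]. apply Hm. lra.
Qed.

Lemma convolution_approx (f k : R -> R) (u v d x eta : R) :
  (forall t, continuous f t) -> (forall t, continuous k t) -> (forall t, 0 <= k t) ->
  0 < d -> off (- d) d k -> RInt k (- (2 * d)) (2 * d) = 1 -> u <= x - 2 * d -> x + 2 * d <= v ->
  (forall s, Rabs (s - x) <= d -> Rabs (f s - f x) <= eta) ->
  Rabs (RInt (fun s => f s * k (x - s)) u v - f x) <= eta.
Proof.
  intros Hf Hk K0 Hd Ok Ik Hu Hv Hm.
  assert (Ck : forall s, continuous (fun s => k (x - s)) s).
  { intros s. apply (continuous_comp (fun s => x - s) k); auto. apply @ex_derive_continuous. auto_derive; auto. }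
  assert (Cp : forall g : R -> R, (forall t, continuous g t) -> forall s, continuous (fun s => g s * k (x - s)) s).
  { intros g Hg s. apply (@continuous_mult R_UniformSpace R_AbsRing g (fun s => k (x - s))); auto. }
  assert (Ex : forall (g : R -> R) s t, (forall t, continuous g t) -> ex_RInt g s t).
  { intros. apply @ex_RInt_continuous. auto. }
  assert (Z : forall (g : R -> R), (forall t, continuous g t) ->
     RInt (fun s => g s * k (x - s)) u v = RInt (fun s => g s * k (x - s)) (x - 2 * d) (x + 2 * d)).
  { intros g Hg. pose proof (Cp g Hg) as C.
    rewrite <- (RInt_Chasles (fun s => g s * k (x - s)) u (x - 2 * d) v) by auto.
    rewrite <- (RInt_Chasles (fun s => g s * k (x - s)) (x - 2 * d) (x + 2 * d) v) by auto.
    rewrite (RInt_zero_on _ u (x - 2 * d)), (RInt_zero_on _ (x + 2 * d) v).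
    - unfold plus; simpl; ring.
    - intros s Hs. rewrite Rmin_left, Rmax_right in Hs by lra. rewrite Ok by lra. ring.
    - intros s Hs. rewrite Rmin_left, Rmax_right in Hs by lra. rewrite Ok by lra. ring. }
  assert (One : is_RInt (fun s => k (x - s)) (x - 2 * d) (x + 2 * d) 1).
  { assert (Q : is_RInt (fun s => scal (-1) (k (-1 * s + x))) (x - 2 * d) (x + 2 * d) (RInt k (2 * d) (- (2 * d)))).
    { apply (is_RInt_comp_lin k (-1) x).
      replace (-1 * (x - 2 * d) + x) with (2 * d) by ring. replace (-1 * (x + 2 * d) + x) with (- (2 * d)) by ring.
      apply @RInt_correct. auto. }
    apply (is_RInt_scal _ _ _ (-1)) in Q. evar_last.
    - eapply is_RInt_ext; [|exact Q]. intros s _. unfold scal; simpl; unfold mult; simpl.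
      replace (-1 * s + x) with (x - s) by ring. ring.
    - rewrite <- opp_RInt_swap, Ik by auto. unfold scal, opp; simpl; unfold mult; simpl. ring. }
  rewrite Z by auto.
  assert (E : RInt (fun s => f s * k (x - s)) (x - 2 * d) (x + 2 * d) - f x =
     RInt (fun s => (f s - f x) * k (x - s)) (x - 2 * d) (x + 2 * d)).
  { symmetry. apply is_RInt_unique.
    assert (Q : is_RInt (fun s => minus (f s * k (x - s)) (scal (f x) (k (x - s)))) (x - 2 * d) (x + 2 * d)
       (minus (RInt (fun s => f s * k (x - s)) (x - 2 * d) (x + 2 * d)) (scal (f x) 1))).
    { apply @is_RInt_minus; [apply @RInt_correct; auto|]. now apply @is_RInt_scal. }
    evar_last; [eapply is_RInt_ext; [|exact Q]|].
    - intros s _. unfold minus, plus, opp, scal; simpl; unfold mult; simpl. ring.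
    - unfold minus, plus, opp, scal; simpl; unfold mult; simpl. ring. }
  rewrite E.
  assert (Cd : forall t, continuous (fun s => f s - f x) t).
  { intros t. apply (@continuous_minus R_UniformSpace R_AbsRing R_NormedModule f (fun _ => f x)); auto. apply continuous_const. }
  replace eta with (RInt (fun s => eta * k (x - s)) (x - 2 * d) (x + 2 * d)).
  2: { rewrite (RInt_scal (fun s => k (x - s))) by auto. rewrite (is_RInt_unique _ _ _ _ One).
       unfold scal; simpl; unfold mult; simpl. ring. }
  eapply Rle_trans.
  - apply abs_RInt_le; [lra|]. auto.
  - apply RInt_le; [lra | | |].
    + apply Ex. intros t. apply (continuous_comp (fun s => (f s - f x) * k (x - s)) Rabs); [apply Cp; auto|].
      apply continuous_Rabs.
    + apply Ex. intros t. apply (@continuous_scal_r R_UniformSpace R_AbsRing R_NormedModule eta (fun s => k (x - s))); auto.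
    + intros s Hs. rewrite Rabs_mult, (Rabs_pos_eq (k _)) by auto.
      destruct (Rle_dec (Rabs (s - x)) d) as [L | L].
      * apply Rmult_le_compat_r; auto.
      * rewrite Ok; [lra|]. unfold Rabs in L. destruct Rcase_abs in L; lra.
Qed.

Lemma off_uniformly_continuous (g : R -> R) (p q eta : R) :
  (forall t, continuous g t) -> off p q g -> 0 < eta ->
  exists d, 0 < d <= 1 /\ forall s x, Rabs (s - x) <= d -> Rabs (g s - g x) <= eta.
Proof.
  intros Hc Hg He.
  destruct (unifcont_normed_1d g (p - 1) (q + 1) (fun x _ => Hc x) (mkposreal eta He)) as [d Hd].
  pose proof (cond_pos d) as Dp. exists (Rmin (d / 2) 1).
  pose proof (Rmin_l (d / 2) 1). pose proof (Rmin_r (d / 2) 1).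
  split; [split; [apply Rmin_pos; lra | auto]|]. intros s x Hsx.
  assert (B : - Rmin (d / 2) 1 <= s - x <= Rmin (d / 2) 1) by now apply Rabs_le_between.
  destruct (Rlt_dec x (p - 1)) as [C | C].
  { rewrite (Hg s), (Hg x) by (left; lra). rewrite Rminus_diag, Rabs_R0. lra. }
  destruct (Rlt_dec (q + 1) x) as [C2 | C2].
  { rewrite (Hg s), (Hg x) by (right; lra). rewrite Rminus_diag, Rabs_R0. lra. }
  destruct (Rlt_dec s (p - 1)) as [C3 | C3].
  { rewrite (Hg s), (Hg x) by (left; lra). rewrite Rminus_diag, Rabs_R0. lra. }
  destruct (Rlt_dec (q + 1) s) as [C4 | C4].
  { rewrite (Hg s), (Hg x) by (right; lra). rewrite Rminus_diag, Rabs_R0. lra. }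
  left. apply (Hd x s); try lra. change (Rabs (s - x) < d). lra.
Qed.

Lemma mollification (f f1 : R -> R) (p q eta d0 : R) :
  (forall t, is_derive f t (f1 t)) -> (forall t, continuous f1 t) -> off p q f -> 0 < eta -> 0 < d0 ->
  exists Ps, tower Ps /\ off (p - d0) (q + d0) (Ps O) /\
    forall t, Rabs (Ps O t - f t) <= eta /\ Rabs (Ps 1%nat t - f1 t) <= eta.
Proof.
  intros Hf Hf1 Of He Hd0.
  assert (Cf : forall t, continuous f t) by (intros t; apply @ex_derive_continuous; eexists; apply Hf).
  assert (Of1 : off p q f1).
  { intros t Ht. rewrite <- (is_derive_unique _ _ _ (Hf t)). rewrite (Derive_ext_loc _ (fun _ => 0)).
    apply Derive_const. destruct Ht as [Ht | Ht].
    - eapply filter_imp; [|exact (locally_below t p Ht)]. intros u Hu. apply Of. now left.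
    - eapply filter_imp; [|exact (locally_above t q Ht)]. intros u Hu. apply Of. now right. }
  destruct (off_uniformly_continuous f p q eta Cf Of He) as (e1 & E1 & U1).
  destruct (off_uniformly_continuous f1 p q eta Hf1 Of1 He) as (e2 & E2 & U2).
  set (d := Rmin d0 (Rmin e1 e2)).
  assert (Hd : 0 < d) by (unfold d; repeat apply Rmin_pos; lra).
  assert (D0 : d <= d0) by apply Rmin_l.
  assert (D1 : d <= e1) by (unfold d; eapply Rle_trans; [apply Rmin_r | apply Rmin_l]).
  assert (D2 : d <= e2) by (unfold d; eapply Rle_trans; [apply Rmin_r | apply Rmin_r]).
  destruct bump_tower as (X & HX & OX & Xp & X0).
  set (I := RInt (X O) (-2) 2).
  assert (HI : 0 < I).
  { apply RInt_pos_at with 0; auto; [lra|]. apply tower_continuous, HX. }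
  pose (K := fun n u => / (d * I) * (/ d ^ n * X n (u / d))).
  assert (HK : tower K).
  { intros n t. apply @is_derive_scal. exact (tower_scale X d Hd HX n t). }
  assert (CK : forall n t, continuous (K n) t) by (apply tower_continuous; auto).
  assert (OK : off (- d) d (K O)).
  { intros t Ht. unfold K. rewrite OX; [ring|].
    destruct Ht as [Ht | Ht]; [left | right]; apply Rmult_lt_reg_r with d; auto;
    unfold Rdiv; rewrite Rmult_assoc, Rinv_l; lra. }
  assert (Kp : forall t, 0 <= K O t).
  { intros t. unfold K. apply Rmult_le_pos; [left; apply Rinv_0_lt_compat; nra|].
    simpl. rewrite Rinv_1, Rmult_1_l. auto. }
  assert (IK : RInt (K O) (- (2 * d)) (2 * d) = 1).
  { unfold K. rewrite (RInt_ext _ (fun t => (fun u => / (d * I) * X O u) (t / d))).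
    - rewrite (RInt_dilate (fun u => / (d * I) * X O u)); auto.
      + rewrite (RInt_scal (X O)). fold I. unfold scal; simpl; unfold mult; simpl. field. lra.
        apply @ex_RInt_continuous. intros; apply tower_continuous, HX.
      + intros t. apply (@continuous_scal_r R_UniformSpace R_AbsRing R_NormedModule (/ (d * I)) (X O)).
        apply tower_continuous, HX.
    - intros t _. simpl. rewrite Rinv_1, Rmult_1_l. reflexivity. }
  (* Since d <= 1, these limits contain x - 2 d and x + 2 d for all x in [p - 2, q + 2]; outside
     that interval both functions vanish. *)
  set (u := p - 4). set (v := q + 4).
  pose (Ps := fun n x => RInt (fun s => f s * K n (x - s)) u v).
  assert (HP : tower Ps) by now apply convolution_tower.
  assert (OP : off (p - d) (q + d) (Ps O)).
  { intros t Ht. apply RInt_zero_on. intros s _.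
    destruct (Rlt_dec s p); [rewrite Of by auto; ring|].
    destruct (Rlt_dec q s); [rewrite Of by auto; ring|].
    rewrite OK; [ring|]. destruct Ht; [left | right]; lra. }
  exists Ps. split; auto. split.
  { intros t Ht. apply OP. destruct Ht; [left | right]; lra. }
  intros t.
  destruct (Rle_dec (p - 2) t) as [T1 | T1].
  1: destruct (Rle_dec t (q + 2)) as [T2 | T2].
  - split.
    + apply convolution_approx with d; auto; try (unfold u, v; lra). intros s Hs. apply U1. lra.
    (* Integration by parts moves the derivative from the kernel to f, so that the derivative of the
       mollification is the mollification of f1. *)
    + assert (Parts : Ps 1%nat t = RInt (fun s => f1 s * K O (t - s)) u v).
      { unfold Ps.
        assert (Cc : forall n (g : R -> R), (forall s, continuous g s) -> forall s, continuous (fun s => g s * K n (t - s)) s).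
        { intros n g Hg s. apply (@continuous_mult R_UniformSpace R_AbsRing g (fun s => K n (t - s))); auto.
          apply (continuous_comp (fun s => t - s) (K n)); auto. apply @ex_derive_continuous. auto_derive; auto. }
        assert (Q : is_RInt (fun s : R => f1 s * K O (t - s) - f s * K 1%nat (t - s)) u v
           (f v * K O (t - v) - f u * K O (t - u))).
        { apply (is_RInt_derive (fun s => f s * K O (t - s)) (fun s : R => f1 s * K O (t - s) - f s * K 1%nat (t - s))).
          - intros s _. evar_last.
            + apply @is_derive_mult; [apply Hf | | intros; apply Rmult_comm].
              apply (is_derive_comp (K O) (fun s => t - s)); [apply HK | auto_derive; [auto | reflexivity]].
            + unfold plus, mult, scal; simpl; unfold mult; simpl. ring.
          - intros s _. apply (@continuous_minus R_UniformSpace R_AbsRing R_NormedModule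
              (fun s => f1 s * K O (t - s)) (fun s => f s * K 1%nat (t - s))); auto. }
        assert (Q2 : is_RInt (fun s : R => f1 s * K O (t - s) - f s * K 1%nat (t - s)) u v
           (RInt (fun s => f1 s * K O (t - s)) u v - RInt (fun s => f s * K 1%nat (t - s)) u v)).
        { apply (is_RInt_minus (fun s => f1 s * K O (t - s)) (fun s => f s * K 1%nat (t - s)));
            apply @RInt_correct, @ex_RInt_continuous; auto. }
        pose proof (@is_RInt_unique R_CompleteNormedModule _ _ _ _ Q) as V1.
        pose proof (@is_RInt_unique R_CompleteNormedModule _ _ _ _ Q2) as V2.
        rewrite V2 in V1. clear Q Q2.
        rewrite (Of v), (Of u) in V1 by (unfold u, v; lra). lra. }
      rewrite Parts.
      apply convolution_approx with d; auto; try (unfold u, v; lra). intros s Hs. apply U2. lra.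
  - rewrite (tower_off Ps _ _ HP OP O), (tower_off Ps _ _ HP OP 1%nat), Of, Of1 by (right; lra).
    rewrite Rminus_diag, Rabs_R0. lra.
  - rewrite (tower_off Ps _ _ HP OP O), (tower_off Ps _ _ HP OP 1%nat), Of, Of1 by (left; lra).
    rewrite Rminus_diag, Rabs_R0. lra.
Qed.

Lemma sqr_diff_bound (u v B eta : R) : Rabs (u - v) <= eta -> Rabs v <= B -> eta <= 1 ->
  Rabs (u ^ 2 - v ^ 2) <= eta * (2 * B + 1).
Proof.
  intros H1 H2 H3. replace (u ^ 2 - v ^ 2) with ((u - v) * ((u - v) + 2 * v)) by ring.
  rewrite Rabs_mult. apply Rmult_le_compat; auto; try apply Rabs_pos.
  eapply Rle_trans; [apply Rabs_triang|]. rewrite Rabs_mult, (Rabs_pos_eq 2) by lra. lra.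
Qed.

Lemma hardy_1d_C1 (b c p : R) (f f1 : R -> R) :
  PI <= b -> b <= 2 * PI -> 0 < p -> p < b / 2 -> 0 <= c ->
  (forall t, is_derive f t (f1 t)) -> (forall t, continuous f1 t) -> off p (b - p) f ->
  hardy_ineq (Lambda b) c -> 0 <= hardy_form b c f f1.
Proof.
  intros B1 B2 P1 P2 Hc Hf Hf1 Of HI. pose proof PI_RGT_0 as HPI.
  assert (Cf : forall t, continuous f t) by (intros t; apply @ex_derive_continuous; eexists; apply Hf).
  destruct bump_tower as (X & HX & OX & _ & X0).
  assert (Sm : forall r Ps, 0 < r -> r < b / 2 -> tower Ps -> off r (b - r) (Ps O) -> 0 <= hardy_form b c (Ps O) (Ps 1%nat)).
  { intros r Ps R1 R2 HP OP. destruct (classic (exists t0, Ps O t0 <> 0)) as [[t0 H0] | N].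
    - apply hardy_1d_smooth with (p := r) (X := X) (t0 := t0); auto. lra.
    - assert (Z : forall t, Ps O t = 0) by (intros t; apply NNPP; intros K; apply N; eauto).
      assert (Z1 : forall t, Ps 1%nat t = 0).
      { intros t. rewrite <- (is_derive_unique _ _ _ (HP O t)). rewrite (Derive_ext _ (fun _ => 0)); auto.
        apply Derive_const. }
      unfold hardy_form. rewrite RInt_zero_on; [lra|]. intros t _. rewrite Z, Z1. unfold Rdiv. ring. }
  destruct (continuous_off_bounded f p (b - p)) as (F & F0 & HF); auto; [lra|].
  assert (Of1 : off p (b - p) f1).
  { intros t Ht. rewrite <- (is_derive_unique _ _ _ (Hf t)). rewrite (Derive_ext_loc _ (fun _ => 0)).
    apply Derive_const. destruct Ht as [Ht | Ht].
    - eapply filter_imp; [|exact (locally_below t p Ht)]. intros u Hu. apply Of. now left.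
    - eapply filter_imp; [|exact (locally_above t (b - p) Ht)]. intros u Hu. apply Of. now right. }
  destruct (continuous_off_bounded f1 p (b - p)) as (F' & F0' & HF'); auto; [lra|].
  (* Mollification enlarges the support from [p, b - p] to [r, b - r] at most; there [sfun] >= sin r
     keeps the weight bounded. *)
  set (r := Rmin (p / 2) (PI / 4)).
  assert (Hr : 0 < r /\ r <= p / 2 /\ r <= PI / 4).
  { unfold r. split; [apply Rmin_pos; lra|]. split; [apply Rmin_l | apply Rmin_r]. }
  assert (S0 : 0 < sin r) by (apply sin_gt_0; lra).
  assert (Sl : forall t, r <= t <= b - r -> sin r <= sfun b t).
  { intros t Ht. destruct (angle_cases b t B1) as [H | [H | H]].
    - rewrite sfun_left by lra. apply sin_incr_1; lra.
    - rewrite sfun_mid by lra. apply SIN_bound.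
    - rewrite sfun_right by lra. apply sin_incr_1; lra. }
  set (C := (2 * F' + 1) + c * ((2 * F + 1) / sin r ^ 2)).
  assert (HC : 0 <= C).
  { unfold C. assert (0 <= (2 * F + 1) / sin r ^ 2) by (apply Rmult_le_pos; [lra | left; apply Rinv_0_lt_compat; nra]). nra. }
  assert (Approx : forall eta, 0 < eta -> eta <= 1 -> - (b * (eta * C)) <= hardy_form b c f f1).
  { intros eta He1 He2.
    destruct (mollification f f1 p (b - p) eta (p - r) Hf Hf1 Of He1) as (Ps & HP & OP & HA); [lra|].
    replace (p - (p - r)) with r in OP by ring. replace (b - p + (p - r)) with (b - r) in OP by ring.
    assert (Pos : 0 <= hardy_form b c (Ps O) (Ps 1%nat)) by (apply Sm with r; auto; lra).
    pose proof (tower_continuous Ps HP) as CP.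
    assert (Ex : forall (g g1 : R -> R) r, 0 < r -> (forall t, continuous g t) -> (forall t, continuous g1 t) -> off r (b - r) g ->
       forall t, continuous (fun t => g1 t ^ 2 + - c * (g t ^ 2 / sfun b t ^ 2)) t).
    { intros g g1 r' Hr' Cg Cg1 Og t. apply continuous_lincomb; [now apply continuous_sqr|].
      apply hardy_weight_continuous with (f := fun t => g t ^ 2) (p := r'); auto.
      - intros; now apply continuous_sqr.
      - intros s Hs. rewrite Og by auto. ring. }
    assert (L : hardy_form b c (Ps O) (Ps 1%nat) <= hardy_form b c f f1 + b * (eta * C)).
    { unfold hardy_form at 2.
      replace (b * (eta * C)) with (RInt (fun _ => eta * C) 0 b).
      2: { rewrite RInt_const. unfold scal; simpl; unfold mult; simpl. ring. }
      assert (E1 : ex_RInt (fun t => f1 t ^ 2 + - c * (f t ^ 2 / sfun b t ^ 2)) 0 b).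
      { apply @ex_RInt_continuous. intros t _. apply Ex with p; auto. }
      change (Rplus ?x ?y) with (plus x y).
      rewrite <- (RInt_plus (fun t => f1 t ^ 2 + - c * (f t ^ 2 / sfun b t ^ 2)) (fun _ => eta * C));
        [|exact E1 | apply ex_RInt_const].
      unfold hardy_form. apply RInt_le; [lra | | |].
      - apply @ex_RInt_continuous. intros t _. apply Ex with r; auto. lra.
      - apply @ex_RInt_plus; [exact E1 | apply ex_RInt_const].
      - intros t Ht. destruct (HA t) as [A0 A1].
        pose proof (sqr_diff_bound _ _ F' eta A1 (HF' t) He2) as D1.
        pose proof (sqr_diff_bound _ _ F eta A0 (HF t) He2) as D0.
        apply Rabs_le_between in D0, D1.
        assert (W : f t ^ 2 / sfun b t ^ 2 - Ps O t ^ 2 / sfun b t ^ 2 <= eta * ((2 * F + 1) / sin r ^ 2)).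
        { assert (Q0 : 0 <= (2 * F + 1) / sin r ^ 2) by (apply Rmult_le_pos; [lra | left; apply Rinv_0_lt_compat; nra]).
          destruct (Rlt_dec t r) as [T | T].
          { rewrite (OP t), (Of t) by (left; lra). unfold Rdiv in *. nra. }
          destruct (Rlt_dec (b - r) t) as [T' | T'].
          { rewrite (OP t), (Of t) by (right; lra). unfold Rdiv in *. nra. }
          specialize (Sl t ltac:(lra)).
          replace (f t ^ 2 / sfun b t ^ 2 - Ps O t ^ 2 / sfun b t ^ 2) with ((f t ^ 2 - Ps O t ^ 2) * / sfun b t ^ 2) by (field; lra).
          apply Rle_trans with (eta * (2 * F + 1) * / sfun b t ^ 2).
          - apply Rmult_le_compat_r; [left; apply Rinv_0_lt_compat; nra | lra].
          - unfold Rdiv. rewrite Rmult_assoc. apply Rmult_le_compat_l; [lra|].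
            apply Rmult_le_compat_l; [lra|]. apply Rinv_le_contravar; [nra|]. apply pow_incr. lra. }
        change (Ps 1%nat t ^ 2 + - c * (Ps O t ^ 2 / sfun b t ^ 2) <=
          (f1 t ^ 2 + - c * (f t ^ 2 / sfun b t ^ 2)) + eta * C).
        apply Rmult_le_compat_l with (r := c) in W; auto. unfold C. lra. }
    lra. }
  apply Rnot_lt_le. intros N.
  set (h := hardy_form b c f f1) in *. set (T := b * C + 1).
  assert (HT : 0 <= b * C) by (apply Rmult_le_pos; lra).
  set (eta := Rmin 1 (- h / 2 / T)).
  assert (He : 0 < eta) by (apply Rmin_pos; [lra | apply Rdiv_lt_0_compat; unfold T; lra]).
  specialize (Approx eta He (Rmin_l _ _)).
  assert (E2 : eta * T <= - h / 2).
  { apply Rle_trans with (- h / 2 / T * T).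
    - apply Rmult_le_compat_r; [unfold T; lra | apply Rmin_r].
    - right. field. unfold T; lra. }
  unfold T in E2. nra.
Qed.

(** * Zeros of angular solutions *)

(** The power x^e extended by 0. Then x times it is C^1 on the whole line with derivative 0 at 0,
    which allows gluing with the zero function at a zero of y. *)
Definition ppow (e x : R) : R := if Rlt_dec 0 x then exp (e * ln x) else 0.

Lemma ppow_spec (e x : R) : 0 < e ->
  0 <= ppow e x /\ (x <= 0 -> ppow e x = 0) /\ (0 < x -> 0 < ppow e x) /\ continuous (ppow e) x /\
  (0 < x -> is_derive (ppow e) x (e * ppow e x / x)) /\
  is_derive (fun x => x * ppow e x) x ((1 + e) * ppow e x).
Proof.
  intros He.
  assert (Pp : forall u, 0 < u -> ppow e u = exp (e * ln u)) by (intros u Hu; unfold ppow; destruct Rlt_dec; lra).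
  assert (Pn : forall u, u <= 0 -> ppow e u = 0) by (intros u Hu; unfold ppow; destruct Rlt_dec; lra).
  assert (Small : forall eps, 0 < eps -> exists d : posreal, forall u, Rabs u < d -> Rabs (ppow e u) < eps).
  { intros eps H. exists (mkposreal (exp (ln eps / e)) (exp_pos _)). intros u Hu. simpl in Hu.
    destruct (Rlt_dec 0 u) as [U | U].
    - rewrite Rabs_pos_eq in Hu by lra. rewrite Pp, Rabs_pos_eq by (auto; left; apply exp_pos).
      rewrite <- (exp_ln eps) by auto. apply exp_increasing.
      apply Rmult_lt_reg_r with (/ e); [now apply Rinv_0_lt_compat|].
      replace (e * ln u * / e) with (ln u) by (field; lra).
      rewrite <- (ln_exp (ln eps * / e)). apply ln_increasing; auto.
    - rewrite Pn, Rabs_R0; lra. }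
  assert (Dp : 0 < x -> is_derive (ppow e) x (e * ppow e x / x)).
  { intros Hx. apply is_derive_ext_loc with (fun u => exp (e * ln u)).
    - eapply filter_imp; [|exact (locally_above x 0 Hx)]. intros u Hu. symmetry. now apply Pp.
    - rewrite Pp by auto. auto_derive; auto. field. lra. }
  split; [|split; [|split; [|split; [|split]]]]; auto.
  - unfold ppow. destruct Rlt_dec; [left; apply exp_pos | lra].
  - intros Hx. rewrite Pp by auto. apply exp_pos.
  - destruct (Rtotal_order x 0) as [H | [H | H]].
    + apply continuous_ext_loc with (fun _ => 0); [|apply continuous_const].
      eapply filter_imp; [|exact (locally_below x 0 H)]. intros u Hu. symmetry. apply Pn. lra.
    + subst x. apply filterlim_locally. intros eps. rewrite (Pn 0) by lra.
      destruct (Small eps (cond_pos eps)) as [d Hd]. exists d. intros u Hu.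
      change (Rabs (u - 0) < d) in Hu. rewrite Rminus_0_r in Hu.
      change (Rabs (ppow e u - 0) < eps). rewrite Rminus_0_r. auto.
    + apply @ex_derive_continuous. eexists. now apply Dp.
  - destruct (Rtotal_order x 0) as [H | [H | H]].
    + rewrite Pn by lra. rewrite Rmult_0_r. apply is_derive_ext_loc with (fun _ => 0).
      * eapply filter_imp; [|exact (locally_below x 0 H)]. intros u Hu. cbv beta. rewrite Pn; lra.
      * apply @is_derive_const.
    + subst x. rewrite Pn by lra. rewrite Rmult_0_r. apply is_derive_Reals. intros eps Heps.
      destruct (Small eps Heps) as [d Hd]. exists d. intros h Hh Hl.
      rewrite (Pn 0), Rplus_0_l by lra.
      replace ((h * ppow e h - 0 * 0) / h - 0) with (ppow e h) by (field; auto). auto.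
    + evar_last. apply @is_derive_mult; [apply @is_derive_id | now apply Dp | intros; apply Rmult_comm].
      unfold plus, mult, one; simpl. field. lra.
Qed.

(* A positive subsolution on an interval between two of its zeros violates the Hardy inequality
   for any larger constant; the power 1 + e makes it C^1 across the zeros. *)
Lemma hardy_fails_between_zeros (b c c1 p q : R) (y y1 y2 : R -> R) :
  PI <= b -> b <= 2 * PI -> 0 < c1 -> c1 < c -> 0 < p -> p < q -> q < b ->
  (forall t, 0 < t < b -> is_derive y t (y1 t) /\ is_derive y1 t (y2 t)) ->
  y p = 0 -> y q = 0 -> (forall t, p < t < q -> 0 < y t) ->
  (forall t, p < t < q -> - (c1 / sfun b t ^ 2) * y t <= y2 t) ->
  ~ hardy_ineq (Lambda b) c.
Proof.
  intros B1 B2 C1 C2 P0 Ppq Pq Hy Yp Yq Ypos Hsub HI.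
  (* Chosen so that (1 + e) c1 is the midpoint of c1 and c: the exponent raises the constant of the
     subsolution to [c0], still below c. *)
  set (e := (c - c1) / (2 * c1)).
  assert (He : 0 < e) by (apply Rdiv_lt_0_compat; lra).
  set (c0 := (1 + e) * c1).
  assert (Hc0 : c0 < c /\ 0 < c0).
  { unfold c0, e. replace ((1 + (c - c1) / (2 * c1)) * c1) with ((c + c1) / 2) by (field; lra). lra. }
  pose (ps := ppow e).
  pose (f := pw p (fun _ => 0) (pw q (fun t => y t * ps (y t)) (fun _ => 0))).
  pose (f1 := pw p (fun _ => 0) (pw q (fun t => (1 + e) * ps (y t) * y1 t) (fun _ => 0))).
  assert (ps0 : ps 0 = 0) by (apply ppow_spec; lra).
  assert (Cy : forall t, 0 < t < b -> continuous y t).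
  { intros t Ht. apply @ex_derive_continuous. exists (y1 t). exact (proj1 (Hy t Ht)). }
  assert (Cy1 : forall t, 0 < t < b -> continuous y1 t).
  { intros t Ht. apply @ex_derive_continuous. exists (y2 t). exact (proj2 (Hy t Ht)). }
  assert (Cps : forall t, 0 < t < b -> continuous (fun t => ps (y t)) t).
  { intros t Ht. apply (continuous_comp y ps); auto. now apply ppow_spec. }
  assert (Df : forall t, is_derive f t (f1 t)).
  { intros t. apply pw_derive.
    - intros _. apply @is_derive_const.
    - intros H. apply pw_derive.
      + intros H'. assert (Ht : 0 < t < b) by lra.
        destruct (ppow_spec e (y t) He) as (_ & _ & _ & _ & _ & Dx).
        evar_last. exact (is_derive_comp (fun x => x * ps x) y t _ _ Dx (proj1 (Hy t Ht))).
        unfold scal; simpl; unfold mult; simpl. fold ps. ring.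
      + intros _. apply @is_derive_const.
      + rewrite Yq, ps0. ring.
      + rewrite Yq, ps0. ring.
    - rewrite pw_left by lra. rewrite Yp, ps0. ring.
    - rewrite pw_left by lra. rewrite Yp, ps0. ring. }
  assert (Cf1 : forall t, continuous f1 t).
  { intros t. apply pw_continuous.
    - intros _. apply continuous_const.
    - intros H. apply pw_continuous.
      + intros H'. apply (@continuous_mult R_UniformSpace R_AbsRing (fun t => (1 + e) * ps (y t)) y1); [|apply Cy1; lra].
        apply (@continuous_scal_r R_UniformSpace R_AbsRing R_NormedModule (1 + e) (fun t => ps (y t))). apply Cps; lra.
      + intros _. apply continuous_const.
      + rewrite Yq, ps0. ring.
    - rewrite pw_left by lra. rewrite Yp, ps0. ring. }
  assert (Cf : forall t, continuous f t) by (intros t; apply @ex_derive_continuous; eexists; apply Df).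
  assert (Fin : forall t, p <= t <= q -> f t = y t * ps (y t) /\ f1 t = (1 + e) * ps (y t) * y1 t).
  { intros t Ht. unfold f, f1. rewrite !(pw_right p), !pw_left by (try lra; rewrite pw_left, Yp, ps0 by lra; ring). auto. }
  assert (Off : off p q f /\ off p q f1).
  { split; intros t [Ht | Ht]; unfold f, f1.
    - apply pw_left. lra.
    - rewrite pw_right, pw_right by (try lra; try (rewrite pw_left by lra); rewrite ?Yp, ?Yq, ps0; ring). reflexivity.
    - apply pw_left. lra.
    - rewrite pw_right, pw_right by (try lra; try (rewrite pw_left by lra); rewrite ?Yp, ?Yq, ps0; ring). reflexivity. }
  destruct Off as [Of Of1].
  set (r := Rmin (Rmin p (b - q)) (b / 4)).
  assert (Hr : 0 < r /\ r <= p /\ r <= b - q /\ r <= b / 4).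
  { unfold r. pose proof (Rmin_l (Rmin p (b - q)) (b / 4)). pose proof (Rmin_r (Rmin p (b - q)) (b / 4)).
    pose proof (Rmin_l p (b - q)). pose proof (Rmin_r p (b - q)). pose proof PI_RGT_0.
    split; [repeat apply Rmin_pos; lra | lra]. }
  assert (Or : off r (b - r) f) by (intros t Ht; apply Of; lra).
  assert (Pos : 0 <= hardy_form b c f f1).
  { apply hardy_1d_C1 with r; auto; lra. }
  pose (W := fun t => f t ^ 2 / sfun b t ^ 2).
  assert (CW : forall t, continuous W t).
  { apply hardy_weight_continuous with (f := fun t => f t ^ 2) (p := r); auto; try lra.
    - intros; now apply continuous_sqr.
    - intros t Ht. rewrite Or by auto. ring. }
  pose (g := fun t => f1 t ^ 2 + - c0 * W t).
  assert (Cg : forall t, continuous g t) by (intros t; apply continuous_lincomb; auto; now apply continuous_sqr).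
  assert (Ex : forall (h : R -> R) u v, (forall t, continuous h t) -> ex_RInt h u v).
  { intros. apply @ex_RInt_continuous. auto. }
  assert (Og : off p q g).
  { intros t Ht. unfold g, W. rewrite Of, Of1 by auto. unfold Rdiv. ring. }
  assert (Ig : RInt g 0 b = RInt g p q).
  { rewrite <- (RInt_Chasles g 0 p b), <- (RInt_Chasles g p q b) by auto.
    rewrite (RInt_zero_on g 0 p), (RInt_zero_on g q b).
    - unfold plus; simpl; ring.
    - intros t Ht. apply Og. rewrite Rmin_left in Ht by lra. lra.
    - intros t Ht. apply Og. rewrite Rmax_right in Ht by lra. lra. }
  assert (WI : 0 < RInt W 0 b).
  { set (m := (p + q) / 2). assert (Hm : p < m < q) by (unfold m; lra).
    apply RInt_pos_at with m; auto; [lra| |].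
    - intros t. unfold W, Rdiv. apply Rmult_le_pos; [apply pow2_ge_0|].
      destruct (Req_dec (sfun b t ^ 2) 0) as [-> | N]; [rewrite Rinv_0; lra|].
      left. apply Rinv_0_lt_compat. pose proof (pow2_ge_0 (sfun b t)). lra.
    - unfold W. destruct (Fin m) as [-> _]; [lra|]. specialize (Ypos m Hm).
      destruct (sfun_bounds b m B1) as [S0 _]; [lra|].
      assert (0 < ps (y m)) by (now apply ppow_spec).
      apply Rdiv_lt_0_compat; apply pow2_gt_0; nra. }
  (* G is f f1 and vanishes at both zeros of y, so G' integrates to 0, while g <= G' inside. The
     mean value theorem is applied to the difference because the derivative of [ps] is available
     only where y > 0. *)
  pose (G := fun t => (1 + e) * (y t * ps (y t) * (ps (y t) * y1 t))).
  assert (Mono : RInt g p q - G q <= RInt g p p - G p).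
  { destruct (MVT_gen (fun t => RInt g p t - G t) p q (fun t =>
      g t - (1 + e) * ps (y t) ^ 2 * ((1 + 2 * e) * y1 t ^ 2 + y t * y2 t))) as (m & Hm & E).
    - intros t Ht. rewrite Rmin_left, Rmax_right in Ht by lra.
      destruct (Hy t) as [D1 D2]; [lra|]. specialize (Ypos t Ht).
      apply @is_derive_minus.
      + apply (is_derive_RInt g (fun t => RInt g p t) p t); auto. apply filter_forall. intros x.
        apply @RInt_correct; auto.
      + assert (Dps : is_derive (fun t => ps (y t)) t (e * ps (y t) / y t * y1 t)).
        { destruct (ppow_spec e (y t) He) as (_ & _ & _ & _ & Dx & _). specialize (Dx Ypos).
          evar_last. exact (is_derive_comp ps y t _ _ Dx D1).
          unfold scal; simpl; unfold mult; simpl. unfold ps. ring. }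
        evar_last.
        * apply @is_derive_scal. apply @is_derive_mult; [| |intros; apply Rmult_comm].
          apply @is_derive_mult; [exact D1 | exact Dps | intros; apply Rmult_comm].
          apply @is_derive_mult; [exact Dps | exact D2 | intros; apply Rmult_comm].
        * unfold plus, mult, scal; simpl; unfold mult; simpl. field. lra.
    - intros t Ht. rewrite Rmin_left, Rmax_right in Ht by lra. apply continuity_pt_filterlim.
      apply (@continuous_minus R_UniformSpace R_AbsRing R_NormedModule (fun t => RInt g p t) G).
      + apply @ex_derive_continuous. exists (g t). apply (is_derive_RInt g (fun t => RInt g p t) p t); auto.
        apply filter_forall. intros x. apply @RInt_correct; auto.
      + apply (@continuous_scal_r R_UniformSpace R_AbsRing R_NormedModule (1 + e) (fun t => y t * ps (y t) * (ps (y t) * y1 t))).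
        apply (@continuous_mult R_UniformSpace R_AbsRing (fun t => y t * ps (y t)) (fun t => ps (y t) * y1 t)).
        * apply (@continuous_mult R_UniformSpace R_AbsRing y (fun t => ps (y t))); [apply Cy | apply Cps]; lra.
        * apply (@continuous_mult R_UniformSpace R_AbsRing (fun t => ps (y t)) y1); [apply Cps | apply Cy1]; lra.
    - rewrite Rmin_left, Rmax_right in Hm by lra.
      assert (D : g m - (1 + e) * ps (y m) ^ 2 * ((1 + 2 * e) * y1 m ^ 2 + y m * y2 m) <= 0).
      { unfold g, W. destruct (Fin m Hm) as [-> ->].
        destruct (Req_dec (ps (y m)) 0) as [Z | Z]; [rewrite Z; unfold Rdiv; right; ring|].
        assert (Hm' : p < m < q).
        { split; apply Rnot_le_lt; intros K; apply Z.
          - replace m with p by lra. now rewrite Yp.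
          - replace m with q by lra. now rewrite Yq. }
        specialize (Hsub m Hm'). specialize (Ypos m Hm').
        destruct (sfun_bounds b m B1) as [S0 _]; [lra|].
        replace (((1 + e) * ps (y m) * y1 m) ^ 2 + - c0 * ((y m * ps (y m)) ^ 2 / sfun b m ^ 2) -
           (1 + e) * ps (y m) ^ 2 * ((1 + 2 * e) * y1 m ^ 2 + y m * y2 m))
          with ((1 + e) * ps (y m) ^ 2 * (- e * y1 m ^ 2 + y m * (- (c1 / sfun b m ^ 2) * y m - y2 m)))
          by (unfold c0; field; lra).
        assert (0 <= (1 + e) * ps (y m) ^ 2) by (apply Rmult_le_pos; [lra | apply pow2_ge_0]).
        assert (0 <= e * y1 m ^ 2) by (apply Rmult_le_pos; [lra | apply pow2_ge_0]).
        assert (0 <= y m * - (- (c1 / sfun b m ^ 2) * y m - y2 m)) by (apply Rmult_le_pos; lra).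
        assert (S : forall u v, 0 <= u -> v <= 0 -> u * v <= 0) by (clear; intros; nra).
        apply S; auto. lra. }
      assert (S : forall u v, u <= 0 -> 0 <= v -> u * v <= 0) by (clear; intros; nra).
      specialize (S _ (q - p) D ltac:(lra)). lra. }
  rewrite RInt_point in Mono. unfold G in Mono. rewrite Yp, Yq in Mono. unfold zero in Mono; simpl in Mono.
  assert (Spl : hardy_form b c f f1 = RInt g 0 b + - (c - c0) * RInt W 0 b).
  { assert (Q : is_RInt (fun t => plus (g t) (scal (- (c - c0)) (W t))) 0 b
       (plus (RInt g 0 b) (scal (- (c - c0)) (RInt W 0 b)))).
    { apply @is_RInt_plus; [|apply @is_RInt_scal]; apply @RInt_correct; auto. }
    apply (@is_RInt_unique R_CompleteNormedModule) in Q.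
    change (plus (RInt g 0 b) (scal (- (c - c0)) (RInt W 0 b))) with (RInt g 0 b + - (c - c0) * RInt W 0 b) in Q.
    rewrite <- Q. apply RInt_ext. intros t _. unfold g, W, plus, scal; simpl; unfold mult; simpl. ring. }
  rewrite Ig in Spl.
  assert (0 < (c - c0) * RInt W 0 b) by (apply Rmult_lt_0_compat; lra). lra.
Qed.

(** For c > 1/4 the Euler equation y'' + (1/4 + mu^2) y / t^2 = 0 oscillates at 0: sqrt t sin (mu ln
    t) has the consecutive zeros exp (-2 PI / mu) and exp (- PI / mu), and is positive between them.
    As sin t < t, it is a subsolution for the weight 1 / sin^2; the choice of mu makes 1/4 + mu^2
    smaller than c. *)
Lemma hardy_Lambda_le_quarter (b c : R) :
  PI <= b -> b <= 2 * PI -> hardy_ineq (Lambda b) c -> c <= 1 / 4.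
Proof.
  intros B1 B2 HI. apply Rnot_lt_le. intros N. pose proof PI_RGT_0 as HPI.
  set (mu := sqrt ((c - 1 / 4) / 2)).
  assert (Hmu : 0 < mu) by (apply sqrt_lt_R0; lra).
  assert (Emu : mu ^ 2 = (c - 1 / 4) / 2) by (unfold mu; rewrite pow2_sqrt; lra).
  assert (M1 : exp (- PI / mu) < 1).
  { rewrite <- exp_0. apply exp_increasing. apply Rmult_lt_reg_r with mu; auto.
    replace (- PI / mu * mu) with (- PI) by (field; lra). lra. }
  assert (M2 : exp (-2 * PI / mu) < exp (- PI / mu)).
  { apply exp_increasing. apply Rmult_lt_reg_r with mu; auto.
    replace (-2 * PI / mu * mu) with (-2 * PI) by (field; lra).
    replace (- PI / mu * mu) with (- PI) by (field; lra). lra. }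
  pose proof PI2_1 as HP2.
  pose (y := fun t => exp (ln t / 2) * sin (mu * ln t)).
  assert (Ypos : forall t, exp (-2 * PI / mu) < t < exp (- PI / mu) -> 0 < y t).
  { intros t [T1 T2]. pose proof (exp_pos (-2 * PI / mu)).
    assert (T0 : 0 < t) by lra.
    apply ln_increasing in T1, T2; try lra. rewrite ln_exp in T1, T2.
    unfold y. apply Rmult_lt_0_compat; [apply exp_pos|].
    rewrite <- (sin_period (mu * ln t) 1). simpl INR.
    apply Rmult_lt_compat_l with (r := mu) in T1, T2; auto.
    replace (mu * (-2 * PI / mu)) with (-2 * PI) in T1 by (field; lra).
    replace (mu * (- PI / mu)) with (- PI) in T2 by (field; lra).
    apply sin_gt_0; lra. }
  apply (hardy_fails_between_zeros b c (1 / 4 + mu ^ 2) (exp (-2 * PI / mu)) (exp (- PI / mu)) y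
    (fun t => exp (ln t / 2) * (sin (mu * ln t) / 2 + mu * cos (mu * ln t)) / t)
    (fun t => - (1 / 4 + mu ^ 2) * y t / t ^ 2)); auto; try lra.
  - apply exp_pos.
  - intros t Ht. unfold y, Rdiv. split; auto_derive; repeat split; try lra; field; lra.
  - unfold y. rewrite ln_exp. replace (mu * (-2 * PI / mu)) with (- (2 * PI)) by (field; lra).
    rewrite sin_neg, sin_2PI. ring.
  - unfold y. rewrite ln_exp. replace (mu * (- PI / mu)) with (- PI) by (field; lra).
    rewrite sin_neg, sin_PI. ring.
  - intros t Ht. pose proof (Ypos t Ht). pose proof (exp_pos (-2 * PI / mu)).
    rewrite sfun_left by lra.
    assert (St : sin t < t) by (apply sin_lt_x; lra).
    assert (S0 : 0 < sin t) by (apply sin_gt_0; lra).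
    assert (I : / t ^ 2 <= / sin t ^ 2) by (apply Rinv_le_contravar; [nra | apply pow_incr; lra]).
    assert (K : (1 / 4 + mu ^ 2) * y t * / t ^ 2 <= (1 / 4 + mu ^ 2) * y t * / sin t ^ 2).
    { apply Rmult_le_compat_l; auto. apply Rmult_le_pos; [nra | lra]. }
    unfold Rdiv. lra.
Qed.

(** * Transfer of constants from the sector to E *)

Lemma hardy_ineq_mono (Om : pt -> Prop) (c c' : R) :
  c' <= c -> hardy_ineq Om c -> hardy_ineq Om c'.
Proof.
  intros H HI u D HD HK I1 I2 H1 H2. specialize (HI u D HD HK I1 I2 H1 H2).
  assert (0 <= I2); [|nra].
  destruct (Int2_eventually _ _ H2) as (M & HM & Q). destruct (Q M (Rle_refl M)) as (_ & Q2 & <-).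
  rewrite <- (iint_zero M). apply iint_le; auto.
  - apply box_integrable_continuous. intros; apply continuous_const.
  - intros z. unfold Rdiv. apply Rmult_le_pos; [apply pow2_ge_0|].
    (* Where the distance vanishes the weight takes the default value / 0 = 0, so it is nonnegative
       everywhere. *)
    destruct (Req_dec (dist_bd Om z ^ 2) 0) as [-> | N]; [rewrite Rinv_0; lra|].
    left. apply Rinv_0_lt_compat. pose proof (pow2_ge_0 (dist_bd Om z)). lra.
Qed.

Lemma hardy_ineq_Lambda_E (b g c c' : R) :
  0 < g -> g <= PI -> PI <= b -> b <= 2 * PI -> 0 < c' -> c' < c ->
  hardy_ineq (Lambda b) c -> hardy_ineq (E b g) c'.
Proof.
  intros G1 G2 B1 B2 H0 H1 HI.
  pose proof (hardy_Lambda_le_quarter b c B1 B2 HI) as Q.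
  set (c1 := (c + c') / 2). assert (C1 : c' < c1 < c) by (unfold c1; lra).
  set (k := sqrt c1). assert (Hk : 0 < k) by (apply sqrt_lt_R0; lra).
  assert (Ek : k ^ 2 = c1) by (unfold k; rewrite pow2_sqrt; lra).
  assert (Hk2 : k <= 1 / 2) by nra.
  (* A root of a (1 - a) = c1, real because c1 < c <= 1/4; it is the exponent in the factor sin^a of
     Y. *)
  set (a := (1 + sqrt (1 - 4 * c1)) / 2).
  assert (S0 : 0 <= sqrt (1 - 4 * c1)) by apply sqrt_pos.
  assert (S1 : sqrt (1 - 4 * c1) ^ 2 = 1 - 4 * c1) by (rewrite pow2_sqrt; lra).
  assert (Ha : 0 <= a <= 1) by (unfold a; nra).
  assert (Ea : k ^ 2 = a * (1 - a)) by (rewrite Ek; unfold a; nra).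
  destruct (angular_solution_exists b a k B1 B2 Ha Hk Ea) as (Y & Y1 & HY).
  destruct (angular_dichotomy b k Y Y1 B1 B2 HY) as [P | (p & Hp & Yp & P)].
  (* Since (1 - 2e)^2 >= 1 - 4e, this e leaves a constant of at least c1 (1 - 4e) = c'; c' > 0 gives
     e < 1/4. *)
  - set (e := (c1 - c') / (4 * c1)).
    assert (Ee : 4 * (c1 * e) = c1 - c') by (unfold e; field; lra).
    apply hardy_ineq_mono with (k ^ 2 * (1 - 2 * e) ^ 2).
    + rewrite Ek. pose proof (pow2_ge_0 e). nra.
    + assert (He : 0 < e < 1 / 4) by (split; nra).
      apply hardy_ineq_E_of_positive_solution with Y Y1; auto; lra.
  - exfalso. destruct HY as (HY1 & HY2 & _). pose proof PI_RGT_0.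
    apply (hardy_fails_between_zeros b c c1 p (b - p) Y Y1 (fun t => - (k ^ 2 / sfun b t ^ 2) * Y t)); auto; try lra.
    + destruct (HY2 p) as [-> _]; lra.
    + intros t Ht. rewrite Ek. lra.
Qed.

Theorem theorem2 (beta gamma : R) :
  0 < gamma -> gamma <= PI -> PI <= beta -> beta <= 2 * PI ->
  forall cb : R, hardy_constant (Lambda beta) cb <-> hardy_constant (E beta gamma) cb.
Proof.
  intros G1 G2 B1 B2 cb. apply hardy_constant_eq.
  - intros c. now apply hardy_ineq_E_Lambda.
  - intros c c' H1 H2. now apply hardy_ineq_Lambda_E.
Qed.
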